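(* Let $W$ be a finite Coxeter group. Then the Coxeter arrangement $\mathscr{A}(W)$ is accurate.
   Context: The Coxeter arrangement $\mathscr{A}(W)$ of a finite Coxeter group $W$ is the arrangement, in the (real, $\ell$-dimensional) reflection representation $V$ of $W$, consisting of the reflecting hyperplanes of all reflections in $W$. For an arrangement $\mathscr{A}$ (finite set of linear hyperplanes) in $V\cong\mathbb{K}^\ell$, $L(\mathscr{A})$ is the set of all intersections of subsets of $\mathscr{A}$ (the empty intersection is $V$); for $X\in L(\mathscr{A})$ the restriction is $\mathscr{A}^X=\{H\cap X\mid H\in\mathscr{A},H\not\supseteq X\}$, an arrangement in $X$. Let $S=\mathrm{Sym}(V^* )\cong\mathbb{K}[x_1,\dots,x_\ell]$ and $H=\ker\alpha_H$. $D(\mathscr{A})=\{\theta\in\mathrm{Der}_{\mathbb{K}}(S)\mid\theta(\alpha_H)\in\alpha_HS\text{ for all }H\in\mathscr{A}\}$. $\theta=\sum f_i\,\partial/\partial x_i$ is homogeneous of degree $p$ if all $f_i$ are homogeneous of degree $p$ (or zero). $\mathscr{A}$ is free if $D(\mathscr{A})$ is a free $S$-module; its exponents are the degrees of a homogeneous basis of $D(\mathscr{A})$. Accurate: $\mathscr{A}$ is free with exponents $e_1\le e_2\le\dots\le e_\ell$, and for every integer $1\le d\le\ell$ there is $X\in L(\mathscr{A})$ with $\dim X=d$ such that $\mathscr{A}^X$ is free with exponents $e_1\le\dots\le e_d$. *)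

(* Defs.v *)
From HB Require Import structures.
From mathcomp Require Import all_boot all_order all_algebra all_fingroup.
From mathcomp Require Import mxrepresentation finmap mpoly.
From mathcomp Require Import reals trigo.

Set Implicit Arguments.
Unset Strict Implicit.
Unset Printing Implicit Defensive.

Import GRing.Theory.
Local Open Scope fset_scope.
Local Open Scope ring_scope.

Definition is_hyperplane (K : fieldType) (V : vectType K) (H : {vspace V}) :
    bool :=
  (\dim H).+1 == \dim {:V}.

Section Arrangements.
Variables (K : fieldType) (V : vectType K).

Record arrangement := Arrangement {
  hyperplanes :> {fset {vspace V}};
  hyperplanesP : {in hyperplanes, forall H, is_hyperplane H}
}.

Definition intersection_lattice (A : arrangement) : {fset {vspace V}} :=
  [fset (\bigcap_(H <- enum_fset B) H)%VS
     | B : {fset {vspace V}} in fpowerset (hyperplanes A)].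

(* The intersection of H and X, seen in the vector space X. *)
Definition hyperplane_trace (X H : {vspace V}) : {vspace subvs_of X} :=
  (linfun (@vsval K V X) @^-1: H)%VS.

Lemma hyperplane_traceP (X H : {vspace V}) :
  is_hyperplane H -> ~~ (X <= H)%VS -> is_hyperplane (hyperplane_trace X H).
Proof.
rewrite /is_hyperplane => /eqP dH XH.
have limgX : limg (linfun (@vsval K V X)) = X.
  apply/vspaceP => v; apply/memv_imgP/idP => [[u _ ->]|vX].
    by rewrite lfunE /=; apply: subvsP.
  by exists (vsproj X v); rewrite ?memvf // lfunE /= vsprojK.
have ker0 : lker (linfun (@vsval K V X)) = 0%VS.
  apply/eqP/lker0P => u v; rewrite !lfunE /=; exact: val_inj.
have -> : \dim (hyperplane_trace X H) = \dim (H :&: X)%VS.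
  rewrite /hyperplane_trace -lpreim_cap_limg.
  rewrite -(@limg_dim_eq _ _ _ (linfun (@vsval K V X))) ?ker0 ?capv0 //.
  by rewrite lpreimK ?capvSr // limgX.
have -> : \dim {:subvs_of X} = \dim X by rewrite dimvf.
have sum : (H + X)%VS = {:V}%VS.
  apply/eqP; rewrite eqEdim subvf /= -dH.
  rewrite ltnNge; apply: contra XH => le.
  have /eqP -> : H == (H + X)%VS by rewrite eqEdim addvSl.
  exact: addvSr.
have := dimv_sum_cap H X; rewrite sum -dH addSn -addnS.
by move/eqP; rewrite eqn_add2l.
Qed.

Lemma restriction_subproof (A : arrangement) (X : {vspace V}) :
  {in [fset hyperplane_trace X H | H in hyperplanes A & ~~ (X <= H)%VS],
    forall H, is_hyperplane H}.
Proof.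
move=> _ /imfsetP [H /= /andP [HA XH] ->].
exact: hyperplane_traceP (hyperplanesP HA) XH.
Qed.

End Arrangements.

Definition restriction (K : fieldType) (V : vectType K) (A : arrangement V)
    (X : {vspace V}) : arrangement (subvs_of X) :=
  Arrangement (@restriction_subproof K V A X).

Section LogarithmicDerivations.
Variables (K : fieldType) (V : vectType K).

(* The symmetric algebra of the dual of V, with 'X_i the i-th coordinate in the
   basis [vbasis {:V}]. *)
Definition symV := {mpoly K[\dim {:V}]}.

Definition linear_form (alpha : 'Hom(V, K^o)) : symV :=
  \sum_(i < \dim {:V}) (alpha (vbasis {:V})`_i : K) *: 'X_i.

Definition derivation (theta : symV -> symV) : Prop :=
  linear theta /\ forall p q, theta (p * q) = theta p * q + p * theta q.

(* As theta = \sum_i theta 'X_i * d/dx_i; by dhomog0, 0 is p.-homog. *)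
Definition homogeneous_derivation (p : nat) (theta : symV -> symV) : Prop :=
  forall i : 'I_(\dim {:V}), theta 'X_i \is p.-homog.

(* All the linear forms with kernel H are proportional. *)
Definition log_derivation (A : arrangement V) (theta : symV -> symV) : Prop :=
  derivation theta /\
  forall H, H \in hyperplanes A ->
  forall alpha : 'Hom(V, K^o), lker alpha = H ->
  exists q, theta (linear_form alpha) = linear_form alpha * q.

Definition log_derivation_basis (A : arrangement V) (r : nat)
    (thetas : 'I_r -> symV -> symV) : Prop :=
  (forall i, log_derivation A (thetas i)) /\
  forall theta, log_derivation A theta ->
  exists! c : {ffun 'I_r -> symV},
    forall p, theta p = \sum_i c i * thetas i p.

Definition free_with_exponents (A : arrangement V) (e : seq nat) : Prop :=
  exists thetas : 'I_(size e) -> symV -> symV,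
    log_derivation_basis A thetas /\
    forall i : 'I_(size e), homogeneous_derivation (nth 0%N e i) (thetas i).

End LogarithmicDerivations.

Definition accurate (K : fieldType) (V : vectType K) (A : arrangement V) :
    Prop :=
  exists e : (\dim {:V}).-tuple nat,
    [/\ sorted leq e,
        free_with_exponents A e
      & forall d : nat, (1 <= d <= \dim {:V})%N ->
        exists X : {vspace V},
          [/\ X \in intersection_lattice A,
              \dim X = d
            & free_with_exponents (restriction A X) (take d e)]].

Section CoxeterGroups.
Variable n : nat.

(* The entry 0 stands for infinity. *)
Definition coxeter_matrix (m : 'M[nat]_n) : Prop :=
  (forall i, m i i = 1%N) /\
  (forall i j, i != j -> m i j = m j i /\ m i j != 1%N).

Definition coxeter_relations (m : 'M[nat]_n) (G : groupType) (s : 'I_n -> G) :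
    Prop :=
  forall i j, ((s i * s j) ^+ m i j = 1)%g.

(* W is presented by the generators s and the relations of m. *)
Definition coxeter_system (W : finGroupType) (m : 'M[nat]_n) (s : 'I_n -> W) :
    Prop :=
  [/\ coxeter_matrix m,
      coxeter_relations m s,
      <<[set s i | i : 'I_n]>>%g = [set: W]
    & forall (G : groupType) (g : 'I_n -> G), coxeter_relations m g ->
      exists f : W -> G,
        {morph f : x y / (x * y)%g} /\ forall i, f (s i) = g i].

Variable R : realType.

(* If m i j = 0, the entry is - cos 0 = -1, the usual value for infinity. *)
Definition coxeter_form (m : 'M[nat]_n) : 'M[R]_n :=
  \matrix_(i, j) - cos (pi / (m i j)%:R).

(* v *m simple_reflection m i = v - 2 B(v, alpha_i) alpha_i, for
   alpha_i = delta_mx 0 i and B the bilinear form of matrix coxeter_form m. *)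
Definition simple_reflection (m : 'M[nat]_n) (i : 'I_n) : 'M[R]_n :=
  1%:M - 2 *: (col i (coxeter_form m) *m delta_mx 0 i).

Variable W : finGroupType.

Definition reflection_representation (m : 'M[nat]_n) (s : 'I_n -> W)
    (rho : mx_representation R [set: W] n) : Prop :=
  forall i, rho (s i) = simple_reflection m i.

Variable rho : mx_representation R [set: W] n.

Definition fixed_space (w : W) : {vspace 'rV[R]_n} :=
  fixedSpace (linfun (mulmxr (rho w))).

Definition reflections : {set W} :=
  [set w | is_hyperplane (fixed_space w) && (rho w *m rho w == 1%:M)].

Lemma coxeter_arrangement_subproof :
  {in [fset fixed_space w | w in reflections],
    forall H, is_hyperplane H}.
Proof. by move=> _ /imfsetP [w wP ->]; move: wP; rewrite /= inE => /andP []. Qed.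

Definition coxeter_arrangement : arrangement 'rV[R]_n :=
  Arrangement coxeter_arrangement_subproof.

End CoxeterGroups.

(* Main.v *)
(* Give each form of a family of linear forms a height, and add the forms level
   by level.  If every level is free, no lower form lies in its span, and the
   number of lower forms exceeds the number of planes through a form of height k
   and a lower form by k - 1, then the arrangement is free (multiple addition
   theorem): at a point common to the new hyperplanes and off the old ones, a
   constant recombination of a basis of the logarithmic derivations makes all but
   q members tangent to the q new hyperplanes, and the remaining ones, which have
   the top degree, are multiplied by the new forms.  A nonzero minor of that
   recombination selects c hyperplanes of one level on whose intersection X the
   l - c members of smallest degrees are tangent and independent; the restriction
   to X has at least as many hyperplanes as the sum of these degrees, so that
   they form a basis of its logarithmic derivations by Saito's criterion.

   The reflecting hyperplanes of a Coxeter group are the orthogonals of its roots,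
   because the product of the root forms is skew.  For a crystallographic root
   system the positive roots with their usual heights satisfy the hypotheses: two
   roots of the same height form an obtuse angle, the height is half the pairing
   with the sum of the positive coroots, and both this pairing and the count of
   planes split over the planes through a root.  For dihedral groups the heights
   1, 1, 2, 3, ... work, and for H3 and H4 a suitable choice of heights is checked
   by computation in Z[phi].  Positive definiteness shows that a Coxeter graph with
   a label other than 2, 3, 4, 6 has such a component, and direct sums preserve
   the hypotheses. *)

From HB Require Import structures.
From mathcomp Require Import all_boot all_order all_algebra all_fingroup.
From mathcomp Require Import mxrepresentation mpoly finmap boolp reals trigo.
From mathcomp Require Import ring lra zify ssrZ.
Require Import Defs.

Set Implicit Arguments.
Unset Strict Implicit.
Unset Printing Implicit Defensive.

Import Order.TTheory GRing.Theory Num.Theory.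
Local Open Scope ring_scope.

(** * Linear forms *)

(** Tangency can be tested at one point because of a bound for pencils of planes. On the kernel of a
    new form, a derivation applied to this form vanishes along each trace of old hyperplanes, to
    order one less than the number of old hyperplanes with that trace. Restricted to a line, this
    bounds the degree of a derivation that is not tangent below by the number of old forms minus the
    number of planes, that is by k - 1. So members of degree less than k - 1 are tangent to all new
    hyperplanes, and one of degree k - 1 is tangent as soon as its value at the chosen point
    vanishes. For accuracy the difficulty is to keep the smallest degrees on a flat. The c
    hyperplanes are therefore taken from the last level that has at least c forms: the c members
    given up have degree k, and all those raised later are among them. A label 5 puts the square of
    the golden ratio in the place of a product of two Cartan integers, so no choice of root lengths
    gives a crystallographic system. This is why H3 and H4 need explicit heights. *)

Definition noncollinear (K : fieldType) (E : vectType K) (s : seq E) : bool :=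
  (0 \notin s) && uniq [seq <[a]>%VS | a <- s].

Section Noncollinear.
Variables (K : fieldType) (E : vectType K).
Implicit Types (a b : E) (s : seq E).

Lemma vline_eq a b : a != 0 -> (<[a]> == <[b]>)%VS = (a \in <[b]>%VS).
Proof.
move=> a0; apply/eqP/idP => [<-|ab]; first exact: memv_line.
apply/eqP; rewrite eqEdim -memvE ab dim_vline dim_vline a0.
by case: (b != 0).
Qed.

Lemma noncollinear_cons a s :
  noncollinear (a :: s) =
  [&& a != 0, all (fun b => b \notin <[a]>%VS) s & noncollinear s].
Proof.
rewrite /noncollinear /= in_cons negb_or eq_sym.
case a0: (a != 0) => //=; case s0: (0 \notin s) => /=; last first.
  by rewrite andbF.
congr (_ && _); apply/idP/allP => [H b bs|H].
  apply: contra H => ba; apply/mapP; exists b => //; apply/esym/eqP.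
  by rewrite vline_eq // (memPn s0).
by apply/mapP => -[b bs e]; move: (H _ bs); rewrite e memv_line.
Qed.

Lemma map_uniq_in (T1 T2 : eqType) (f : T1 -> T2) (s : seq T1) x y :
  uniq [seq f x | x <- s] -> x \in s -> y \in s -> f x = f y -> x = y.
Proof.
elim: s => //= a s IH /andP [nf us]; rewrite !in_cons.
case/predU1P => [->|xs] /predU1P [->|ys] // e; last exact: IH.
  by case/negP: nf; rewrite e map_f.
by case/negP: nf; rewrite -e map_f.
Qed.

Lemma noncollinear_neq0 s a : noncollinear s -> a \in s -> a != 0.
Proof. by case/andP => /memPn h _; apply: h. Qed.

Lemma noncollinear_uniq s : noncollinear s -> uniq s.
Proof. by case/andP => _ /map_uniq. Qed.

Lemma noncollinear_notin s a b :
  noncollinear s -> a \in s -> b \in s -> a != b -> b \notin <[a]>%VS.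
Proof.
move=> ns sa sb; apply: contra => ba.
case/andP: ns => s0 us; apply/eqP/(map_uniq_in us sa sb)/esym/eqP.
by rewrite vline_eq // (memPn s0).
Qed.

Lemma noncollinear_filter (p : pred E) s : noncollinear s -> noncollinear (filter p s).
Proof.
elim: s => //= a s IH; rewrite noncollinear_cons => /and3P [a0 /allP h ns].
case: ifP => _; last exact: IH.
rewrite noncollinear_cons a0 IH // andbT; apply/allP => b.
by rewrite mem_filter => /andP [_ /h].
Qed.

Lemma noncollinear_perm s t : perm_eq s t -> noncollinear s = noncollinear t.
Proof.
move=> st; rewrite /noncollinear (perm_mem st).
by rewrite (perm_uniq (perm_map _ st)).
Qed.

End Noncollinear.

Section LinearForms.
Variables (K : fieldType) (l : nat).
Notation S := {mpoly K[l]}.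
Implicit Types (a b : 'cV[K]_l) (z v : 'rV[K]_l) (p q : S).

Definition lin a : S := \sum_i a i 0 *: 'X_i.

Definition ev v a : K := (v *m a) 0 0.

Definition mdvd p q : Prop := exists r, q = p * r.

Lemma lin_is_linear : linear lin.
Proof.
move=> k a b; rewrite /lin scaler_sumr -big_split /=; apply: eq_bigr => i _.
by rewrite !mxE scalerDl scalerA.
Qed.
HB.instance Definition _ := GRing.isLinear.Build K 'cV[K]_l S *:%R lin lin_is_linear.

Lemma evE v a : ev v a = \sum_i v 0 i * a i 0.
Proof. by rewrite /ev mxE. Qed.

Lemma meval_lin v a : (lin a).@[v 0] = ev v a.
Proof.
rewrite evE /lin raddf_sum; apply: eq_bigr => i _ /=.
by rewrite mevalZ mevalXU mulrC.
Qed.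

Lemma evDl v z a : ev (v + z) a = ev v a + ev z a.
Proof. by rewrite /ev mulmxDl mxE. Qed.
Lemma evZl k v a : ev (k *: v) a = k * ev v a.
Proof. by rewrite /ev -scalemxAl mxE. Qed.
Lemma evDr v a b : ev v (a + b) = ev v a + ev v b.
Proof. by rewrite /ev mulmxDr mxE. Qed.
Lemma evZr k v a : ev v (k *: a) = k * ev v a.
Proof. by rewrite /ev -scalemxAr mxE. Qed.
Lemma ev0r v : ev v 0 = 0.
Proof. by rewrite /ev mulmx0 mxE. Qed.
Lemma ev0l a : ev 0 a = 0.
Proof. by rewrite /ev mul0mx mxE. Qed.
Lemma evNr v a : ev v (- a) = - ev v a.
Proof. by rewrite /ev mulmxN mxE. Qed.
Lemma evBr v a b : ev v (a - b) = ev v a - ev v b.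
Proof. by rewrite evDr evNr. Qed.

Lemma exists_ev1 a : a != 0 -> exists z, ev z a = 1.
Proof.
move=> a0; have [i ai] : exists i, a i 0 != 0.
  apply/existsP; apply: contraNT a0 => /existsPn h; apply/eqP/matrixP => i j.
  by rewrite mxE ord1; apply/eqP; rewrite -[_ == _]negbK h.
exists ((a i 0)^-1 *: delta_mx 0 i); rewrite evZl.
rewrite /ev -rowE mxE mulVf //.
Qed.

Lemma lin_homog a : lin a \is 1.-homog.
Proof.
rewrite /lin rpred_sum // => i _; apply: rpredZ.
by rewrite dhomogX /= mdeg1.
Qed.

Lemma lin_eq0 a : (lin a == 0) = (a == 0).
Proof.
apply/eqP/eqP => [e|->]; last by rewrite linear0.
have [//|a0] := eqVneq a 0.
have [z ez] := exists_ev1 a0.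
by move: (meval_lin z a); rewrite e meval0 ez => /eqP; rewrite eq_sym oner_eq0.
Qed.

Section Substitution.
Variables (a : 'cV[K]_l) (z : 'rV[K]_l).
Hypothesis az : ev z a = 1.

(** The coordinates of [v - ev v a *: z], the projection onto the kernel of [a] along [z]. *)
Definition proj_tuple : l.-tuple S := [tuple 'X_i - z 0 i *: lin a | i < l].

Lemma proj_lin b : lin b \mPo proj_tuple = lin (b - ev z b *: a).
Proof.
rewrite linearB linearZ /= {1}/lin raddf_sum /=.
under eq_bigr => i _ do rewrite comp_mpolyZ comp_mpolyXU -tnth_nth tnth_mktuple scalerBr scalerA.
rewrite sumrB; congr (_ - _).
rewrite -scaler_suml; congr (_ *: _).
by rewrite evE; apply: eq_bigr => i _; rewrite mulrC.
Qed.

Lemma proj_lin0 : lin a \mPo proj_tuple = 0.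
Proof. by rewrite proj_lin az scale1r subrr linear0. Qed.

Lemma proj_cong p : mdvd (lin a) (p - (p \mPo proj_tuple)).
Proof.
pose cg (x y : S) := mdvd (lin a) (x - y).
have cgM x y x' y' : cg x y -> cg x' y' -> cg (x * x') (y * y').
  move=> [r er] [r' er']; exists (r * x' + y * r').
  have -> : x * x' - y * y' = (x - y) * x' + y * (x' - y').
    by rewrite mulrBl mulrBr addrA subrK.
  by rewrite er er' mulrDr !mulrA [y * lin a]mulrC.
have cg0 x : cg x x by exists 0; rewrite subrr mulr0.
have cgX x y k : cg x y -> cg (x ^+ k) (y ^+ k).
  by move=> h; elim: k => [|k IH]; rewrite ?expr0 // !exprS; apply: cgM.
rewrite -/(cg p (p \mPo proj_tuple)); elim/mpolyind: p => [|c m p _ _ IH].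
  by rewrite raddf0; apply: cg0.
rewrite raddfD /= linearZ /=.
have [r er] : cg 'X_[m] ('X_[m] \mPo proj_tuple).
  rewrite mpolyXE_id rmorph_prod /=; apply: big_ind2; first exact: cg0.
    by move=> *; apply: cgM.
  move=> i _; rewrite rmorphXn /=; apply: cgX.
  rewrite comp_mpolyXU -tnth_nth tnth_mktuple; exists (z 0 i)%:MP.
  by rewrite opprB addrC subrK mulrC mul_mpolyC.
case: IH => r' er'; exists (c *: r + r').
by rewrite opprD addrACA -scalerBr er er' mulrDr scalerAr.
Qed.

(** The substitution realizes the quotient by [lin a] inside the polynomial ring, a domain; this
    gives primality and a decidable test. *)
Lemma lin_dvdP p : mdvd (lin a) p <-> p \mPo proj_tuple = 0.
Proof.
split=> [[r ->]|e]; first by rewrite rmorphM /= proj_lin0 mul0r.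
by have := proj_cong p; rewrite e subr0.
Qed.

End Substitution.

Lemma lin_prime a p q : a != 0 -> mdvd (lin a) (p * q) ->
  mdvd (lin a) p \/ mdvd (lin a) q.
Proof.
case/exists_ev1 => z az /(lin_dvdP az).
by rewrite rmorphM => /eqP; rewrite mulf_eq0 => /orP [] /eqP /(lin_dvdP az); auto.
Qed.

Lemma lin_dvd_lin a b : a != 0 -> mdvd (lin a) (lin b) -> b \in <[a]>%VS.
Proof.
case/exists_ev1 => z az /(lin_dvdP az) /eqP.
rewrite proj_lin lin_eq0 subr_eq0 => /eqP ->.
by rewrite memvZ ?memv_line.
Qed.

Definition pi_lin (s : seq 'cV[K]_l) : S := \prod_(a <- s) lin a.

Lemma prod_lin_dvd s p : noncollinear s ->
  (forall a, a \in s -> mdvd (lin a) p) -> mdvd (pi_lin s) p.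
Proof.
rewrite /pi_lin; elim: s p => [|a s IH] p.
  by move=> _ _; exists p; rewrite big_nil mul1r.
rewrite noncollinear_cons => /and3P [a0 /allP na ns] h.
have [|r er] := h a; first by rewrite mem_head.
have [b bs|r' er'] := IH r ns; last first.
  by exists r'; rewrite big_cons -mulrA -er'.
have b0 := noncollinear_neq0 ns bs.
have hb : mdvd (lin b) (lin a * r) by rewrite -er; apply: h; rewrite in_cons bs orbT.
case: (lin_prime b0 hb) => //.
  move=> /(lin_dvd_lin b0) ab; case/negP: (na _ bs).
  by move: ab; rewrite -!vline_eq // eq_sym.
Qed.

Lemma pi_lin_neq0 s : noncollinear s -> pi_lin s != 0.
Proof.
move=> ns; rewrite prodf_seq_neq0; apply/allP => a sa.
by rewrite lin_eq0 (noncollinear_neq0 ns sa).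
Qed.

Lemma homog_prod_seq (T : Type) (s : seq T) (F : T -> S) (d : T -> nat) :
  (forall i, F i \is (d i).-homog) ->
  \prod_(i <- s) F i \is (\sum_(i <- s) d i)%N.-homog.
Proof.
move=> h; elim: s => [|x s IH]; first by rewrite !big_nil dhomog1.
by rewrite !big_cons dhomogM.
Qed.

Lemma pi_lin_homog s : pi_lin s \is (size s).-homog.
Proof.
rewrite -sum1_size; apply: homog_prod_seq => a; exact: lin_homog.
Qed.

Lemma dhomog_msizeE p d : p != 0 -> p \is d.-homog -> msize p = d.+1.
Proof.
move=> p0 hp; rewrite -mlead_deg //; congr _.+1.
exact: (dhomog_mf hp (mlead_supp p0)).
Qed.

End LinearForms.

(** * Saito's criterion *)

Section SaitoCriterion.
Variables (K : fieldType) (l : nat).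
Notation S := {mpoly K[l]}.
Implicit Types (a b : 'cV[K]_l) (z v : 'rV[K]_l) (p q : S) (s : seq 'cV[K]_l).
Implicit Types (th : 'rV[S]_l) (M : 'M[S]_l).

(* The derivation sum_i th_i d/dx_i applied to the linear form a. *)
Definition app th a : S := (th *m map_mx (@mpolyC l K) a) 0 0.

Definition logd s th : Prop := forall a, a \in s -> mdvd (lin a) (app th a).

(* The rows of M are a basis of the logarithmic derivations of degrees e. *)
Definition saito s (e : 'I_l -> nat) M : Prop :=
  [/\ forall i, logd s (row i M), forall i j, M i j \is (e i).-homog,
      (\sum_i e i)%N = size s & \det M != 0].

Lemma appE th a : app th a = \sum_i th 0 i * (a i 0)%:MP.
Proof. by rewrite /app mxE; apply: eq_bigr => i _; rewrite mxE. Qed.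

Lemma appDr th a b : app th (a + b) = app th a + app th b.
Proof. by rewrite /app map_mxD mulmxDr mxE. Qed.
Lemma appZr th k a : app th (k *: a) = k *: app th a.
Proof. by rewrite /app map_mxZ -scalemxAr mxE mul_mpolyC. Qed.
Lemma appZl p th a : app (p *: th) a = p * app th a.
Proof. by rewrite /app -scalemxAl mxE. Qed.
Lemma app0r th : app th 0 = 0.
Proof. by rewrite /app map_mx0 mulmx0 mxE. Qed.

Lemma app_suml (I : Type) (r : seq I) (F : I -> 'rV[S]_l) a :
  app (\sum_(i <- r) F i) a = \sum_(i <- r) app (F i) a.
Proof. by rewrite /app mulmx_suml summxE. Qed.

Lemma app_homog th a d : (forall j, th 0 j \is d.-homog) -> app th a \is d.-homog.
Proof.
move=> h; rewrite appE rpred_sum // => i _.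
by rewrite mulrC mul_mpolyC rpredZ.
Qed.

Lemma app_ev th a v :
  (app th a).@[v 0] = ev (map_mx (meval (v 0)) th) a.
Proof.
rewrite appE evE raddf_sum; apply: eq_bigr => i _ /=.
by rewrite mevalM mevalC mxE.
Qed.

Lemma mdvdD p q q' : mdvd p q -> mdvd p q' -> mdvd p (q + q').
Proof. by move=> [r ->] [r' ->]; exists (r + r'); rewrite mulrDr. Qed.
Lemma mdvdMl p q q' : mdvd p q -> mdvd p (q' * q).
Proof. by move=> [r ->]; exists (q' * r); rewrite mulrCA. Qed.
Lemma mdvd0 p : mdvd p 0.
Proof. by exists 0; rewrite mulr0. Qed.
Lemma mdvd_sum (I : Type) (r : seq I) (P : pred I) (F : I -> S) p :
  (forall i, P i -> mdvd p (F i)) -> mdvd p (\sum_(i <- r | P i) F i).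
Proof.
by move=> h; elim/big_ind: _ => //; [exact: mdvd0 | move=> *; apply: mdvdD].
Qed.

Lemma logd_comb s (I : finType) (c : I -> S) (F : I -> 'rV[S]_l) :
  (forall i, logd s (F i)) -> logd s (\sum_i c i *: F i).
Proof.
move=> h a sa; rewrite app_suml; apply: mdvd_sum => i _.
by rewrite appZl; apply: mdvdMl; apply: h.
Qed.

Lemma det0_col (D : idomainType) m (A : 'M[D]_m) (v : 'cV[D]_m) :
  v != 0 -> A *m v = 0 -> \det A = 0.
Proof.
move=> v0 Av; have : (\det A) *: v = 0.
  by rewrite -mul_scalar_mx -mul_adj_mx -mulmxA Av mulmx0.
have [i vi] : exists i, v i 0 != 0.
  apply/existsP; apply: contraNT v0 => /existsPn h; apply/eqP/matrixP => i j.
  by rewrite mxE ord1; apply/eqP; rewrite -[_ == _]negbK h.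
by move/matrixP => /(_ i 0) /eqP; rewrite !mxE mulf_eq0 (negbTE vi) orbF => /eqP.
Qed.

(** Modulo [lin a] the nonzero constant column [a] is killed by [M], since every row sends the form
    [a] to a multiple of [lin a]; hence the determinant vanishes there. The forms of a noncollinear
    family are coprime primes. *)
Lemma pi_lin_dvd_det s M : noncollinear s -> (forall i, logd s (row i M)) ->
  mdvd (pi_lin s) (\det M).
Proof.
move=> ns h; apply: prod_lin_dvd => // a sa.
have a0 := noncollinear_neq0 ns sa; have [z az] := exists_ev1 a0.
apply/(lin_dvdP az); rewrite -det_map_mx.
apply: (@det0_col _ _ _ (map_mx (@mpolyC l K) a)).
  apply: contra a0 => /eqP /matrixP e; apply/eqP/matrixP => i j.
  by have := e i j; rewrite !mxE => /eqP; rewrite mpolyC_eq0 => /eqP.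
apply/matrixP => i j; rewrite ord1 [RHS]mxE.
have := h i a sa => /(lin_dvdP az) <-.
rewrite mxE appE raddf_sum /=; apply: eq_bigr => k _.
by rewrite rmorphM /= !mxE comp_mpolyC.
Qed.

Lemma det_homog (e : 'I_l -> nat) M : (forall i j, M i j \is (e i).-homog) ->
  \det M \is (\sum_i e i)%N.-homog.
Proof.
move=> h; rewrite /determinant rpred_sum // => g _.
rewrite -signr_odd; case: (odd_perm g); rewrite /= ?expr1 ?expr0 ?mulN1r ?mul1r ?rpredN;
  exact: (@homog_prod_seq _ _ _ _ (fun i => M i (g i))).
Qed.

Lemma saito_det s e M : noncollinear s -> saito s e M ->
  exists2 c, c != 0 & \det M = c *: pi_lin s.
Proof.
move=> ns [hl hh he d0]; have [r er] := pi_lin_dvd_det ns hl.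
have r0 : r != 0 by apply: contraNneq d0 => r0; rewrite er r0 mulr0.
have := det_homog hh; rewrite he er => hd.
have pr0 : pi_lin s * r != 0 by rewrite -er.
have := dhomog_msizeE pr0 hd; rewrite msizeM ?pi_lin_neq0 // (dhomog_msizeE (pi_lin_neq0 ns) (pi_lin_homog s)).
rewrite addSn /= => /eqP; rewrite -[X in _ == X]addn1 eqn_add2l => /msize_poly1P [c c0 ec].
by exists c; rewrite // ec mulrC mul_mpolyC.
Qed.

(** Serves for restrictions, whose number of hyperplanes is only bounded from below beforehand; the
    two bounds together give the equality that [saito] asks for. *)
Lemma saito_le s e M : noncollinear s -> (forall i, logd s (row i M)) ->
  (forall i j, M i j \is (e i).-homog) -> \det M != 0 ->
  (size s <= \sum_i e i)%N.
Proof.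
move=> ns hl hh d0; have [r er] := pi_lin_dvd_det ns hl.
have r0 : r != 0 by apply: contraNneq d0 => r0; rewrite er r0 mulr0.
have := dhomog_msizeE d0 (det_homog hh); rewrite er msizeM ?pi_lin_neq0 //.
rewrite (dhomog_msizeE (pi_lin_neq0 ns) (pi_lin_homog s)) addSn /= => h.
have: (0 < msize r)%N by rewrite lt0n mmeasure_poly_eq0.
by rewrite -(leq_add2l (size s)) addn1 h.
Qed.

Lemma saito_basis s e M : noncollinear s -> saito s e M ->
  forall th, logd s th -> exists! c : 'rV[S]_l, th = c *m M.
Proof.
move=> ns sM th hth; have [c c0 ec] := saito_det ns sM; case: sM => hl _ _ d0.
(* Cramer's rule: the entry is the determinant of [M] with row [j] replaced by [th]. All rows of
   that matrix are logarithmic, so [pi_lin s] divides it. *)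
have hr j : exists r, (th *m \adj M) 0 j = pi_lin s * r.
  pose N := \matrix_(i, k) if i == j then th 0 k else M i k.
  have -> : (th *m \adj M) 0 j = \det N.
    rewrite (expand_det_row _ j) mxE; apply: eq_bigr => k _.
    rewrite !mxE eqxx /cofactor; congr (_ * (_ * \det _)).
    by apply/matrixP => x y; rewrite !mxE [_ == j]eq_sym (negbTE (neq_lift _ _)).
  apply: pi_lin_dvd_det => // i; case: (eqVneq i j) => [->|ij].
    suff -> : row j N = th by [].
    by apply/rowP => k; rewrite !mxE eqxx.
  suff -> : row i N = row i M by [].
  by apply/rowP => k; rewrite !mxE (negbTE ij).
have [r er] : exists r : 'rV[S]_l, th *m \adj M = pi_lin s *: r.
  have /fin_all_exists [f hf] := hr; exists (\row_j f j).
  by apply/rowP => j; rewrite !mxE -hf mxE.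
have p0 := pi_lin_neq0 ns.
exists (c^-1%:MP *: r); split; last first.
  move=> r' e'; apply/rowP => j; move: er; rewrite e' -mulmxA mul_mx_adj ec.
  rewrite mul_mx_scalar => /rowP /(_ j); rewrite !mxE -mul_mpolyC -!mulrA.
  rewrite mulrCA => /(mulfI p0) <-.
  by rewrite mulrA -mpolyCM mulVf // mpolyC1 mul1r.
have : (c *: pi_lin s) *: th = pi_lin s *: (r *m M).
  by rewrite -ec -mul_mx_scalar -mul_adj_mx mulmxA er -scalemxAl.
move=> h; apply/rowP => j; move/rowP: h => /(_ j); rewrite -scalemxAl !mxE.
rewrite -mul_mpolyC -!mulrA mulrCA => /(mulfI p0) <-.
by rewrite mulrA -mpolyCM mulVf // mpolyC1 mul1r.
Qed.

End SaitoCriterion.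

(** * Points outside hyperplanes *)

Section SeqCount.
Variables (T T1 T2 : eqType).

Lemma size_undup_map_le (s : seq T) (f : T -> T1) (g : T -> T2) :
  {in s &, forall x y, f x = f y -> g x = g y} ->
  (size (undup (map g s)) <= size (undup (map f s)))%N.
Proof.
elim: s => //= a s IH h.
have {}IH : (size (undup (map g s)) <= size (undup (map f s)))%N.
  by apply: IH => x y xs ys; apply: h; rewrite in_cons ?xs ?ys orbT.
case: ifP => ga; case: ifP => fa //=; first exact: leqW.
case/negP: (negbT ga); case/mapP: fa => x xs e; apply/mapP; exists x => //.
by apply: h => //; rewrite in_cons ?eqxx ?xs ?orbT.
Qed.
End SeqCount.

Lemma size_undup_map_eq (T T1 T2 : eqType) (s : seq T) (f : T -> T1) (g : T -> T2) :
  {in s &, forall x y, f x = f y <-> g x = g y} ->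
  size (undup (map g s)) = size (undup (map f s)).
Proof.
move=> h; apply/eqP; rewrite eqn_leq; apply/andP; split;
  by apply: size_undup_map_le => x y xs ys /(h _ _ xs ys).
Qed.

Section Points.
Variable (K : numFieldType).

Lemma poly_nonroot (P : {poly K}) : P != 0 -> exists t, P.[t] != 0.
Proof.
move=> P0; have : ~~ all (root P) [seq i%:R | i <- iota 0 (size P)].
  apply/negP => /(max_poly_roots P0); rewrite map_inj_uniq ?iota_uniq; last first.
    by move=> i j /eqP; rewrite eqr_nat => /eqP.
  by move=> /(_ isT); rewrite size_map size_iota ltnn.
by case/allPn => t _ h; exists t.
Qed.

Let wid n := @widen_ord n n.+1 (leqnSn n).

(** [muni] isolates the last variable. A monomial is determined by its exponent there and its
    remaining part, so nothing cancels the leading coefficient. *)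
Lemma muni_neq0 n (p : {mpoly K[n.+1]}) : p != 0 -> muni p != 0.
Proof.
move=> p0; pose m := mlead p; have mp : m \in msupp p by apply: mlead_supp.
apply: contraTneq mp => e; rewrite mcoeff_msupp negbK; apply/eqP.
pose r k : 'X_{1..n} := [multinom k (wid i) | i < n].
have : ((muni p)`_(m ord_max))@_(r m) = 0 by rewrite e coef0 mcoeff0.
rewrite muniE coef_sum raddf_sum /=.
under eq_bigr => k _ do rewrite coefZ coefXn mulr_natr raddfMn /= mcoeffZ mcoeffX.
rewrite (bigD1_seq m) /=; last first.
- exact: msupp_uniq.
- exact: mlead_supp.
rewrite -[X in X == r m]/(r m) !eqxx mulr1 mulr1n big1 ?addr0 // => k km.
have [e1|] := eqVneq (r k) (r m); last first.
  by rewrite mulr0 mul0rn.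
have [e2|] := eqVneq (m ord_max) (k ord_max); last by rewrite mulr0n.
case/negP: km; apply/eqP/mnmP => i; case: (unliftP ord_max i) => [j ->|-> //].
have -> : lift ord_max j = wid j.
  by apply: val_inj; rewrite /= /bump leqNgt ltn_ord.
by have := congr1 (fun x : 'X_{1..n} => x j) e1; rewrite /r !mnmE.
Qed.

Lemma muni_eval n (p : {mpoly K[n.+1]}) (v : 'I_n.+1 -> K) :
  (map_poly (meval (fun i => v (wid i))) (muni p)).[v ord_max] = p.@[v].
Proof.
rewrite muniE raddf_sum /= horner_sum mevalE; apply: eq_bigr => m _.
rewrite map_polyZ /= map_polyXn hornerZ hornerXn mevalZ mevalX -mulrA.
congr (_ * _); rewrite big_ord_recr /=; congr (_ * _).
by apply: eq_bigr => i _; rewrite mnmE.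
Qed.

Lemma mpoly_nonroot n (p : {mpoly K[n]}) : p != 0 -> exists v : 'rV[K]_n, p.@[v 0] != 0.
Proof.
elim: n p => [|n IH] p p0.
  exists 0; rewrite [p]nvar0_mpolyC mevalC.
  by apply: contra p0 => /eqP e; rewrite [p]nvar0_mpolyC e.
have : exists k, (muni p)`_k != 0.
  exists (size (muni p)).-1; rewrite -lead_coefE lead_coef_eq0; exact: muni_neq0.
case=> k /IH [v hv].
have P0 : map_poly (meval (v 0)) (muni p) != 0.
  by apply: contra hv => /eqP e; rewrite -coef_map e coef0.
have [t ht] := poly_nonroot P0.
exists (\row_i if unlift ord_max i is Some j then v 0 j else t).
rewrite -muni_eval mxE unlift_none.
rewrite (_ : map_poly _ _ = map_poly (meval (v 0)) (muni p)) //.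
apply: eq_map_poly => q; apply: meval_eq => j; rewrite mxE.
have -> : wid j = lift ord_max j.
  by apply: val_inj; rewrite /= /bump leqNgt ltn_ord.
by rewrite liftK.
Qed.

Lemma avoid_hyperplane l (a : 'cV[K]_l) (z : 'rV[K]_l) (ps : seq {mpoly K[l]}) :
  ev z a = 1 -> (forall p, p \in ps -> p \mPo (proj_tuple a z) != 0) ->
  exists y, ev y a = 0 /\ forall p, p \in ps -> p.@[y 0] != 0.
Proof.
move=> az h; have : \prod_(p <- ps) (p \mPo proj_tuple a z) != 0.
  by rewrite prodf_seq_neq0; apply/allP => p /h.
case/mpoly_nonroot => v; rewrite rmorph_prod /= prodf_seq_neq0 => /allP hv.
exists (v - ev v a *: z); split.
  by rewrite -scaleNr evDl evZl az mulr1 subrr.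
move=> p /hv; rewrite comp_mpoly_meval.
rewrite (@meval_eq _ _ _ ((v - ev v a *: z) 0)) // => i.
by rewrite tnth_mktuple mevalB mevalXU mevalZ meval_lin !mxE mulrC.
Qed.

Definition line_eval l (x w : 'rV[K]_l) : {mpoly K[l]} -> {poly K} :=
  mmap (@polyC K) (fun i => (x 0 i)%:P + w 0 i *: 'X).

HB.instance Definition _ l (x w : 'rV[K]_l) := GRing.RMorphism.on (line_eval x w).

Section LineEval.
Variables (l : nat) (x w : 'rV[K]_l).

Lemma line_evalM p q : line_eval x w (p * q) = line_eval x w p * line_eval x w q.
Proof. exact: rmorphM. Qed.

Lemma line_evalB p q : line_eval x w (p - q) = line_eval x w p - line_eval x w q.
Proof. exact: rmorphB. Qed.

Lemma line_eval_lin a : line_eval x w (lin a) = (ev x a)%:P + ev w a *: 'X.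
Proof.
rewrite /lin /line_eval raddf_sum /= !evE rmorph_sum scaler_suml -big_split /=.
apply: eq_bigr => i _; rewrite mmapZ mmapX mmap1U mulrDr -polyCM mulrC.
by rewrite mul_polyC scalerA [a i 0 * _]mulrC.
Qed.

Lemma line_eval_horner p t : (line_eval x w p).[t] = p.@[(x + t *: w) 0].
Proof.
rewrite /line_eval mevalE /mmap horner_sum; apply: eq_bigr => m _.
rewrite hornerM hornerC /mmap1 horner_prod; congr (_ * _); apply: eq_bigr => i _.
by rewrite horner_exp hornerD hornerC hornerZ hornerX !mxE mulrC.
Qed.

Lemma line_eval_size p e : p \is e.-homog -> (size (line_eval x w p) <= e.+1)%N.
Proof.
move=> hp; rewrite /line_eval /mmap.
apply: (leq_trans (size_sum _ _ _)); apply/bigmax_leqP_seq => m mp _.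
rewrite mul_polyC; apply: (leq_trans (size_scale_leq _ _)).
have -> : e = (\sum_i m i)%N by rewrite -mdegE (dhomog_mf hp mp).
rewrite /mmap1; elim/big_ind2: _ => [|P d Q d' hP hQ|i _]; first by rewrite size_poly1.
  apply: (leq_trans (size_polyMleq _ _)).
  by rewrite -subn1 leq_subLR add1n -addnS -addSn leq_add.
elim: (m i) => [|k IH]; first by rewrite expr0 size_poly1.

rewrite exprS; apply: (leq_trans (size_polyMleq _ _)).
have hs : (size ((x 0%R i)%:P + w 0%R i *: 'X)%R <= 2)%N.
  apply: (leq_trans (size_polyD _ _)); rewrite geq_max.
  rewrite (leq_trans (size_polyC_leq1 _)) //=.
  by apply: (leq_trans (size_scale_leq _ _)); rewrite size_polyX.
by rewrite -subn1 leq_subLR add1n -[k.+3]/(2 + k.+1)%N leq_add.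
Qed.

End LineEval.

Lemma mult_roots (h : {poly K}) (rs : seq K) : h != 0 ->
  (forall c, c \in rs -> exists q, h = ('X - c%:P) ^+ count_mem c rs * q) ->
  (size rs < size h)%N.
Proof.
move=> h0 hr; rewrite -(size_prod_XsubC rs id); apply: dvdp_leq => //.
rewrite -big_undup_iterop_count /=.
have hs c : c \in undup rs -> exists q, h = ('X - c%:P) ^+ count_mem c rs * q.
  by rewrite mem_undup; apply: hr.
elim: (undup rs) (undup_uniq rs) hs => [|c s IH] /=; first by rewrite big_nil dvd1p.
move=> /andP [cs us] hs; rewrite big_cons Gauss_dvdp.
  apply/andP; split; last by apply: IH => // d ds; apply: hs; rewrite in_cons ds orbT.
  have [|q ->] := hs c; first by rewrite mem_head.
  by rewrite -[iterop _ _ _ _]/(('X - c%:P) ^+ count_mem c rs) dvdp_mulr // dvdpp.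
rewrite big_seq; elim/big_ind: _ => [|P Q hP hQ|d ds].
- by rewrite coprimep1.
- by rewrite coprimepMr hP.
rewrite -[iterop _ _ ('X - c%:P) _]/(('X - c%:P) ^+ count_mem c rs).
rewrite -[iterop _ _ ('X - d%:P) _]/(('X - d%:P) ^+ count_mem d rs).
apply: coprimep_expl; apply: coprimep_expr.
rewrite coprimep_XsubC root_XsubC; apply: contraNneq cs => e.
by rewrite -?e // ?e.
Qed.

End Points.

(** * Planes through a form and the order of vanishing along them *)

Section Planes.
Variables (K : fieldType) (E : vectType K).
Implicit Types a b c : E.

Definition plane a b : {vspace E} := (<[a]> + <[b]>)%VS.

Lemma mem_plane a b c : reflect (exists m n, c = m *: a + n *: b) (c \in plane a b).
Proof.
apply: (iffP memv_addP) => [[_ /vlineP [m ->] [_ /vlineP [n ->] ->]]|[m [n ->]]].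
  by exists m, n.
by exists (m *: a); [rewrite memvZ ?memv_line | exists (n *: b); rewrite ?memvZ ?memv_line].
Qed.

Lemma mem_planel a b : a \in plane a b.
Proof. by apply/mem_plane; exists 1, 0; rewrite scale1r scale0r addr0. Qed.
Lemma mem_planer a b : b \in plane a b.
Proof. by apply/mem_plane; exists 0, 1; rewrite scale1r scale0r add0r. Qed.

Lemma plane_eq a b c : c \notin <[a]>%VS -> c \in plane a b -> plane a c = plane a b.
Proof.
move=> ca cab; apply/eqP; rewrite eqEsubv /plane !subv_add !addvSl /=.
rewrite -!memvE; have /mem_plane [m [n e]] := cab; rewrite cab /=.
have n0 : n != 0.
  by apply: contraNneq ca => n0; rewrite e n0 scale0r addr0 memvZ ?memv_line.
apply/(mem_plane a c b); exists (- (n^-1 * m)), n^-1.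
by rewrite e scalerDr !scalerA mulVf // scale1r addrA -scalerDl addNr scale0r add0r.
Qed.
End Planes.

Section Pencil.
Variables (K : numFieldType) (l : nat).
Notation S := {mpoly K[l]}.
Implicit Types (a b : 'cV[K]_l) (x y z v : 'rV[K]_l) (p q : S) (s : seq 'cV[K]_l).

(** The right-hand side is alternating and bilinear in [al] and [a], so replacing [a] by another
    form [b] of the plane multiplies it by a constant. For [b] in [s] both terms are then divisible
    by [lin b]. *)
Lemma pencil_dvd (al a : 'cV[K]_l) s (th : 'rV[S]_l) : al != 0 ->
  (forall b, b \in s -> b \notin <[al]>%VS) -> noncollinear s -> logd s th ->
  mdvd (pi_lin [seq b <- s | plane al b == plane al a])
    (lin a * app th al - lin al * app th a).
Proof.
move=> al0 hs ns ls; apply: prod_lin_dvd; first exact: noncollinear_filter.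
move=> b; rewrite mem_filter => /andP [/eqP pe bs].
have : b \in plane al a by rewrite -pe mem_planer.
case/mem_plane => n [m e].
have m0 : m != 0.
  by apply: contraNneq (hs _ bs) => m0; rewrite e m0 scale0r addr0 memvZ ?memv_line.
have ea : a = m^-1 *: (b - n *: al).
  by rewrite e addrC addKr scalerA mulVf // scale1r.
have [r er] := ls _ bs.
exists (m^-1 *: (app th al - lin al * r)).
have -> : app th a = m^-1%:MP * (lin b * r - n%:MP * app th al).
  by rewrite ea appZr -scaleNr appDr appZr er -mulNr -rmorphN !mul_mpolyC.
have -> : lin a = m^-1%:MP * (lin b - n%:MP * lin al).
  by rewrite ea linearZ linearB linearZ /= !mul_mpolyC.
rewrite -mul_mpolyC; ring.
Qed.

(** By [pencil_dvd], on the kernel of [al] the polynomial [app th al] vanishes along the trace of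
    each plane, to order one less than the number of members of [s] in the plane. On a generic line
    of this kernel through [x] it becomes a nonzero polynomial of degree at most [e], whose roots
    number at least [size s] minus the number of planes; a zero at [x] is one root more. *)
Lemma pencil_bound (al : 'cV[K]_l) s (th : 'rV[S]_l) e x : al != 0 ->
  noncollinear s -> logd s th -> (forall j, th 0 j \is e.-homog) ->
  ev x al = 0 -> (forall a, a \in s -> ev x a != 0) ->
  ~ mdvd (lin al) (app th al) ->
  (size s <= e + size (undup [seq plane al a | a <- s]))%N /\
  ((app th al).@[x 0] = 0 ->
   (size s < e + size (undup [seq plane al a | a <- s]))%N).
Proof.
move=> al0 ns ls he xal xs nd; set g := app th al; have [z az] := exists_ev1 al0.
have nal a : a \in s -> a \notin <[al]>%VS.
  by move=> /xs; apply: contra => /vlineP [k ->]; rewrite evZr xal mulr0.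
have proj0 b : b \notin <[al]>%VS -> lin b \mPo proj_tuple al z != 0.
  rewrite proj_lin // lin_eq0 subr_eq0; apply: contra => /eqP ->.
  by rewrite memvZ ?memv_line.
pose c a a' := ev x a' *: a - ev x a *: a'.
have hc a a' : a \in s -> a' \in s -> c a a' \in <[al]>%VS -> plane al a = plane al a'.
  move=> sa sa' /vlineP [k]; rewrite /c => /eqP; rewrite subr_eq => /eqP ek.
  apply: plane_eq; first exact: nal.
  apply/mem_plane; exists ((ev x a')^-1 * k), ((ev x a')^-1 * ev x a).
  by rewrite -!scalerA -scalerDr -ek scalerA mulVf ?xs // scale1r.
pose ps := g :: [seq lin a - (ev x a)%:MP | a <- s] ++
   [seq lin (c d.1 d.2) | d <- [seq (a, b) | a <- s, b <- s] & c d.1 d.2 \notin <[al]>%VS].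
have [|y [yal hy]] := avoid_hyperplane (ps := ps) az.
  move=> p; rewrite in_cons mem_cat => /orP [/eqP -> |/orP [/mapP [a sa ->]|]].
  - by apply/negP => /eqP /(lin_dvdP az).
  - rewrite rmorphB /= comp_mpolyC; apply/negP => /eqP /(congr1 (meval ((0 : 'rV[K]_l) 0))).
    rewrite mevalB mevalC meval0 proj_lin // meval_lin ev0l sub0r => /eqP.
    by rewrite oppr_eq0 (negbTE (xs _ sa)).
  - by case/mapP => -[a b] /=; rewrite mem_filter => /andP [/= h _] ->; apply: proj0.
have gy : g.@[y 0] != 0 by apply: hy; rewrite mem_head.
pose w := y - x.
have wE a : ev w a = ev y a - ev x a by rewrite /w -scaleN1r evDl evZl mulN1r.
have wal : ev w al = 0 by rewrite wE yal xal subrr.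
have wn0 a : a \in s -> ev w a != 0.
  move=> sa; rewrite wE.
  have := hy (lin a - (ev x a)%:MP); rewrite mevalB mevalC meval_lin; apply.
  rewrite in_cons mem_cat; apply/orP; right; apply/orP; left.
  by apply/mapP; exists a.
have cyal a a' : a \in s -> a' \in s -> ev y a * ev x a' = ev y a' * ev x a ->
    plane al a = plane al a'.
  move=> sa sa' e1; have [|h] := boolP (c a a' \in <[al]>%VS); first exact: hc.
  have hin : lin (c a a') \in ps.
    rewrite in_cons mem_cat; apply/orP; right; apply/orP; right.
    apply/mapP; exists (a, a') => //; rewrite mem_filter /= h /=.
    by apply/allpairsP; exists (a, a').
  have := hy _ hin; rewrite meval_lin evBr !evZr.
  by rewrite [X in X - _]mulrC e1 mulrC subrr eqxx.
(* The parameter [t] at which the line [x + t *: w] meets the kernel of [a]. *)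
pose r a := - ev x a / ev w a.
have hr a a' : a \in s -> a' \in s -> (plane al a = plane al a' <-> r a = r a').
  move=> sa sa'; split=> [e1|].
    have : a \in plane al a' by rewrite -e1 mem_planer.
    case/mem_plane => n [m em]; have := wn0 _ sa.
    rewrite /r em !evDr !evZr xal wal !mulr0 !add0r mulf_eq0 negb_or => /andP [m0 _].
    by rewrite -mulrN -mulf_div divff // mul1r.
  rewrite /r => /eqP; rewrite eqr_div ?wn0 // !mulNr eqr_opp !wE => /eqP h.
  apply: cyal => //; apply/eqP; rewrite -subr_eq0.
  have -> : ev y a * ev x a' - ev y a' * ev x a =
    - (ev x a * (ev y a' - ev x a') - ev x a' * (ev y a - ev x a)) by ring.
  by rewrite h subrr oppr0.
pose h := line_eval x w g.
have h0 : h != 0.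
  apply: contraNneq gy => h0; have := line_eval_horner x w g 1.
  by rewrite -/h h0 horner0 scale1r /w addrC subrK => <-.
have hsize : (size h <= e.+1)%N by apply: line_eval_size; apply: app_homog.
have lE a : a \in s -> line_eval x w (lin a) = ev w a *: ('X - (r a)%:P).
  move=> sa; rewrite line_eval_lin scalerBr -!mul_polyC -polyCM.
  by rewrite /r mulrCA divff ?wn0 // mulr1 polyCN opprK addrC.
(* On the line [lin al] is zero, so the second term of [pencil_dvd] disappears, and one factor
   [lin a] cancels. *)
have mult a : a \in s ->
    exists P : {poly K}, h = ('X - (r a)%:P) ^+ (count_mem (r a) (map r s)).-1 * P.
  move=> sa; have [R eR] := pencil_dvd a al0 nal ns ls.
  have : line_eval x w (lin a) * h - line_eval x w (lin al) * line_eval x w (app th a)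
      = line_eval x w (pi_lin [seq b <- s | plane al b == plane al a]) * line_eval x w R.
    by rewrite /h -!line_evalM -line_evalB -eR.
  rewrite (line_eval_lin x w al) xal wal scale0r addr0 mul0r subr0 lE // -/h.
  have -> : line_eval x w (pi_lin [seq b <- s | plane al b == plane al a]) =
      (\prod_(b <- [seq b <- s | plane al b == plane al a]) ev w b) *:
      ('X - (r a)%:P) ^+ count_mem (r a) (map r s).
    rewrite /pi_lin rmorph_prod /= count_map.
    have -> : count (preim r (pred1 (r a))) s = size [seq b <- s | plane al b == plane al a].
      rewrite size_filter; apply: eq_in_count => b sb /=.
      by apply/eqP/eqP => [/(hr _ _ sb sa) ->|/(hr _ _ sb sa) ->].
    have : {subset [seq b <- s | plane al b == plane al a] <= s} by apply: mem_subseq; apply: filter_subseq.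
    have : forall b, b \in [seq b <- s | plane al b == plane al a] -> r b = r a.
      by move=> b; rewrite mem_filter => /andP [/eqP pe sb]; apply/hr.
    elim: [seq b <- s | _] => [|b t IH] hb ht; first by rewrite !big_nil scale1r.
    rewrite !big_cons IH; last 2 first.
    - by move=> d dt; apply: hb; rewrite in_cons dt orbT.
    - by move=> d dt; apply: ht; rewrite in_cons dt orbT.
    rewrite lE ?hb ?ht ?mem_head // -scalerAl -scalerAr scalerA -exprS //.
  have : (0 < count_mem (r a) (map r s))%N by rewrite -has_count has_pred1 map_f.
  case: (count_mem _ _) => // k _; rewrite -!scalerAl exprS -mulrA => hq.
  have Xn0 : 'X - (r a)%:P != 0 by rewrite polyXsubC_eq0.
  exists ((ev w a)^-1 *: ((\prod_(b <- [seq b <- s | plane al b == plane al a]) ev w b) *: line_eval x w R)).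
  rewrite -!scalerAr; apply: (scalerI (wn0 _ sa)); rewrite [RHS]scalerA divff ?wn0 // scale1r.
  by apply: (mulfI Xn0); rewrite -scalerAr hq -scalerAr.
pose T := map r s.
(* The complement of [undup T] in [T]: each root with its multiplicity lowered by one. *)
have [rs prs] := perm_to_subseq (undup_subseq T).
have sT : size (undup [seq plane al a | a <- s]) = size (undup T).
  by symmetry; apply: size_undup_map_eq.
have hcount cc : cc \in rs -> count_mem cc rs = (count_mem cc T).-1 /\ cc \in T.
  move=> crs; have cT : cc \in T by rewrite (perm_mem prs) mem_cat crs orbT.
  rewrite (seq.permP prs) count_cat (count_uniq_mem cc (undup_uniq T)) mem_undup cT //.
have roots cc : cc \in rs -> exists P : {poly K}, h = ('X - cc%:P) ^+ count_mem cc rs * P.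
  by move=> /hcount [-> /mapP [a sa ->]]; apply: mult.
have szT : size s = (size (undup T) + size rs)%N.
  by rewrite -(size_map r s) -/T (perm_size prs) size_cat.
rewrite sT szT ![(e + _)%N]addnC leq_add2l ltn_add2l; split.
  by have := leq_trans (mult_roots h0 roots) hsize; rewrite ltnS.
(* The point [x] has parameter 0, which is no [r a] because no member of [s] vanishes at [x]. *)
move=> gx; have r0 : 0 \notin rs.
  apply/negP => /hcount [_ /mapP [a sa /esym /eqP]].
  by rewrite /r mulf_eq0 invr_eq0 (negbTE (wn0 _ sa)) oppr_eq0 (negbTE (xs _ sa)).
have : (size (0%R :: rs) < size h)%N.
  apply: mult_roots => // cc; rewrite in_cons => /orP [/eqP ->|crs] /=.
    rewrite eqxx (count_memPn r0).
    have : root h 0 by rewrite rootE line_eval_horner scale0r addr0 gx.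
    by case/factor_theorem => q eq; exists q; rewrite mulrC expr1.
  have -> : (0 == cc) = false by apply: contraNF r0 => /eqP ->.
  by rewrite add0n; apply: roots.
by move=> h1; have := leq_trans h1 hsize; rewrite /= ltnS.
Qed.

End Pencil.

(** * Multiple addition *)

Definition below (T : Type) (s : seq T) (ht : T -> nat) (k : nat) :=
  [seq a <- s | (ht a < k)%N].
Definition level (T : Type) (s : seq T) (ht : T -> nat) (k : nat) :=
  [seq a <- s | ht a == k].

(* The hypotheses of the multiple addition theorem, for each level [ht = k] added
   to the forms below it.  The planes through a are the hyperplanes of the
   restriction to the kernel of a of the arrangement below a. *)
Definition mat_free (K : fieldType) (E : vectType K) (s : seq E) (ht : E -> nat) :
    Prop :=
  [/\ noncollinear s, forall a, a \in s -> (0 < ht a)%N,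
      forall k, free (level s ht k),
      forall k a, a \in s -> (ht a < k)%N -> a \notin <<level s ht k>>%VS
    & forall a, a \in s -> size (below s ht (ht a)) =
        ((ht a).-1 + size (undup [seq plane a b | b <- below s ht (ht a)]))%N].

Lemma perm_below_level (T : eqType) (s : seq T) (ht : T -> nat) k :
  perm_eq (below s ht k.+1) (below s ht k ++ level s ht k).
Proof.
apply/seq.permP => p; rewrite count_cat !count_filter.
elim: s => //= a s ->; rewrite addnACA; congr (_ + _)%N.
rewrite ltnS leq_eqVlt; case: (p a) => //=.
by case: ltngtP => //.
Qed.

(** Two triangular factorizations of the same block matrix. *)
Lemma det_sylvester (D : comNzRingType) m n (X : 'M[D]_(m, n)) (E : 'M[D]_(n, m)) :
  \det (1%:M + X *m E) = \det (1%:M + E *m X).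
Proof.
have h1 : block_mx 1%:M (- X) E 1%:M =
    block_mx 1%:M 0 E 1%:M *m block_mx 1%:M (- X) 0 (1%:M + E *m X).
  rewrite mulmx_block ?mul1mx ?mul0mx ?mulmx0 ?mulmx1 ?addr0 mulmxN.
  by rewrite addrCA addNr addr0.
have h2 : block_mx 1%:M (- X) E 1%:M =
    block_mx 1%:M (- X) 0 1%:M *m block_mx (1%:M + X *m E) 0 E 1%:M.
  by rewrite mulmx_block ?mul1mx ?mul0mx ?mulmx0 ?mulmx1 ?add0r mulNmx addrK.
have := congr1 determinant h2; rewrite h1 !det_mulmx !det_lblock !det_ublock.
by rewrite !det1 !mul1r mulr1 => ->.
Qed.

Section DualPoint.
Variables (K : numFieldType) (l : nat).
Implicit Types (a b : 'cV[K]_l) (bs ss : seq 'cV[K]_l).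

Definition colmx bs : 'M[K]_(l, size bs) := \matrix_(i, j) (bs`_j) i 0.

Lemma colmx_mul bs m (N : 'M[K]_(m, l)) i j :
  (N *m colmx bs) i j = ev (row i N) bs`_j.
Proof. by rewrite evE mxE; apply: eq_bigr => t _; rewrite !mxE. Qed.

Lemma colmx_comb bs (u : 'cV[K]_(size bs)) :
  colmx bs *m u = \sum_j u j 0 *: bs`_j.
Proof.
apply/matrixP => i t; rewrite ord1 summxE mxE; apply: eq_bigr => j _.
by rewrite !mxE mulrC.
Qed.

Lemma colmx_full bs : free bs -> row_full (colmx bs).
Proof.
move=> fb; rewrite /row_full -mxrank_tr -/(row_free _); apply: inj_row_free => v hv.
have := @freeP _ _ _ (in_tuple bs) fb (fun j => v 0 j).
have -> : \sum_(i < size bs) v 0 i *: (in_tuple bs)`_i = 0.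
  have := colmx_comb v^T; rewrite -[colmx bs]trmxK -trmx_mul hv trmx0 => e; rewrite [RHS]e.
  by apply: eq_bigr => j _; rewrite mxE.
by move=> /(_ erefl) h; apply/rowP => j; rewrite h mxE.
Qed.

(** No form of [ss] vanishes identically on the annihilator of [bs], so their product is a nonzero
    polynomial there. This turns the span condition of [mat_free] into a point. *)
Lemma dual_point bs ss : (forall a, a \in ss -> a \notin <<bs>>%VS) ->
  exists x, (forall b, b \in bs -> ev x b = 0) /\ (forall a, a \in ss -> ev x a != 0).
Proof.
move=> h; pose N := (cokermx (colmx bs)^T)^T.
have Na a : a \in ss -> N *m a != 0.
  move=> /h; apply: contra => /eqP e; have : (a^T <= (colmx bs)^T)%MS.
    by rewrite submxE -trmx_eq0 trmx_mul trmxK -/N e.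
  case/submxP => D /(congr1 trmx); rewrite trmx_mul !trmxK colmx_comb => ->.
  by apply: memv_suml => j _; rewrite memvZ // memv_span // mem_nth.
have : \prod_(a <- ss) lin (N *m a) != 0.
  by rewrite prodf_seq_neq0; apply/allP => a /Na; rewrite lin_eq0.
case/mpoly_nonroot => y; rewrite rmorph_prod /= prodf_seq_neq0 => /allP hy.
exists (y *m N); split=> [b bb|a /hy].
  rewrite /ev -mulmxA (_ : N *m b = 0) ?mulmx0 ?mxE //.
  apply: trmx_inj; rewrite trmx_mul trmxK trmx0; apply/eqP; rewrite -submxE.
  have hi : (index b bs < size bs)%N by rewrite index_mem.
  rewrite (_ : b^T = row (Ordinal hi) (colmx bs)^T) ?row_sub //.
  by apply/rowP => i; rewrite !mxE /= nth_index.
by rewrite meval_lin /ev mulmxA.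
Qed.

Lemma mdvd_lin_dec a (p : {mpoly K[l]}) : a != 0 -> mdvd (lin a) p \/ ~ mdvd (lin a) p.
Proof.
case/exists_ev1 => z az; case: (eqVneq (p \mPo proj_tuple a z) 0) => h.
  by left; apply/(lin_dvdP az).
by right => /(lin_dvdP az) /eqP; apply/negP.
Qed.

Lemma mdvd_lin_ev a (p : {mpoly K[l]}) x : mdvd (lin a) p -> ev x a = 0 -> p.@[x 0] = 0.
Proof. by case=> r ->; rewrite mevalM meval_lin => ->; rewrite mul0r. Qed.

End DualPoint.

(** * The addition of one level *)

Section Step.
Variables (K : numFieldType) (l : nat) (s : seq 'cV[K]_l) (ht : 'cV[K]_l -> nat).
Notation S := {mpoly K[l]}.
Notation mC := (map_mx (@mpolyC l K)).
Hypothesis mf : mat_free s ht.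

Let ns : noncollinear s. Proof. by case: mf. Qed.

Lemma noncollinear_below k : noncollinear (below s ht k).
Proof. exact: noncollinear_filter. Qed.

(* Phi is a constant recombination of the basis M of the previous stage, and M
   is obtained from it by multiplying one row by each new linear form. *)
Definition stage k (e : 'I_l -> nat) (M Phi : 'M[S]_l) (b : 'I_l -> 'cV[K]_l) : Prop :=
  [/\ saito (below s ht k.+1) e M, forall i, (e i <= k)%N,
      perm_eq [seq b i | i <- enum 'I_l & e i == k] (level s ht k),
      forall i, row i M = (if e i == k then lin (b i) else 1) *: row i Phi
    & (forall i j, Phi i j \is (e i - (e i == k))%N.-homog) /\
      exists2 c, c != 0 & \det Phi = c *: pi_lin (below s ht k)].

Lemma row_mC_mul (G : 'M[K]_l) (M : 'M[S]_l) i :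
  row i (mC G *m M) = \sum_i' (G i i')%:MP *: row i' M.
Proof.
by rewrite row_mul mulmx_sum_row; apply: eq_bigr => j _; rewrite !mxE.
Qed.

(** The matrix [G] mixes only members of degree [k.-1]. This keeps the rows homogeneous, and later
    lets a flat found at one stage survive the following ones. *)
Lemma mat_step k (e : 'I_l -> nat) (M : 'M[S]_l) : (0 < k)%N ->
  saito (below s ht k) e M -> (forall i, e i < k)%N ->
  exists e' M' Phi b (G : 'M[K]_l),
    [/\ stage k e' M' Phi b, Phi = mC G *m M, G \in unitmx,
        forall i i', (e i < k.-1)%N || (e i' < k.-1)%N -> G i i' = (i == i')%:R
      & forall i, e' i = (e i + (e' i == k))%N].
Proof.
move=> k0 sM ek; pose bs := level s ht k; pose q := size bs.
have [_ ht0 hfree hspan hcnt] := mf.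
have [lM hM eM dM] := sM.
have [x [xb xa]] : exists x, (forall b, b \in bs -> ev x b = 0) /\
    (forall a, a \in below s ht k -> ev x a != 0).
  apply: dual_point => a; rewrite mem_filter => /andP [ak sa]; exact: hspan.
pose Mx := map_mx (meval (x 0)) M.
have Mxu : Mx \in unitmx.
  rewrite unitmxE det_map_mx; have [c c0 ->] := saito_det (noncollinear_below k) sM.
  rewrite unitfE /= mevalZ mulf_neq0 // /pi_lin rmorph_prod /= prodf_seq_neq0.
  by apply/allP => a /xa; rewrite /= meval_lin.
(* Entry [i], [j] is the value at [x] of member [i] on the new form [j], the obstruction to
   tangency. The rank is q, since [Mx] is invertible and the new forms are independent. *)
pose C := Mx *m colmx bs.
have Cfull : row_full C.
  have h : row_full Mx by rewrite row_full_unit.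
  by rewrite (eq_row_full (eqmxMfull _ h)) colmx_full //; apply: hfree.
pose sg : 'I_q -> 'I_l := fullrankfun Cfull.
have sgI : injective sg := @fullrankfun_inj _ _ _ _ Cfull.
pose R := rowsub sg C.
have Ru : R \in unitmx := fullrowsub_unit Cfull.
pose E : 'M[K]_(q, l) := rowsub sg 1%:M.
have EA p (A : 'M[K]_(l, p)) : E *m A = rowsub sg A by rewrite mul_rowsub_mx mul1mx.
have EE : E *m E^T = 1%:M.
  rewrite EA; apply/matrixP => i j; rewrite !mxE (inj_eq sgI) eq_sym //.
pose T := C *m invmx R.
have ET : E *m T = 1%:M by rewrite mulmxA EA mulmxV.
(* A correction of the identity by a matrix of rank at most q, which turns [C] into the 0-1 matrix
   [E^T]: only member [sg j] keeps a nonzero value on the new form [j]. *)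
pose G := 1%:M + (E^T *m invmx R - T) *m E.
have Gu : G \in unitmx.
  rewrite unitmxE det_sylvester mulmxBr mulmxA EE ET mul1mx addrC subrK.
  by rewrite -unitmxE unitmx_inv.
have GC : G *m C = E^T.
  rewrite mulmxDl mul1mx -mulmxA EA -/R mulmxBl /T -!mulmxA mulVmx // !mulmx1.
  by rewrite addrC subrK.
have Cev i j : C i j = ev (row i Mx) bs`_j by rewrite colmx_mul.
have appC i (j : 'I_q) : (app (row i M) bs`_j).@[x 0] = C i j.
  by rewrite Cev app_ev /Mx map_row.
have bsn (j : 'I_q) : bs`_j \in bs by rewrite mem_nth.
have bss b : b \in bs -> b \in s /\ ht b = k.
  by rewrite mem_filter => /andP [/eqP -> ->].
have bs0 b : b \in bs -> b != 0 by move=> /bss [/(noncollinear_neq0 ns)].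
(* With the count of [mat_free], [pencil_bound] reads [k.-1 <= d] for a derivation that is not
   tangent, strictly if its value at [x] is zero; [d < k] leaves no room for the latter. *)
have key (th : 'rV[S]_l) d (j : 'I_q) : logd (below s ht k) th ->
    (forall t, th 0 t \is d.-homog) -> (d < k)%N ->
    (d < k.-1)%N \/ (app th bs`_j).@[x 0] = 0 -> mdvd (lin bs`_j) (app th bs`_j).
  move=> lth hth dk hd; have [//|nd] := mdvd_lin_dec (app th bs`_j) (bs0 _ (bsn j)).
  have [sb hb] := bss _ (bsn j).
  have [] := pencil_bound (bs0 _ (bsn j)) (noncollinear_below k) lth hth (xb _ (bsn j)) xa nd.
  have := hcnt _ sb; rewrite hb => ->; rewrite leq_add2r ltn_add2r => h1 h2.
  case: hd => [h|/h2 h]; first by rewrite ltnNge h1 in h.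
  by move: dk h; case: (k) k0 => //= k' _; rewrite ltnS => h3 h4; rewrite ltnNge h3 in h4.
have C0 i : (e i < k.-1)%N -> row i C = 0.
  move=> ei; apply/rowP => j; rewrite [LHS]mxE -appC [RHS]mxE.
  apply: (mdvd_lin_ev _ (xb _ (bsn j))); apply: (key _ (e i)) => //; last by left.
  by move=> t; rewrite mxE.
(* A member of lower degree has a zero row in [C], which cannot belong to the invertible minor
   [R]. *)
have esg j : e (sg j) = k.-1.
  apply/eqP; rewrite eqn_leq -ltnS prednK // ek /= leqNgt; apply/negP => /C0 h.
  have : row j R = 0 by rewrite -[RHS]h; apply/rowP => t; rewrite !mxE.
  move=> hR; have := congr1 (mulmx^~ (invmx R)) hR.
  rewrite -row_mul mulmxV // mul0mx => /rowP /(_ j); rewrite !mxE eqxx => /eqP.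
  by rewrite oner_eq0.
have Gid i i' : (e i < k.-1)%N || (e i' < k.-1)%N -> G i i' = (i == i')%:R.
  move=> h; rewrite mxE [X in X + _]mxE [X in _ + X]mxE big1 ?addr0 // => j _.
  have [si'|] := eqVneq (sg j) i'; last by move=> hn; rewrite [E j i']mxE [1%:M _ _]mxE (negbTE hn) mulr0.
  move: h; rewrite -si' esg ltnn orbF => ei.
  rewrite [X in X * _](_ : _ = 0) ?mul0r // mxE [X in X + _]mxE big1 => [|t _]; last first.
    have [st|hn] := eqVneq (sg t) i; first by rewrite -st esg ltnn in ei.
    by rewrite [E^T i t]mxE [E t i]mxE [1%:M _ _]mxE (negbTE hn) mul0r.
  rewrite add0r mxE; apply/eqP; rewrite oppr_eq0 /T.
  have := congr1 (fun v : 'rV_q => (v *m invmx R) 0 j) (C0 _ ei).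
  by rewrite -row_mul mul0mx !mxE => ->.
clearbody G; pose Phi := mC G *m M.
pose im i := i \in codom sg.
pose e' i := (e i + im i)%N.
have e'k i : (e' i == k) = im i.
  rewrite /e'; have [/codomP [j ->]|_] := boolP (im i).
    by rewrite esg addn1 prednK // eqxx.
  by rewrite addn0; apply: negbTE; rewrite neq_ltn ek.
pose b i : 'cV[K]_l := if [pick j | sg j == i] is Some j then bs`_j else 0.
have bsg j : b (sg j) = bs`_j.
  rewrite /b; case: pickP => [j'|/(_ j)]; last by rewrite eqxx.
  by move=> /eqP /sgI ->.
have im_sg i : im i -> exists j, i = sg j by move/codomP.
pose M' := diag_mx (\row_i (if im i then lin (b i) else 1)) *m Phi.
have rowM' i : row i M' = (if im i then lin (b i) else 1) *: row i Phi.
  by apply/rowP => j; rewrite [RHS]mxE /M' mul_diag_mx !mxE.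
have PhiD i : logd (below s ht k) (row i Phi).
  by rewrite /Phi row_mC_mul; apply: logd_comb => i'; apply: lM.
have Phih i j : Phi i j \is (e i).-homog.
  have -> : Phi i j = (row i Phi) 0 j by rewrite [RHS]mxE.
  rewrite /Phi row_mC_mul summxE rpred_sum // => i' _.
  rewrite mxE mxE mul_mpolyC.
  have [h|] := boolP ((e i < k.-1)%N || (e i' < k.-1)%N).
    by rewrite (Gid _ _ h); case: eqVneq => [->|_]; rewrite ?scale1r // scale0r rpred0.
  rewrite negb_or -!leqNgt => /andP [h1 h2].
  have eq1 t : (k.-1 <= e t)%N -> e t = k.-1.
    by move=> h; apply/eqP; rewrite eqn_leq h andbT -ltnS prednK // ek.
  by rewrite (eq1 _ h1) -(eq1 _ h2); apply: rpredZ.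
have Phix i (j : 'I_q) : (app (row i Phi) bs`_j).@[x 0] = (sg j == i)%:R.
  have -> : (sg j == i)%:R = (G *m C) i j by rewrite GC !mxE.
  rewrite /Phi row_mC_mul app_suml raddf_sum /= mxE; apply: eq_bigr => i' _.
  by rewrite appZl mevalM mevalC appC.
have Phib i (j : 'I_q) : sg j != i -> mdvd (lin bs`_j) (app (row i Phi) bs`_j).
  move=> h; apply: (key _ (e i)) => //; try by move=> t; rewrite [X in X \is _]mxE.
  by right; rewrite Phix (negbTE h).
have detPhi : exists2 c, c != 0 & \det Phi = c *: pi_lin (below s ht k).
  have [c c0 ec] := saito_det (noncollinear_below k) sM.
  exists (\det G * c); first by rewrite mulf_neq0 // -unitfE -unitmxE.
  by rewrite /Phi det_mulmx det_map_mx ec mul_mpolyC scalerA.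
have ePhi : Phi = mC G *m M by []; clearbody Phi.
exists e', M', Phi, b, G; split => //; last by move=> i; rewrite e'k.
split.
- split.
  + move=> i a; rewrite (perm_mem (perm_below_level s ht k)) mem_cat rowM' appZl.
    case/orP => [ha|hb]; first by apply: mdvdMl; apply: PhiD.
    have hi : (index a bs < q)%N by rewrite index_mem.
    have ea : a = bs`_(Ordinal hi) by rewrite /= nth_index.
    rewrite ea; have [si|hn] := eqVneq (sg (Ordinal hi)) i; last first.
      by apply: mdvdMl; apply: Phib.
    rewrite -si (_ : im _ = true) ?bsg; last by rewrite /im codom_f.
    by exists (app (row (sg (Ordinal hi)) Phi) bs`_(Ordinal hi)).
  + move=> i j; have -> : M' i j = (row i M') 0 j by rewrite [RHS]mxE.
    rewrite rowM' !mxE /e' addnC; apply: dhomogM => //.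
    by case: (im i); rewrite ?lin_homog ?dhomog1.
  + have -> : (\sum_i e' i = \sum_i e i + \sum_i im i)%N by rewrite -big_split.
    rewrite eM (perm_size (perm_below_level s ht k)) size_cat.
    congr (_ + _)%N; transitivity #|codom sg|; last by rewrite card_codom ?card_ord.
    rewrite -sum1_card.
    by rewrite [RHS]big_mkcond /=; apply: eq_bigr => i _; rewrite /im; case: ifP.
  + rewrite /M' det_mulmx det_diag mulf_neq0 //; last first.
      have [c c0 ->] := detPhi; rewrite -mul_mpolyC mulf_neq0 ?mpolyC_eq0 //.
      exact: (pi_lin_neq0 (noncollinear_below k)).
    rewrite prodf_seq_neq0; apply/allP => i _ /=; rewrite mxE.
    case: ifP => [/im_sg [j ->]|_]; last exact: oner_neq0.
    by rewrite bsg lin_eq0 bs0.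
- by move=> i; rewrite /e'; case: (im i); rewrite ?addn1 ?addn0 // ltnW.
- have -> : level s ht k = [seq b i | i <- [seq sg j | j <- enum 'I_q]].
    rewrite -map_comp (eq_map (g := fun j : 'I_q => bs`_j)); last exact: bsg.
    rewrite -/bs -[LHS](mkseq_nth 0) -/q /mkseq -val_enum_ord -map_comp.
    by apply: eq_map.
  apply: perm_map; apply: uniq_perm.
  + by rewrite filter_uniq // enum_uniq.
  + by rewrite map_inj_uniq ?enum_uniq.
  + by move=> i; rewrite mem_filter mem_enum andbT e'k.
- by move=> i; rewrite e'k; apply: rowM'.
- split=> // i j; rewrite e'k /e' addnK; exact: Phih.
Qed.

End Step.

(** * Restrictions to flats *)

Section Count.
Variables (K : fieldType) (E : vectType K).
Implicit Types (U : {vspace E}) (a b : E) (A : seq E).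

Lemma mem_addv_line U a b :
  reflect (exists k, a - k *: b \in U) (a \in U + <[b]>)%VS.
Proof.
apply: (iffP memv_addP) => [[u uU [_ /vlineP [k ->] ->]]|[k ak]].
  by exists k; rewrite addrK.
by exists (a - k *: b) => //; exists (k *: b); rewrite ?memvZ ?memv_line ?subrK.
Qed.

Lemma addv_line_eq U a b : a \notin U -> a \in (U + <[b]>)%VS ->
  (U + <[a]> = U + <[b]>)%VS.
Proof.
move=> aU ab; apply/eqP; rewrite eqEsubv !subv_add !addvSl /= -!memvE ab /=.
case/mem_addv_line: ab => k akU; apply/(mem_addv_line U b a).
have k0 : k != 0.
  by apply: contraNneq aU => k0; rewrite k0 scale0r subr0 in akU.
exists k^-1; have -> : b - k^-1 *: a = - k^-1 *: (a - k *: b).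
  by rewrite scalerBr scaleNr scaleNr scalerA mulVf // scale1r opprK addrC.
exact: memvZ.
Qed.

Lemma span_comb A a : a \in <<A>>%VS ->
  a = \sum_(i < size A) coord (in_tuple A) i a *: A`_i.
Proof. exact: (@coord_span _ _ _ (in_tuple A)). Qed.

(* The number of distinct traces on the annihilator of U of the hyperplanes
   with normals in A. *)
Definition cnt U A : nat := size (undup [seq (U + <[a]>)%VS | a <- A & a \notin U]).

Lemma cnt_sub U A B : {subset A <= B} -> (cnt U A <= cnt U B)%N.
Proof.
move=> AB; apply: uniq_leq_size (undup_uniq _) _ => W; rewrite !mem_undup.
case/mapP => a; rewrite mem_filter => /andP [aU /AB aB] ->.
by apply/mapP; exists a; rewrite ?mem_filter ?aU.
Qed.

(* One vector of A on each line spanned by a vector of A. *)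
Fixpoint nc A : seq E :=
  if A is a :: A' then
    if <[a]>%VS \in [seq <[b]>%VS | b <- nc A'] then nc A' else a :: nc A'
  else [::].

Lemma nc_sub A : {subset nc A <= A}.
Proof.
elim: A => //= a A IH b; case: ifP => _; rewrite !in_cons; first by move/IH->; rewrite orbT.
by case/predU1P => [->|/IH ->]; rewrite ?eqxx ?orbT.
Qed.

Lemma map_nc A : [seq <[b]>%VS | b <- nc A] = undup [seq <[b]>%VS | b <- A].
Proof.
elim: A => //= a A IH; rewrite IH mem_undup; case: ifP => _ //=.
by rewrite IH.
Qed.

Lemma noncollinear_nc A : 0 \notin A -> noncollinear (nc A).
Proof.
move=> A0; rewrite /noncollinear map_nc undup_uniq andbT.
by apply: contra A0 => /nc_sub.
Qed.

Lemma nc_mem A a : a \in A -> exists2 b, b \in nc A & <[a]>%VS = <[b]>%VS.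
Proof.
move=> aA; have : <[a]>%VS \in [seq <[b]>%VS | b <- nc A].
  by rewrite map_nc mem_undup map_f.
by case/mapP => b; exists b.
Qed.

Lemma size_nc A : size (nc A) = size (undup [seq <[b]>%VS | b <- A]).
Proof. by rewrite -map_nc size_map. Qed.

End Count.

Section Restriction.
Variables (K : numFieldType) (l d : nat) (N : 'M[K]_(d, l)).
Implicit Types (a b : 'cV[K]_l) (C A : seq 'cV[K]_l).

(* Restriction to the subspace spanned by the rows of N. *)
Definition rest : l.-tuple {mpoly K[d]} := [tuple lin (col j N) | j < l].

Lemma rest_lin a : lin a \mPo rest = lin (N *m a).
Proof.
rewrite {1}/lin raddf_sum /=.
have -> : N *m a = \sum_j a j 0 *: col j N.
  apply/matrixP => i j; rewrite ord1 mxE summxE; apply: eq_bigr => t _.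
  by rewrite !mxE mulrC.
rewrite linear_sum; apply: eq_bigr => j _.
by rewrite comp_mpolyZ comp_mpolyXU -tnth_nth tnth_mktuple linearZ.
Qed.

Lemma rest_ev p (y : 'rV[K]_d) : (p \mPo rest).@[y 0] = p.@[(y *m N) 0].
Proof.
rewrite comp_mpoly_meval; apply: meval_eq => j.
rewrite tnth_mktuple meval_lin evE mxE; apply: eq_bigr => i _.
by rewrite mxE.
Qed.

Lemma rest_homog p e : p \is e.-homog -> p \mPo rest \is e.-homog.
Proof.
move=> hp; rewrite comp_mpolyEX big_seq rpred_sum // => m mp; apply: rpredZ.
have -> : e = (\sum_i m i)%N by rewrite -mdegE (dhomog_mf hp mp).
rewrite comp_mpolyX.
apply: homog_prod_seq => j; rewrite tnth_mktuple.
by rewrite -[X in X.-homog]mul1n; apply: dhomogMn; apply: lin_homog.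
Qed.

(** A form [w] on the subspace is extended to [pinvmx N *m w], the derivation is applied and the
    result restricted. By [restd_app] any extension gives the same for a derivation tangent to the
    subspace. *)
Definition restd (th : 'rV[{mpoly K[l]}]_l) : 'rV[{mpoly K[d]}]_d :=
  map_mx (fun p => p \mPo rest) th *m map_mx (@mpolyC d K) (pinvmx N).

Lemma restd_homog (th : 'rV[{mpoly K[l]}]_l) e : (forall j, th 0 j \is e.-homog) ->
  forall j, restd th 0 j \is e.-homog.
Proof.
move=> h j; rewrite mxE rpred_sum // => i _; rewrite !mxE mulrC mul_mpolyC.
by apply: rpredZ; apply: rest_homog.
Qed.

(** Stated dually: the forms that vanish on the row space of [N] are those in the span of [C], so
    this row space is the annihilator of [C]. *)
Definition is_flat C : Prop := row_free N /\ forall u, (N *m u == 0) = (u \in <<C>>%VS).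

Variable C : seq 'cV[K]_l.
Hypothesis NC : is_flat C.

Lemma flat_notin a : a \notin <<C>>%VS -> N *m a != 0.
Proof. by case: NC => _ ->. Qed.

Lemma flat0 a : a \in C -> N *m a = 0.
Proof. by case: NC => _ h aC; apply/eqP; rewrite h memv_span. Qed.

Lemma restd_app th a : (forall c, c \in C -> mdvd (lin c) (app th c)) ->
  app (restd th) (N *m a) = app th a \mPo rest.
Proof.
move=> tg; have [rN hN] := NC.
have appE0 u : (app th u \mPo rest) =
    (map_mx (fun p => p \mPo rest) th *m map_mx (@mpolyC d K) u) 0 0.
  rewrite appE mxE raddf_sum /=; apply: eq_bigr => i _.
  by rewrite rmorphM /= comp_mpolyC !mxE.
have z u : u \in <<C>>%VS -> app th u \mPo rest = 0.
  move=> /span_comb ->; elim/big_ind: _ => [|v w hv hw|i _].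
  - by rewrite app0r raddf0.
  - by rewrite appDr raddfD /= hv hw addr0.
  rewrite appZr linearZ /=; have cC : C`_i \in C by rewrite mem_nth.
  have [r ->] := tg _ cC.
  by rewrite rmorphM /= rest_lin flat0 // linear0 mul0r scaler0.
rewrite /app /restd -mulmxA -map_mxM -appE0; apply/eqP; rewrite -subr_eq0.
rewrite -raddfB /=.
have -> : app th (pinvmx N *m (N *m a)) - app th a = app th (pinvmx N *m (N *m a) - a).
  by rewrite -scaleN1r -[in RHS]scaleN1r appDr appZr.
rewrite z // -hN mulmxBr (mulmxA N (pinvmx N)) mulmxVp // mul1mx subrr //.
Qed.

Lemma flat_point (x : 'rV[K]_l) : (forall c, c \in C -> ev x c = 0) ->
  exists y, x = y *m N.
Proof.
move=> hx; have [rN hN] := NC; exists (x *m pinvmx N).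
apply/eqP; rewrite -subr_eq0; apply/eqP.
have -> : x - x *m pinvmx N *m N = x *m (1%:M - pinvmx N *m N).
  by rewrite mulmxBr mulmx1 (mulmxA x (pinvmx N)).
have z u : u \in <<C>>%VS -> ev x u = 0.
  move=> /span_comb ->; elim/big_ind: _ => [|v w hv hw|i _].
  - by rewrite ev0r.
  - by rewrite evDr hv hw addr0.
  by rewrite evZr hx ?mulr0 // mem_nth.
apply/rowP => j; have hc m (A : 'M[K]_(m, l)) (B : 'M[K]_l) : A *m col j B = col j (A *m B).
  by rewrite !colE mulmxA.
have := z (col j (1%:M - pinvmx N *m N)) _; rewrite -hN /ev !hc.
rewrite mulmxBr mulmx1 (mulmxA N (pinvmx N)) mulmxVp // mul1mx subrr.
rewrite mxE => ->; first by rewrite mxE.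
by apply/eqP/matrixP => i t; rewrite !mxE.
Qed.

End Restriction.

Section Chain.
Variables (K : numFieldType) (l : nat).
Notation S := {mpoly K[l]}.
Implicit Types (a b : 'cV[K]_l) (C A D : seq 'cV[K]_l).

Lemma exists_flat C : exists d (N : 'M[K]_(d, l)), is_flat N C.
Proof.
pose N := (cokermx (colmx C)^T)^T; exists _, (row_base N); split.
  exact: row_base_free.
move=> u; have -> : (row_base N *m u == 0) = (N *m u == 0).
  apply/eqP/eqP => [h|h].
    have /submxP [Q ->] : (N <= row_base N)%MS by rewrite eq_row_base.
    by rewrite -mulmxA h mulmx0.
  have /submxP [Q ->] : (row_base N <= N)%MS by rewrite eq_row_base.
  by rewrite -mulmxA h mulmx0.
have -> : (N *m u == 0) = (u^T <= (colmx C)^T)%MS.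
  by rewrite submxE -trmx_eq0 trmx_mul trmxK.
apply/idP/idP => [/submxP [Q /(congr1 trmx)]|].
  rewrite trmx_mul !trmxK colmx_comb => ->.
  by apply: memv_suml => j _; rewrite memvZ // memv_span // mem_nth.
move=> /span_comb e; apply/submxP; exists (\row_i coord (in_tuple C) i u).
apply: trmx_inj; rewrite trmx_mul !trmxK colmx_comb {1}e.
by apply: eq_bigr => i _; rewrite !mxE.
Qed.

(** This is [pencil_bound] on the annihilator of [D]. The restriction of [th] is logarithmic there
    because [th] is tangent to [D], and the planes through the restriction of [be] correspond to
    traces on the annihilator of [be :: D]. *)
Lemma cnt_drop D be A (th : 'rV[S]_l) e x :
  (forall a, a \in A -> a \notin <<be :: D>>%VS) -> be \notin <<D>>%VS ->
  logd A th -> (forall j, th 0 j \is e.-homog) ->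
  (forall c, c \in D -> mdvd (lin c) (app th c)) ->
  (forall c, c \in be :: D -> ev x c = 0) -> (forall a, a \in A -> ev x a != 0) ->
  (app th be).@[x 0] != 0 ->
  (cnt <<D>> A <= e + cnt <<be :: D>> A)%N.
Proof.
move=> hA hbe lA he tg xD xA nz; have [d [N NC]] := exists_flat D.
have [y ey] : exists y, x = y *m N.
  by apply: (flat_point NC) => c cD; apply: xD; rewrite in_cons cD orbT.
have hD a : a \in A -> a \notin <<D>>%VS.
  by move=> /hA; apply: contra => h; rewrite span_cons; apply: subvP h; apply: addvSr.
have evN a : ev y (N *m a) = ev x a by rewrite /ev mulmxA -ey.
pose A' := nc [seq N *m a | a <- A].
have A0 : 0 \notin [seq N *m a | a <- A].
  by apply/mapP => -[a /hD /(flat_notin NC) h e0]; rewrite -e0 eqxx in h.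
have A'P w : w \in A' -> exists2 a, a \in A & w = N *m a by move/nc_sub/mapP.
have al0 : N *m be != 0 by apply: (flat_notin NC).
have app_r a : app (restd N th) (N *m a) = app th a \mPo rest N by apply: (restd_app NC).
have [||||||h _] := @pencil_bound K d (N *m be) A' (restd N th) e y al0.
- exact: noncollinear_nc.
- move=> b /A'P [a aA ->]; rewrite app_r; have [r ->] := lA _ aA.
  by exists (r \mPo rest N); rewrite rmorphM /= rest_lin.
- exact: restd_homog.
- by rewrite evN xD ?mem_head.
- by move=> b /A'P [a aA ->]; rewrite evN xA.
- move=> h; have := mdvd_lin_ev h; rewrite app_r => /(_ y).
  rewrite rest_ev -ey evN xD ?mem_head // => /(_ erefl) /eqP.
  by rewrite (negbTE nz).
have filt U : (forall a, a \in A -> a \notin U) -> [seq a <- A | a \notin U] = A.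
  by move=> hU; apply/all_filterP/allP.
rewrite /cnt !filt //; apply: leq_trans (leq_trans h _).
  rewrite size_nc -map_comp; apply: size_undup_map_le => a a' aA aA' /= e1.
  apply: addv_line_eq; first exact: hD.
  have : N *m a \in <[N *m a']>%VS by rewrite -e1 memv_line.
  case/vlineP => k ek; apply/mem_addv_line; exists k.
  by case: NC => _ <-; rewrite mulmxBr -scalemxAr ek subrr.
rewrite leq_add2l; apply: (@leq_trans (size (undup [seq plane (N *m be) w | w <- [seq N *m a | a <- A]]))).
  apply: uniq_leq_size (undup_uniq _) _ => W; rewrite !mem_undup.
  by case/mapP => b /nc_sub bA ->; apply: map_f.
rewrite -map_comp; apply: size_undup_map_le => a a' aA aA' /= e1.
have h1 : N *m a \notin <[N *m be]>%VS.
  apply: contra (hA _ aA) => /vlineP [k ek]; rewrite span_cons addvC.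
  apply/mem_addv_line; exists k.
  by case: NC => _ <-; rewrite mulmxBr -scalemxAr ek subrr.
apply: plane_eq => //; apply/mem_plane.
have : a \in (<<be :: D>> + <[a']>)%VS by rewrite -e1 (subvP (addvSr _ _)) ?memv_line.
case/mem_addv_line => k; rewrite span_cons addvC => /mem_addv_line [k'].
case: (NC) => _ <-; rewrite !mulmxBr -!scalemxAr subr_eq0 subr_eq => /eqP ek.
by exists k', k.
Qed.

End Chain.

Lemma free_span_notin (K : fieldType) (E : vectType K) (X Y : seq E) a :
  free X -> a \in X -> {subset Y <= X} -> a \notin Y -> a \notin <<Y>>%VS.
Proof.
move=> fX aX YX aY; have : free (a :: rem a X) by rewrite -(perm_free (perm_to_rem aX)).
rewrite free_cons => /andP [h _]; apply: contra h; apply: subvP; apply: sub_span.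
move=> y yY; rewrite (mem_rem_uniq _ (free_uniq fX)) inE (YX _ yY) andbT.
by apply: contraNneq aY => <-.
Qed.

Lemma subset_card (T : finType) (A : {set T}) m : (m <= #|A|)%N ->
  exists2 B : {set T}, B \subset A & #|B| = m.
Proof.
move=> mA; exists [set x in take m (enum A)].
  by apply/subsetP => x; rewrite inE => /mem_take; rewrite mem_enum.
rewrite cardsE (card_uniqP _) ?take_uniq ?enum_uniq // size_takel //.
by rewrite -cardE.
Qed.

Lemma card_enum_filter (T : finType) (p : pred T) :
  size [seq i <- enum T | p i] = #|[set i | p i]|.
Proof.
rewrite cardE; apply: perm_size; apply: uniq_perm.
- by apply: filter_uniq; apply: enum_uniq.
- exact: enum_uniq.
by move=> i; rewrite mem_filter !mem_enum !inE ?andbT.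
Qed.

Lemma addn_subn_inj a q c : (a + (q - c) = q -> c <= q -> a = c)%N.
Proof. by move=> h1 h2; apply/eqP; rewrite -(eqn_add2r (q - c)) h1 subnKC. Qed.

Lemma flat_count_arith S1 ck T X ck' Y B q r c :
  (S1 + ck = T -> B <= X + ck' -> X + r <= Y -> T = B + q -> r = q - c ->
   ck = ck' + c -> c <= q -> S1 <= Y)%N.
Proof. lia. Qed.

Lemma size_undup_cat_disj (T : eqType) (X Y : seq T) :
  (forall w, w \in X -> w \notin Y) ->
  size (undup (X ++ Y)) = (size (undup X) + size (undup Y))%N.
Proof.
move=> h; rewrite undup_cat size_cat; congr (size _ + _)%N.
by apply/all_filterP/allP => w; rewrite mem_undup => /h.
Qed.

Lemma mulmx_eq_rows (D : pzSemiRingType) m n (u : 'rV[D]_m) (A B : 'M[D]_(m, n)) :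
  (forall i, u 0 i = 0 \/ row i A = row i B) -> u *m A = u *m B.
Proof.
move=> h; rewrite !mulmx_sum_row; apply: eq_bigr => i _.
by case: (h i) => ->; rewrite ?scale0r.
Qed.

(** * A flat of each codimension *)

Section Flats.
Variables (K : numFieldType) (l : nat) (s : seq 'cV[K]_l) (ht : 'cV[K]_l -> nat).
Notation S := {mpoly K[l]}.
Notation mC := (map_mx (@mpolyC l K)).
Hypothesis mf : mat_free s ht.

Let ns : noncollinear s. Proof. by case: mf. Qed.
Notation stage := (stage s ht).

Lemma noncollinear_dvd a b : a \in s -> b \in s -> mdvd (lin a) (lin b) -> a = b.
Proof.
move=> sa sb /(lin_dvd_lin (noncollinear_neq0 ns sa)) h; apply/eqP.
by apply: contraTT h; apply: noncollinear_notin ns sa sb.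
Qed.

Section Stage.
Variables (k : nat) (e : 'I_l -> nat) (M Phi : 'M[S]_l) (b : 'I_l -> 'cV[K]_l).
Hypothesis st : stage k e M Phi b.

Lemma stage_b_level i : e i == k -> b i \in level s ht k.
Proof.
move=> ei; case: st => _ _ /perm_mem <- _ _.
by apply: map_f; rewrite mem_filter ei mem_enum.
Qed.

Lemma stage_b_inj i j : e i == k -> e j == k -> b i = b j -> i = j.
Proof.
move=> ei ej; case: st => _ _ h _ _.
have : uniq [seq b i | i <- enum 'I_l & e i == k].
  by rewrite (perm_uniq h) filter_uniq // noncollinear_uniq.
by move/map_uniq_in; apply; rewrite mem_filter ?ei ?ej mem_enum.
Qed.

Lemma stage_level_b a : a \in level s ht k -> exists2 i, e i == k & a = b i.
Proof.
case: st => _ _ /perm_mem <- _ _ /mapP [i]; rewrite mem_filter => /andP [ei _] ->.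
by exists i.
Qed.

Lemma level_s a j : a \in level s ht j -> a \in s.
Proof. by rewrite mem_filter => /andP []. Qed.

Lemma below_s a j : a \in below s ht j -> a \in s.
Proof. by rewrite mem_filter => /andP []. Qed.

(** Row [i] of [M] is tangent to [a] and has the factor [lin (b i)] at most; this factor is prime to
    [lin a] when [b i] is not [a]. *)
Lemma stage_Phi_dvd i a : a \in below s ht k.+1 ->
  (e i == k -> b i <> a) -> mdvd (lin a) (app (row i Phi) a).
Proof.
move=> ha hb; case: st => [[lM _ _ _] _ _ rM _]; have := lM i a ha.
rewrite rM appZl; case: ifP hb => [ei /(_ isT) ba|_ _]; last by rewrite mul1r.
have sa := below_s ha; case/(lin_prime (noncollinear_neq0 ns sa)) => //.
move=> /noncollinear_dvd h; case: ba; rewrite h //.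
exact: level_s (stage_b_level ei).
Qed.

Lemma level_below a : a \in level s ht k -> a \in below s ht k.+1.
Proof. by move=> h; rewrite (perm_mem (perm_below_level s ht k)) mem_cat h orbT. Qed.

Lemma below_below a : a \in below s ht k -> a \in below s ht k.+1.
Proof. by move=> h; rewrite (perm_mem (perm_below_level s ht k)) mem_cat h. Qed.

Lemma below_level_disj a : a \in below s ht k -> a \in level s ht k -> False.
Proof.
rewrite !mem_filter => /andP [h _] /andP [/eqP h' _].
by rewrite h' ltnn in h.
Qed.

Lemma stage_Phi_logd i : logd (below s ht k) (row i Phi).
Proof.
move=> a ha; apply: stage_Phi_dvd; first exact: below_below.
move=> /stage_b_level h e1; rewrite e1 in h; exact: below_level_disj ha h.
Qed.

Lemma stage_Phi_unit x : (forall a, a \in below s ht k -> ev x a != 0) ->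
  map_mx (meval (x 0)) Phi \in unitmx.
Proof.
move=> hx; rewrite unitmxE det_map_mx; case: st => _ _ _ _ [_ [c c0 ->]].
rewrite unitfE /= mevalZ mulf_neq0 // /pi_lin rmorph_prod /= prodf_seq_neq0.
by apply/allP => a /hx; rewrite /= meval_lin.
Qed.

Lemma notin_span_level a D : a \in below s ht k -> {subset D <= level s ht k} ->
  a \notin <<D>>%VS.
Proof.
rewrite mem_filter => /andP [ak sa] hD; case: mf => _ _ _ h _.
by apply: contra (h k a sa ak); apply: subvP; apply: sub_span.
Qed.

Lemma cnt0 (A : seq 'cV[K]_l) : noncollinear A -> cnt 0%VS A = size A.
Proof.
move=> nA; rewrite /cnt (all_filterP _); last first.
  by apply/allP => a aA; rewrite memv0 (noncollinear_neq0 nA aA).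
under eq_map => a do rewrite add0v.
by rewrite undup_id ?size_map //; case/andP: nA.
Qed.

(** The other rows of [Phi] are tangent to [be]. If this value vanished as well, the value of [Phi]
    at [x], which is invertible, would kill [be]. *)
Lemma stage_app_ev x i be : e i == k -> b i = be ->
  (forall a, a \in below s ht k -> ev x a != 0) -> ev x be = 0 ->
  (app (row i Phi) be).@[x 0] != 0.
Proof.
move=> ei bi hx xbe; apply: contraTneq (stage_Phi_unit hx) => h.
have be0 : be != 0.
  by rewrite -bi (noncollinear_neq0 ns (level_s (stage_b_level ei))).
apply: contra be0 => Pu; apply/eqP.
have : map_mx (meval (x 0)) Phi *m be = 0.
  apply/matrixP => j t; rewrite ord1 [RHS]mxE.
  have -> : (map_mx (meval (x 0)) Phi *m be) j 0 = (app (row j Phi) be).@[x 0].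
    by rewrite app_ev map_row /ev -row_mul [RHS]mxE.
  have [->//|ji] := eqVneq j i.
  apply: (mdvd_lin_ev _ xbe); apply: stage_Phi_dvd.
    by rewrite -bi; apply: level_below; apply: stage_b_level.
  move=> ej e1; case/eqP: ji; apply: stage_b_inj => //; by rewrite e1.
by move/(congr1 (mulmx (invmx (map_mx (meval (x 0)) Phi)))); rewrite mulKmx // mulmx0.
Qed.

(** Each form [be] of [D] lowers the count by at most [k.-1]: the row of [Phi] attached to [be] has
    this degree, is tangent to the other forms of the level, and does not vanish on [be] at a
    generic point of the flat. *)
Lemma cnt_chain D : (0 < k)%N -> uniq D -> {subset D <= level s ht k} ->
  (size (below s ht k) <= cnt <<D>> (below s ht k) + size D * k.-1)%N.
Proof.
move=> k0; elim: D => [|be D IH] /= uD hD.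
  by rewrite mul0n addn0 span_nil cnt0 ?noncollinear_below.
case/andP: uD => beD uD; have hD' : {subset D <= level s ht k}.
  by move=> a aD; apply: hD; rewrite in_cons aD orbT.
have hbe : be \in level s ht k by apply: hD; rewrite mem_head.
have [_ _ hf _ _] := mf.
have [i ei bi] := stage_level_b hbe.
have [|x [xD xA]] := @dual_point K l (be :: D) (below s ht k).
  by move=> a ha; apply: notin_span_level.
apply: leq_trans (IH uD hD') _; rewrite mulSn addnA leq_add2r addnC.
apply: (@cnt_drop _ _ _ _ _ (row i Phi) _ x) => //.
- by move=> a ha; apply: notin_span_level.
- exact: free_span_notin (hf k) hbe hD' beD.
- exact: stage_Phi_logd.
- move=> j; case: st => _ _ _ _ [h _]; rewrite mxE.
  by have := h i j; rewrite ei (eqP ei) subn1.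
- move=> c cD; apply: stage_Phi_dvd; first by apply: level_below; apply: hD'.
  by move=> _ e1; move: beD; rewrite bi e1 cD.
- by apply: (stage_app_ev ei) => //; apply: xD; rewrite mem_head.
Qed.

End Stage.

(* The derivations M i, for i in I, are tangent to the annihilator of C and their
   values at its point x are independent; the members of I have the smallest
   degrees. *)
Definition flat_data (c k : nat) (M : 'M[S]_l) (e : 'I_l -> nat) : Prop :=
  exists (C : seq 'cV[K]_l) (I : {set 'I_l}) (x : 'rV[K]_l),
  [/\ [/\ size C = c, free C & {subset C <= s}],
      forall a, a \in C -> ev x a = 0,
      (#|I| + c)%N = l /\ forall u : 'rV[K]_l, (forall i, i \notin I -> u 0 i = 0) ->
        u *m map_mx (meval (x 0)) M = 0 -> u = 0,
      (\sum_(i in I) e i <= cnt <<C>> s)%N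
    & exists m, [/\ (m < k)%N, forall i, i \in I -> (e i <= m)%N
        & forall i, i \notin I -> (m <= e i)%N]].

Section TwoStages.
Variables (k : nat) (e e' : 'I_l -> nat) (M Phi M' Phi' : 'M[S]_l).
Variables (b b' : 'I_l -> 'cV[K]_l) (G : 'M[K]_l).
Hypotheses (k0 : (0 < k)%N) (st : stage k e M Phi b) (st' : stage k.+1 e' M' Phi' b').
Hypotheses (PhiE : Phi' = mC G *m M) (Gu : G \in unitmx).
Hypothesis Gid : forall i i', (e i < k)%N || (e i' < k)%N -> G i i' = (i == i')%:R.
Hypothesis e'E : forall i, e' i = (e i + (e' i == k.+1))%N.

(** The members of [I] have degree at most [m < k]. The recombination [G] fixes them and none is
    multiplied by a new form, so the same flat still serves. *)
Lemma flat_data_next c : flat_data c k M e -> flat_data c k.+1 M' e'.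
Proof.
move=> [C [I [x [h1 h2 [h3 h4] h5 [m [h6 h7 h8]]]]]].
have e'I i : i \in I -> e' i = e i /\ e' i != k.+1.
  move=> iI; have := e'E i; case: eqP => [->|_]; last by rewrite addn0.
  by have := h7 _ iI; lia.
have rM i : i \in I -> row i M' = row i M.
  move=> iI; have [_ /negbTE ne] := e'I _ iI.
  have [_ _ _ -> _] := st'; rewrite ne scale1r PhiE row_mC_mul (bigD1 i) //=.
  have ek : (e i < k)%N by rewrite (leq_ltn_trans (h7 _ iI)).
  rewrite Gid ?ek // eqxx mpolyC1 scale1r big1 ?addr0 // => j ji.
  by rewrite Gid ?ek // eq_sym (negbTE ji) mpolyC0 scale0r.
exists C, I, x; split => //.
- split=> // u hu h0; apply: h4 => //; rewrite -[RHS]h0; apply: mulmx_eq_rows => i.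
  have [iI|/hu ->] := boolP (i \in I); last by left.
  by right; rewrite -!map_row rM.
- by rewrite (eq_bigr e) // => i /e'I [].
exists m; split=> // [|i iI|i iI]; first exact: leqW.
- by have [-> _] := e'I _ iI; apply: h7.
- by rewrite e'E; apply: leq_trans (h8 _ iI) (leq_addr _ _).
Qed.

(** Level [k] is the last one with at least [c] forms. Thus [c] members of degree [k] can be given
    up in such a way that all those raised to degree [k.+1] are among them. *)
Lemma flat_data_new c : (c <= size (level s ht k))%N ->
  (size (level s ht k.+1) < c)%N -> flat_data c k.+1 M' e'.
Proof.
move=> cq qc; pose J := [set i | e i == k]; pose J' := [set i | e' i == k.+1].
have [hf ek hp rM _] := st; have [_ _ hp' rM' _] := st'.
have cardJ : #|J| = size (level s ht k).
  by rewrite -(perm_size hp) size_map card_enum_filter.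
have cardJ' : #|J'| = size (level s ht k.+1).
  by rewrite -(perm_size hp') size_map card_enum_filter.
have J'J : J' \subset J.
  apply/subsetP => i; rewrite !inE => /eqP h; have := e'E i; rewrite h eqxx addn1.
  by move=> [->].
(* [I2] consists of the members of degree [k] that are kept. The next stage does not raise them, and
   there are enough of them because [#|J'| < c]. *)
have [|I2 I2s cI2] := @subset_card _ (J :\: J') (#|J| - c).
  by rewrite cardsD (setIidPr J'J) leq_sub2l // cardJ' ltnW.
have I2J i : i \in I2 -> e i = k /\ e' i = k.
  move=> /(subsetP I2s); rewrite !inE => /andP [h /eqP h2]; split=> //.
  by rewrite e'E (negbTE h) addn0.
pose I := ~: J :|: I2.
have e'I i : i \in I -> e' i = e i /\ e' i != k.+1.
  rewrite !inE => /orP [h|/I2J [-> ->]]; last by rewrite neq_ltn ltnSn.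
  suff h2 : e' i != k.+1 by split=> //; rewrite e'E (negbTE h2) addn0.
  apply: contra h => h; have := e'E i; rewrite h (eqP h) addn1 => -[<-]; exact: eqxx.
pose r := #|I2|; pose f1 : 'I_r -> 'I_l := @enum_val _ (mem I2).
have f1I : injective f1 by apply: enum_val_inj.
pose A := rowsub f1 G.
have Afree : row_free A.
  apply: inj_row_free => v; rewrite /A -[G]mul1mx -mul_rowsub_mx mulmxA => h.
  have {}h : v *m rowsub f1 1%:M = 0 by rewrite -[LHS](mulmxK Gu) h mul0mx.
  apply/rowP => t; have := congr1 (fun w : 'rV_l => w 0 (f1 t)) h.
  rewrite mxE (bigD1 t) //= [rowsub _ _ t _]mxE mxE eqxx mulr1 big1 => [|t' tt'].
    by rewrite addr0 => ->; rewrite !mxE.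
  by rewrite !mxE (inj_eq f1I) (negbTE tt') mulr0.
have Afull : row_full A^T by rewrite /row_full mxrank_tr; exact: Afree.
(* The columns of a nonzero minor of the rows [I2] of [G]. They lie in [J], since the columns of [G]
   outside [J] are those of the identity and vanish in these rows. *)
pose f2 : 'I_r -> 'I_l := fullrankfun Afull.
have f2I : injective f2 by apply: fullrankfun_inj.
have Ru : rowsub f2 A^T \in unitmx := fullrowsub_unit Afull.
have f1k t : e (f1 t) = k /\ f1 t \in I2.
  have h : f1 t \in I2 by apply: enum_valP.
  by have [] := I2J _ h.
have f2J t : f2 t \in J.
  rewrite inE; apply: contraT => h.
  have {}h : (e (f2 t) < k)%N by rewrite ltn_neqAle h ek.
  have h0 : row t (rowsub f2 A^T) = 0.
    apply/rowP => t'; rewrite !mxE Gid ?h ?orbT //.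
    case: eqP => // h1; have [h2 _] := f1k t'; by rewrite -h1 h2 ltnn in h.
  have := congr1 (mulmx^~ (invmx (rowsub f2 A^T))) h0.
  rewrite -row_mul mulmxV // mul0mx => /rowP /(_ t) /eqP.
  by rewrite !mxE eqxx oner_eq0.
pose J2 := [set f2 t | t : 'I_r].
have J2J : J2 \subset J by apply/subsetP => _ /imsetP [t _ ->].
have cJ2 : #|J2| = r by rewrite card_imset // card_ord.
pose eJ := [seq i <- enum 'I_l | e i == k].
(* The flat is cut out by the forms whose columns are left out of the minor; there are [c] of
   them. *)
pose C := [seq b i | i <- eJ & i \notin J2].
pose B2 := [seq b i | i <- eJ & i \in J2].
have pCB : perm_eq (C ++ B2) (level s ht k).
  rewrite /C /B2 -map_cat; apply: perm_trans hp; apply: perm_map.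
  rewrite perm_catC; exact: permEl (perm_filterC _ _).
have hlev : free (level s ht k) by case: mf.
have fCB : free (C ++ B2) by rewrite (perm_free pCB).
have CL : {subset C <= level s ht k}.
  by move=> a aC; rewrite -(perm_mem pCB) mem_cat aC.
have BL : {subset B2 <= level s ht k}.
  by move=> a aC; rewrite -(perm_mem pCB) mem_cat aC orbT.
have := free_uniq fCB; rewrite cat_uniq => /and3P [uC disj uB].
have disjB a : a \in B2 -> a \notin C.
  by move=> aB; apply: contra disj => aC; apply/hasP; exists a.
have szB : size B2 = r.
  rewrite size_map -filter_predI card_enum_filter -cJ2; apply: eq_card => i.
  rewrite !inE /=; have [/(subsetP J2J)|] := boolP (i \in J2); by rewrite ?inE.
have szC : size C = c.
  have := perm_size pCB; rewrite size_cat szB /r cI2 cardJ => /addn_subn_inj.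
  exact.
have sumI : (\sum_(i in I) e i + c * k = \sum_i e i)%N.
  rewrite [RHS](bigID (mem I)) /=; congr (_ + _)%N.
  rewrite (eq_bigr (fun=> k)); last first.
    by move=> i; rewrite !inE negb_or negbK => /andP [/eqP].
  rewrite sum_nat_const; congr (_ * _)%N.
  have -> : #|[pred i | i \notin I]| = #|J :\: I2|.
    by apply: eq_card => i; rewrite !inE negb_or negbK andbC.
  rewrite cardsD (setIidPr _) ?cI2; last first.
    by apply: (subset_trans I2s); apply: subsetDl.
  by rewrite subKn // cardJ.
have cI : (#|I| + c = l)%N.
  rewrite cardsU (_ : ~: J :&: I2 = set0) ?cards0 ?subn0; last first.
    by apply/setP => i; rewrite !inE; apply/negP => /andP [/negP h /I2J [/eqP]].
  rewrite cI2 cardJ -addnA (subnK cq) -cardJ addnC.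
  by rewrite -[RHS]card_ord; exact: cardsC.
have [|x [xC xA]] := @dual_point K l C (below s ht k ++ B2).
  move=> a; rewrite mem_cat => /orP [h|h]; first exact: notin_span_level h CL.
  exact: free_span_notin hlev (BL _ h) CL (disjB _ h).
have xb a : a \in below s ht k -> ev x a != 0 by move=> h; apply: xA; rewrite mem_cat h.
exists C, I, x; split => //.
- split=> //; first exact: catl_free fCB.
  by move=> a /CL; apply: level_s.
- split=> // u hu hM.
  have rM'I i : i \in I -> row i M' = row i Phi'.
    by move=> /e'I [_ /negbTE h]; rewrite rM' h scale1r.
  have {}hM : u *m G *m map_mx (meval (x 0)) M = 0.
    rewrite -[RHS]hM -mulmxA.
    have -> : G *m map_mx (meval (x 0)) M = map_mx (meval (x 0)) Phi'.
      rewrite PhiE map_mxM; congr (_ *m _); apply/matrixP => i j.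
      by rewrite !mxE /= mevalC.
    apply: mulmx_eq_rows => i.
    have [iI|/hu ->] := boolP (i \in I); last by left.
    by right; rewrite -!map_row rM'I.
  (* The factor between row [i] of [Phi] and row [i] of [M] at [x]. It vanishes exactly for the
     forms of [C], so a relation forces zero coordinates of [u *m G] on the minor and outside
     [J]. *)
  pose lam i := if e i == k then ev x (b i) else 1.
  have {}hM : \row_i ((u *m G) 0 i * lam i) = 0.
    have Pu := stage_Phi_unit st xb; rewrite -[LHS](mulmxK Pu).
    rewrite (_ : _ *m map_mx _ Phi = 0) ?mul0mx // -[RHS]hM !mulmx_sum_row.
    apply: eq_bigr => i _; rewrite [X in X *: _]mxE -scalerA; congr (_ *: _).
    rewrite -!map_row rM; apply/rowP => j; rewrite !mxE mevalM /lam.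
    by case: ifP => _; rewrite ?meval_lin ?meval1.
  have w0 i : lam i != 0 -> (u *m G) 0 i = 0.
    move=> li; have /rowP /(_ i) /eqP := hM.
    by rewrite [X in X == _]mxE [X in _ == X]mxE mulf_eq0 (negbTE li) orbF => /eqP.
  have uJ i : i \notin J -> u 0 i = 0.
    rewrite inE => ei; have lti : (e i < k)%N by rewrite ltn_neqAle ei ek.
    have := w0 i; rewrite /lam (negbTE ei) oner_neq0 => /(_ isT).
    rewrite mxE (bigD1 i) //= Gid ?lti ?orbT // eqxx mulr1 big1 ?addr0 // => j ji.
    by rewrite Gid ?lti ?orbT // (negbTE ji) mulr0.
  have uI2 i : i \notin I2 -> u 0 i = 0.
    move=> h; have [iJ|/uJ //] := boolP (i \in J).
    by apply: hu; rewrite !inE negb_or negbK h andbT; move: iJ; rewrite inE.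
  pose u2 : 'rV[K]_r := \row_t u 0 (f1 t).
  have u20 : u2 = 0.
    have Rt : (rowsub f2 A^T)^T \in unitmx by rewrite unitmx_tr.
    rewrite -[u2](mulmxK Rt) (_ : u2 *m _ = 0) ?mul0mx //.
    apply/rowP => t; rewrite mxE [RHS]mxE.
    have lamt : lam (f2 t) != 0.
      have := f2J t; rewrite /lam inE => ft; rewrite ft; apply: xA; rewrite mem_cat.
      apply/orP; right; apply: map_f; rewrite mem_filter imset_f // mem_filter ft.
      by rewrite mem_enum.
    rewrite -[RHS](w0 _ lamt) [RHS]mxE [RHS](bigID (mem I2)) /= [X in _ = _ + X]big1.
      rewrite addr0 [RHS]big_enum_val; apply: eq_bigr => t' _; rewrite !mxE.
      by [].
    by move=> i /uI2 ->; rewrite mul0r.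
  apply/rowP => i; rewrite mxE; have [iI|/uI2 //] := boolP (i \in I2).
  have := congr1 (fun v : 'rV_r => v 0 (enum_rank_in iI i)) u20.
  by rewrite !mxE /f1 enum_rankK_in.
- rewrite (eq_bigr e); last by move=> i /e'I [].
  have [hl _ hsz _] := hf.
  (* The members given up take [c * k] from the sum of the degrees. Of this, [c * k.-1] covers the
     loss of traces bounded by [cnt_chain]; the other [c] are the forms of [C] themselves, while the
     remaining forms [B2] of the level have distinct new traces. *)
  have h1 := cnt_chain st k0 uC CL; rewrite szC in h1.
  have h2 : (cnt <<C>> (below s ht k) + r <= cnt <<C>> s)%N.
    apply: (@leq_trans (cnt <<C>> (below s ht k ++ B2))); last first.
      by apply: cnt_sub => a; rewrite mem_cat => /orP [/below_s|/BL /level_s].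
    have nB a : a \in B2 -> a \notin <<C>>%VS.
      by move=> h; apply: free_span_notin hlev (BL _ h) CL (disjB _ h).
    rewrite /cnt filter_cat [[seq a <- B2 | _]](all_filterP _); last by apply/allP.
    rewrite map_cat.
    have ue : uniq [seq (<<C>> + <[a]>)%VS | a <- B2].
      rewrite map_inj_in_uniq // => a a' aB aB' e1; apply/eqP; apply: contraT => ne.
      have : a \notin <<C ++ [:: a']>>%VS; last first.
        by rewrite span_cat span_seq1 -e1 (subvP (addvSr _ _)) ?memv_line.
      apply: free_span_notin hlev (BL _ aB) _ _.
        by move=> z; rewrite mem_cat => /orP [/CL //|]; rewrite inE => /eqP ->; apply: BL.
      by rewrite mem_cat negb_or (disjB _ aB) inE.
    rewrite size_undup_cat_disj ?(undup_id ue) ?(size_map _ B2) ?szB // => W.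
    case/mapP => a; rewrite mem_filter => /andP [_ ha] ->.
    apply/mapP => -[a' aB' e1].
    have : a \notin <<C ++ [:: a']>>%VS; last first.
      by rewrite span_cat span_seq1 -e1 (subvP (addvSr _ _)) ?memv_line.
    apply: notin_span_level ha _.
    by move=> z; rewrite mem_cat => /orP [/CL //|]; rewrite inE => /eqP ->; apply: BL.
  have h3 : (\sum_i e i = size (below s ht k) + size (level s ht k))%N.
    by rewrite hsz (perm_size (perm_below_level s ht k)) size_cat.
  have h4 : r = (size (level s ht k) - c)%N by rewrite /r cI2 cardJ.
  have h5 : (c * k = c * k.-1 + c)%N by rewrite -{1}(prednK k0) mulnS addnC.
  exact: flat_count_arith sumI h1 h2 h3 h4 h5 cq.
exists k; split => // i.
- by move=> /e'I [-> _]; apply: ek.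
- by rewrite !inE negb_or negbK => /andP [/eqP h _]; rewrite e'E h leq_addr.
Qed.

End TwoStages.

Lemma saito_empty : saito (l := l) [::] (fun=> 0%N) (1%:M : 'M[S]_l).
Proof.
split=> //.
- by move=> i j; rewrite mxE; case: (i == j); rewrite ?dhomog1 ?dhomog0.
- by rewrite big1.
- by rewrite det1 oner_neq0.
Qed.

Theorem mat_free_flats : size (level s ht 1) = l ->
  exists e M, saito s e M /\
    forall c, (0 < c <= l)%N -> exists k, flat_data c k M e.
Proof.
move=> h1; have [_ ht0 _ _ _] := mf.
have b1 : below s ht 1 = [::].
  rewrite /below -(filter_pred0 s); apply: eq_in_filter => a /ht0.
  by case: (ht a).
(* At stage [k] the codimensions above the size of level [k] are settled. At level 1, which has [l]
   forms, there are none; past the greatest height the level is empty and all positive codimensions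
   are settled. *)
have stages k : (0 < k)%N -> exists e M Phi b, stage k e M Phi b /\
    forall c, (size (level s ht k) < c <= l)%N -> flat_data c k M e.
  elim: k => // k IH _; case: (posnP k) => [->|k0].
    have [|||e [M [Phi [b [G [st _ _ _ _]]]]]] :=
      @mat_step _ _ _ _ mf 1 (fun=> 0%N) 1%:M => //.
      by rewrite b1; apply: saito_empty.
    exists e, M, Phi, b; split=> // c; rewrite h1 => /andP [h2 h3].
    by rewrite ltnNge h3 in h2.
  have [e [M [Phi [b [st hc]]]]] := IH k0.
  have [sM ek _ _ _] := st.
  have [|||e' [M' [Phi' [b' [G [st' PhiE Gu Gid e'E]]]]]] :=
    @mat_step _ _ _ _ mf k.+1 e M => //.
  exists e', M', Phi', b'; split=> // c /andP [c1 c2].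
  have [cq|cq] := leqP c (size (level s ht k)).
    exact: flat_data_new st st' PhiE Gu Gid e'E _ cq c1.
  by apply: (flat_data_next k0 st' PhiE Gu Gid e'E); apply: hc; rewrite cq.
pose k := (\max_(a <- s) ht a).+1.
have hk a : a \in s -> (ht a < k)%N.
  by move=> sa; rewrite ltnS; apply: (leq_bigmax_seq (F := ht)).
have [e [M [Phi [b [st hc]]]]] := stages k isT.
exists e, M; case: (st) => sM _ _ _ _; split.
  have <- : below s ht k.+1 = s => //.
  by apply/all_filterP/allP => a /hk h; apply: leqW.
move=> c /andP [c0 cl]; exists k; apply: hc; rewrite cl andbT.
rewrite (_ : level s ht k = [::]) //.
rewrite /level -(filter_pred0 s); apply: eq_in_filter => a /hk h.
by apply: negbTE; rewrite neq_ltn h.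
Qed.

End Flats.

(** * Arrangements and their logarithmic derivations *)

Section Derivations.
Variables (K : fieldType) (V : vectType K).
Notation l := (\dim {:V}).
Notation S := (symV V).

Definition dth (th : 'rV[S]_l) (p : S) : S := \sum_j th 0 j * p^`M(j).

Lemma dth_derivation th : derivation (dth th).
Proof.
split=> [c p q|p q]; rewrite /dth.
  rewrite scaler_sumr -big_split; apply: eq_bigr => j _ /=.
  by rewrite mderivD mderivZ mulrDr scalerAr.
rewrite mulr_suml mulr_sumr -big_split; apply: eq_bigr => j _ /=.
by rewrite mderivM; ring.
Qed.

Lemma dthX th j : dth th 'X_j = th 0 j.
Proof.
rewrite /dth (bigD1 j) //= mderivX mnmE eqxx scale1r.
have -> : (U_(j) - U_(j))%MM = 0%MM by apply/mnmP => i; rewrite mnmBE mnm0E subnn.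
rewrite mpolyX0 mulr1.
rewrite big1 ?addr0 // => i ij.
by rewrite mderivX mnmE eq_sym (negbTE ij) scale0r mulr0.
Qed.

Section Linear.
Variable (D : S -> S).
Hypothesis hD : derivation D.

Lemma deriv0 : D 0 = 0.
Proof. by case: hD => h _; have := h (-1) 0 0; rewrite scaler0 addr0 scaleN1r addNr. Qed.

Lemma derivZ c p : D (c *: p) = c *: D p.
Proof. by case: hD => h _; rewrite -[c *: p]addr0 h deriv0 addr0. Qed.

Lemma derivD p q : D (p + q) = D p + D q.
Proof. by case: hD => h _; rewrite -[p]scale1r h !scale1r. Qed.

Lemma deriv_sum (I : Type) (r : seq I) (F : I -> S) :
  D (\sum_(i <- r) F i) = \sum_(i <- r) D (F i).
Proof. by elim: r => [|i r IH]; rewrite ?big_nil ?deriv0 // !big_cons derivD IH. Qed.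

Lemma derivE p : D p = dth (\row_j D 'X_j) p.
Proof.
have [_ hM] := hD; set th := \row_j _; have [hL' hM'] := dth_derivation th.
have h1 : D 1 = 0.
  have := hM 1 1; rewrite !mulr1 mul1r => /eqP.
  by rewrite -subr_eq0 opprD addNKr oppr_eq0 => /eqP.
have h1' : dth th 1 = 0.
  by rewrite /dth big1 // => j _; rewrite -mpolyC1 mderivC mulr0.
pose good p := D p = dth th p.
have gM p1 p2 : good p1 -> good p2 -> good (p1 * p2).
  by rewrite /good hM hM' => -> ->.
have g1 : good 1 by rewrite /good h1 h1'.
have gX m : good 'X_[m].
  rewrite mpolyXE_id; elim/big_ind: _ => // j _.
  elim: (m j) => [|k IH]; rewrite ?expr0 // exprS; apply: gM => //.
  by rewrite /good dthX mxE.
rewrite [p in LHS]mpolyE [p in RHS]mpolyE.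
elim: (msupp p) => [|m r IH]; first by rewrite !big_nil deriv0 /dth big1 // => j _; rewrite raddf0 mulr0.
by rewrite !big_cons derivD derivZ hL' IH gX.
Qed.

End Linear.

Definition lform_fun (a : 'cV[K]_l) (v : V) : K^o :=
  \sum_i coord (vbasis {:V}) i v * a i 0.

Lemma lform_fun_linear a : linear (lform_fun a).
Proof.
move=> c u v; rewrite /lform_fun scaler_sumr -big_split; apply: eq_bigr => i _ /=.
by rewrite linearP /= mulrDl scalerAl.
Qed.
HB.instance Definition _ a :=
  GRing.isLinear.Build K V K^o *:%R (lform_fun a) (lform_fun_linear a).

Definition lform a : 'Hom(V, K^o) := linfun (lform_fun a).

Lemma lformE a v : lform a v = \sum_i coord (vbasis {:V}) i v * a i 0.
Proof. by rewrite /lform lfunE. Qed.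

Lemma coord_vbasis_nth (i j : 'I_l) : coord (vbasis {:V}) i (vbasis {:V})`_j = (i == j)%:R.
Proof. by rewrite coord_free ?(basis_free (vbasisP _)) // eq_sym. Qed.

Lemma lform_basis a (i : 'I_l) : lform a (vbasis {:V})`_i = a i 0.
Proof.
rewrite lformE (bigD1 i) //= coord_vbasis_nth eqxx mul1r big1 ?addr0 // => j ji.
by rewrite coord_vbasis_nth (negbTE ji) mul0r.
Qed.

Lemma lformP (al : 'Hom(V, K^o)) (a : 'cV[K]_l) :
  (forall i : 'I_l, al (vbasis {:V})`_i = a i 0) -> al = lform a.
Proof.
move=> h; apply/lfunP => v; rewrite lformE {1}(coord_vbasis (memvf v)).
rewrite linear_sum; apply: eq_bigr => i _ /=.
by rewrite linearZ /= h.
Qed.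

Lemma hom_lform (al : 'Hom(V, K^o)) : exists a, al = lform a.
Proof.
exists (\col_i al (vbasis {:V})`_i); apply: lformP => i; by rewrite mxE.
Qed.

Lemma lformZ c a : lform (c *: a) = c *: lform a.
Proof.
apply/esym/lformP => i; by rewrite scale_lfunE lform_basis mxE.
Qed.

Lemma linear_form_lform a : linear_form (lform a) = lin a.
Proof. by rewrite /linear_form /lin; apply: eq_bigr => i _; rewrite lform_basis. Qed.

Definition hyp a : {vspace V} := lker (lform a).

Lemma mem_hyp a v : (v \in hyp a) = (lform a v == 0).
Proof. by rewrite memv_ker. Qed.

Lemma lform_neq0 a : a != 0 -> exists v, lform a v = 1.
Proof.
move=> a0; have [i ai] : exists i, a i 0 != 0.
  apply/existsP; apply: contraNT a0 => /existsPn h; apply/eqP/matrixP => i j.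
  by rewrite mxE ord1; apply/eqP; rewrite -[_ == _]negbK h.
exists ((a i 0)^-1 *: (vbasis {:V})`_i).
by rewrite linearZ /= lform_basis; apply: mulVf.
Qed.

Lemma hyp_line a b : a != 0 -> (hyp a <= hyp b)%VS -> b \in <[a]>%VS.
Proof.
case/lform_neq0 => v av /subvP h; apply/vlineP; exists (lform b v).
apply/matrixP => i j; rewrite ord1 mxE -!lform_basis.
set u := (vbasis {:V})`_i; have hu : lform a (u - lform a u *: v) = 0.
  rewrite linearB linearZ /= av.
  exact: (etrans (congr1 (fun z => lform a u - z) (mulr1 _)) (subrr _)).
have := h (u - lform a u *: v); rewrite !mem_hyp hu eqxx => /(_ isT).
by rewrite linearB linearZ /= subr_eq0 => /eqP ->; exact: mulrC.
Qed.

Lemma hyp_lineE a b : a != 0 -> b != 0 -> (hyp a == hyp b) = (<[a]> == <[b]>)%VS.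
Proof.
move=> a0 b0; apply/eqP/idP => [e|].
  by rewrite vline_eq // hyp_line // e.
rewrite vline_eq // => /vlineP [k ea]; have k0 : k != 0.
  by apply: contraNneq a0 => k0; rewrite ea k0 scale0r.
apply/vspaceP => v; rewrite !mem_hyp ea lformZ scale_lfunE.
by rewrite [_ *: _ == 0]mulf_eq0 (negbTE k0).
Qed.

Definition represents (A : arrangement V) (s : seq 'cV[K]_l) : Prop :=
  hyperplanes A =i [seq hyp a | a <- s].

Lemma log_derivation_dth A s th : represents A s -> 0 \notin s ->
  log_derivation A (dth th) <-> logd s th.
Proof.
move=> rA s0.
have hlin a : dth th (lin a) = app th a.
  rewrite /lin (deriv_sum (dth_derivation th)) appE; apply: eq_bigr => j _.
  by rewrite (derivZ (dth_derivation th)) dthX mulrC mul_mpolyC.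
split=> [[_ h] a sa|h].
  have [||q eq] := h (hyp a) _ (lform a) => //; first by rewrite rA map_f.
  by exists q; rewrite -hlin -linear_form_lform.
split; first exact: dth_derivation.
move=> H; rewrite rA => /mapP [a sa ->] al e.
have [b eb] := hom_lform al.
have a0 : a != 0 by apply: contraNneq s0 => <-.
have /vlineP [k ek] : b \in <[a]>%VS by rewrite hyp_line // /hyp -eb e.
have [r er] := h a sa.
exists r; rewrite eb linear_form_lform ek linearZ /= (derivZ (dth_derivation th)) hlin er.
by rewrite scalerAl.
Qed.

End Derivations.

Section FreeTransfer.
Variables (K : numFieldType) (V : vectType K).
Notation l := (\dim {:V}).
Notation S := (symV V).

Lemma saito_free A s (e : seq nat) (M : 'M[S]_l) : size e = l ->
  noncollinear s -> represents A s -> saito s (fun i => nth 0%N e i) M ->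
  free_with_exponents A e.
Proof.
move=> se ns rA sM; have [lM hM _ _] := sM.
have s0 : 0 \notin s by case/andP: ns.
have logP := log_derivation_dth _ rA s0.
have uM := saito_basis ns sM.
exists (fun i => dth (row (cast_ord se i) M)); split; last first.
  by move=> i j; rewrite dthX mxE; have := hM (cast_ord se i) j.
move: se; generalize (size e) => r er; subst r.
split=> [i|D lD]; first by apply/logP.
have [dD _] := lD; pose th := \row_j D 'X_j.
have DE p : D p = dth th p by rewrite (derivE dD).
have lth : logd s th.
  apply/logP; split; first exact: dth_derivation.
  by case: lD => _ h H HA al e1; have [q eq] := h H HA al e1; exists q; rewrite -DE.
have [c [ec uc]] := uM th lth.
have comb (c' : {ffun 'I_l -> S}) : (forall p, D p = \sum_i c' i * dth (row (cast_ord erefl i) M) p)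
    <-> th = (\row_i c' i) *m M.
  split=> [h|h p].
    apply/rowP => j; rewrite mxE h mxE; apply: eq_bigr => i _.
    by rewrite dthX cast_ord_id !mxE.
  rewrite DE h /dth; under [RHS]eq_bigr => i _ do rewrite mulr_sumr.
  rewrite exchange_big /=; apply: eq_bigr => j _; rewrite mxE mulr_suml.
  by apply: eq_bigr => i _; rewrite cast_ord_id !mxE mulrA.
exists [ffun i => c 0 i]; split.
  apply/comb; rewrite ec; congr (_ *m _); apply/rowP => i; by rewrite mxE ffunE.
move=> c' /comb /uc ->; apply/ffunP => i; by rewrite ffunE mxE.
Qed.

End FreeTransfer.

Lemma mem_bigcap_seq (K : fieldType) (V : vectType K) (r : seq {vspace V}) v :
  (v \in (\bigcap_(H <- r) H)%VS) = all (fun H : {vspace V} => v \in H) r.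
Proof. by elim: r => [|H r IH]; rewrite ?big_nil ?memvf // big_cons memv_cap IH. Qed.

Section FlatRestriction.
Variables (K : numFieldType) (V : vectType K).
Notation l := (\dim {:V}).
Implicit Types (a : 'cV[K]_l) (C : seq 'cV[K]_l).

Definition flat C : {vspace V} := (\bigcap_(H <- [seq hyp a | a <- C]) H)%VS.

Lemma mem_flat C v : (v \in flat C) = all (fun a => lform a v == 0) C.
Proof. by rewrite mem_bigcap_seq all_map; apply: eq_all => a /=; rewrite mem_hyp. Qed.

Variable C : seq 'cV[K]_l.
Notation X := (flat C).
Notation d := (\dim {:subvs_of X}).

(** The matrix of the inclusion of the flat in the bases [vbasis]; thus [N *m a] holds the
    coordinates of the restriction of the form [a]. *)
Definition flat_mx : 'M[K]_(d, l) :=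
  \matrix_(i, j) coord (vbasis {:V}) j (vsval (vbasis {:subvs_of X})`_i).
Notation N := flat_mx.

Lemma lform_flat_mx a (w : subvs_of X) : lform (N *m a) w = lform a (vsval w).
Proof.
pose al : 'Hom(subvs_of X, K^o) := (lform a \o linfun (@vsval K V X))%VF.
have -> : lform (N *m a) = al; last by rewrite /al comp_lfunE [linfun (@vsval _ _ _) _]lfunE.
apply/esym/lformP => i; rewrite /al comp_lfunE [linfun (@vsval _ _ _) _]lfunE /= lformE mxE.
by apply: eq_bigr => j _; rewrite mxE.
Qed.

Lemma flat_mx_eq0 a : (N *m a == 0) = (X <= hyp a)%VS.
Proof.
apply/eqP/subvP => [h v vX|h].
  have := lform_flat_mx a (Subvs vX); rewrite h mem_hyp /= => <-.
  by rewrite lformE big1 // => i _; rewrite mxE mulr0.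
apply/matrixP => i j; rewrite ord1 [RHS]mxE.
rewrite -lform_basis lform_flat_mx; apply/eqP; rewrite -mem_hyp; apply: h.
exact: subvsP.
Qed.

Lemma trace_hyp a : hyperplane_trace X (hyp a) = hyp (N *m a).
Proof.
apply/vspaceP => w; rewrite -memv_preim !mem_hyp lform_flat_mx.
by rewrite [linfun (@vsval _ _ _) _]lfunE.
Qed.

Lemma lform_point (x : 'rV[K]_l) a : lform a (\sum_j x 0 j *: (vbasis {:V})`_j) = ev x a.
Proof.
rewrite linear_sum evE; apply: eq_bigr => j _.
by rewrite linearZ /= lform_basis.
Qed.

Lemma flat_mx_flat : is_flat N C.
Proof.
have flat0 a : a \in C -> N *m a = 0.
  move=> aC; apply/eqP; rewrite flat_mx_eq0; apply/subvP => v.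
  by rewrite mem_flat mem_hyp => /allP /(_ _ aC).
split.
  apply: inj_row_free => y hy.
  pose w := \sum_i y 0 i *: (vbasis {:subvs_of X})`_i.
  have hv j : coord (vbasis {:V}) j (vsval w) = 0.
    have := congr1 (fun r : 'rV_l => r 0 j) hy; rewrite mxE [RHS]mxE => <-.
    rewrite /w !linear_sum; apply: eq_bigr => i _.
    by rewrite !linearZ /= mxE.
  have h : w = 0.
    apply: val_inj; rewrite /= (coord_vbasis (memvf (vsval w))) big1 // => j _.
    by rewrite hv scale0r.
  have /freeP := basis_free (vbasisP {:subvs_of X}) => /(_ (fun i => y 0 i) h) h2.
  by apply/rowP => i; rewrite h2 mxE.
move=> u; apply/idP/idP => [|/span_comb ->]; last first.
  rewrite mulmx_sumr big1 // => i _.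
  by rewrite -scalemxAr flat0 ?scaler0 // mem_nth.
rewrite flat_mx_eq0 => h; apply: contraT => uC.
have [|x [xC xu]] := @dual_point K l C [:: u].
  by move=> a; rewrite inE => /eqP ->.
have := subvP h (\sum_j x 0 j *: (vbasis {:V})`_j).
rewrite mem_hyp lform_point (negbTE (xu _ (mem_head _ _))); apply.
by rewrite mem_flat; apply/allP => a aC; rewrite lform_point xC.
Qed.

Lemma flat_dim : free C -> (\dim X + size C)%N = l.
Proof.
move=> fC; have [rN hN] := flat_mx_flat.
have -> : \dim X = d by rewrite dimvf.
have : (kermx N^T == (colmx C)^T)%MS.
  apply/andP; split; last first.
    rewrite sub_kermx -trmx_mul; apply/eqP; rewrite -trmx0; congr trmx.
    apply/matrixP => i j; rewrite colmx_mul [RHS]mxE /ev.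
    have : N *m C`_j == 0 by rewrite hN memv_span // mem_nth.
    by move=> /eqP h; rewrite -row_mul h !mxE.
  apply/row_subP => i; set r := row i _.
  have : N *m r^T == 0.
    have : (r <= kermx N^T)%MS by apply: row_sub.
    by rewrite sub_kermx => /eqP h; rewrite -trmx_eq0 trmx_mul trmxK h.
  rewrite hN => /span_comb e; apply/submxP.
  exists (\row_i coord (in_tuple C) i r^T); apply: trmx_inj.
  rewrite trmx_mul !trmxK colmx_comb {1}e; apply: eq_bigr => j _.
  by rewrite !mxE.
move/eqmx_rank; rewrite mxrank_ker !mxrank_tr.
have /eqP -> := colmx_full fC; have /eqP -> := rN => <-.
by rewrite subnKC //; have := rank_leq_col N; have /eqP -> := rN.
Qed.

Lemma flat_lattice (A : arrangement V) s : represents A s -> {subset C <= s} ->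
  X \in intersection_lattice A.
Proof.
move=> rA Cs; apply/imfsetP; exists [fset H in [seq hyp a | a <- C]]%fset => /=.
  rewrite fpowersetE; apply/fsubsetP => H; rewrite inE /= => /mapP [a aC ->].
  by rewrite rA map_f // Cs.
apply/vspaceP => v; rewrite !mem_bigcap_seq; apply/allP/allP => h H hH; apply: h.
  by move: hH; rewrite inE.
by rewrite inE.
Qed.

(** Distinct hyperplanes can have the same trace on the flat, so one form is kept on each line. *)
Definition flat_forms s := nc [seq N *m a | a <- s & N *m a != 0].

Lemma noncollinear_flat_forms s : noncollinear (flat_forms s).
Proof.
apply: noncollinear_nc; apply/mapP => -[a]; rewrite mem_filter => /andP [h _] e.
by rewrite -e eqxx in h.
Qed.

Lemma flat_represents (A : arrangement V) s : represents A s ->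
  represents (restriction A X) (flat_forms s).
Proof.
move=> rA H; apply/imfsetP/mapP => [[H' /=]|[w /nc_sub]].
  rewrite inE /= rA => /andP [/mapP [a sa ->] hX] ->; rewrite -flat_mx_eq0 in hX.
  have : N *m a \in [seq N *m a | a <- s & N *m a != 0].
    by apply: map_f; rewrite mem_filter hX.
  case/nc_mem => w hw e; exists w => //; rewrite trace_hyp; apply/eqP.
  by rewrite hyp_lineE // ?e // (noncollinear_neq0 (noncollinear_flat_forms s)).
case/mapP => a; rewrite mem_filter => /andP [h sa] -> ->.
exists (hyp a); last by rewrite trace_hyp.
by rewrite inE /= rA map_f // -flat_mx_eq0.
Qed.

Lemma cnt_flat_forms s : (cnt <<C>> s <= size (flat_forms s))%N.
Proof.
have NC := flat_mx_flat; have [_ hN] := NC.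
rewrite size_nc -map_comp /cnt (eq_filter (a2 := fun a => N *m a != 0)); last first.
  by move=> a; rewrite /= hN.
apply: size_undup_map_le => a a'; rewrite !mem_filter hN => /andP [ha _] _ /= e1.
apply: addv_line_eq => //.
have : N *m a \in <[N *m a']>%VS by rewrite -e1 memv_line.
case/vlineP => k ek; apply/mem_addv_line; exists k.
by rewrite -hN mulmxBr -scalemxAr ek subrr.
Qed.

End FlatRestriction.

(** * Exponents of the restrictions *)

Section Accurate.
Variables (K : numFieldType) (V : vectType K).
Notation l := (\dim {:V}).
Notation S := (symV V).
Variables (A : arrangement V) (s : seq 'cV[K]_l) (ht : 'cV[K]_l -> nat).
Hypotheses (mf : mat_free s ht) (rA : represents A s).

Let ns : noncollinear s. Proof. by case: mf. Qed.

(** Codimension 0, which the levels do not produce: the flat is the whole space and no member is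
    given up. *)
Lemma flat_data0 (e : 'I_l -> nat) (M : 'M[S]_l) : saito s e M ->
  exists k, flat_data s 0 k M e.
Proof.
move=> sM; have [|x [_ xs]] := @dual_point K l [::] s.
  by move=> a sa; rewrite span_nil memv0 (noncollinear_neq0 ns sa).
exists (\max_i e i).+1, [::], setT, x; split=> //.
- by split=> //; apply: nil_free.
- split=> [|u _ hu]; first by rewrite cardsT card_ord addn0.
  have Mu : map_mx (meval (x 0)) M \in unitmx.
    rewrite unitmxE det_map_mx; have [c c0 ->] := saito_det ns sM.
    rewrite unitfE /= mevalZ mulf_neq0 // /pi_lin rmorph_prod /= prodf_seq_neq0.
    by apply/allP => a /xs; rewrite /= meval_lin.
  by rewrite -[LHS](mulmxK Mu) hu mul0mx.
- have [_ _ hs _] := sM; rewrite span_nil cnt0 // -hs.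
  by apply: eq_leq; apply: eq_bigl => i; rewrite inE.
exists (\max_i e i)%N; split=> // [i _|i]; first exact: leq_bigmax.
by rewrite inE.
Qed.

Definition by_exp (e : 'I_l -> nat) (I : {set 'I_l}) : seq 'I_l :=
  sort (relpre e leq) (enum I).

Lemma leq_sorted_by_exp e (I : {set 'I_l}) : sorted leq [seq e i | i <- by_exp e I].
Proof. by rewrite /by_exp -sort_map sort_sorted // => x y; apply: leq_total. Qed.

Lemma size_by_exp e (I : {set 'I_l}) : size (by_exp e I) = #|I|.
Proof. by rewrite size_sort -cardE. Qed.

Lemma mem_by_exp e (I : {set 'I_l}) i : (i \in by_exp e I) = (i \in I).
Proof. by rewrite mem_sort mem_enum. Qed.

Lemma uniq_by_exp e (I : {set 'I_l}) : uniq (by_exp e I).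
Proof. by rewrite sort_uniq enum_uniq. Qed.

(** Ties at the value [m] leave a choice for [I], but not for the sorted list of its degrees. *)
Lemma take_by_exp e (I : {set 'I_l}) m : (forall i, i \in I -> (e i <= m)%N) ->
  (forall i, i \notin I -> (m <= e i)%N) ->
  take #|I| [seq e i | i <- by_exp e setT] = [seq e i | i <- by_exp e I].
Proof.
move=> h1 h2.
have -> : [seq e i | i <- by_exp e setT] =
    [seq e i | i <- by_exp e I] ++ [seq e i | i <- by_exp e (~: I)].
  apply: (sorted_eq leq_trans anti_leq).
  - exact: leq_sorted_by_exp.
  - rewrite (sorted_pairwise leq_trans) pairwise_cat -!(sorted_pairwise leq_trans).
    rewrite !leq_sorted_by_exp !andbT; apply/allrelP => a b /mapP [i hi ->] /mapP [j hj ->].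
    rewrite mem_by_exp in hi; rewrite mem_by_exp inE in hj.
    exact: leq_trans (h1 _ hi) (h2 _ hj).
  rewrite -map_cat; apply: perm_map; apply: uniq_perm; first exact: uniq_by_exp.
    rewrite cat_uniq !uniq_by_exp andbT; apply/hasPn => i.
    by rewrite /= !mem_by_exp inE.
  by move=> i; rewrite mem_cat !mem_by_exp !inE orbN.
by rewrite -{1}(size_by_exp e I) -{1}(size_map e) take_size_cat.
Qed.

Lemma ev_inj m (v w : 'rV[K]_m) : (forall a, ev v a = ev w a) -> v = w.
Proof.
move=> h; apply/rowP => j; have := h (delta_mx j 0).
by rewrite /ev -!colE !mxE.
Qed.

Lemma mul_rowsub1_eq0 m (f : 'I_m -> 'I_l) (v : 'rV[K]_m) : injective f ->
  v *m rowsub f 1%:M = 0 -> v = 0.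
Proof.
move=> fI h; apply/rowP => t; have := congr1 (fun w : 'rV_l => w 0 (f t)) h.
rewrite mxE (bigD1 t) //= [rowsub _ _ t _]mxE mxE eqxx mulr1 big1 => [|t' tt'].
  by rewrite addr0 => ->; rewrite !mxE.
by rewrite !mxE (inj_eq fI) (negbTE tt') mulr0.
Qed.

Lemma flat_free (c k : nat) (e : 'I_l -> nat) (M : 'M[S]_l) :
  saito s e M -> flat_data s c k M e -> (c < l)%N ->
  exists X : {vspace V}, [/\ X \in intersection_lattice A, (\dim X + c)%N = l
    & free_with_exponents (restriction A X)
        (take (\dim X) [seq e i | i <- by_exp e setT])].
Proof.
move=> sM [C [I [x [[sC fC Cs] xC [cI Iindep] hsum [m [_ hm1 hm2]]]]]] cl.
have dX := flat_dim fC; rewrite sC in dX.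
exists (flat C); split => //; first exact: flat_lattice rA Cs.
have dI : \dim (flat C) = #|I| by apply/eqP; rewrite -(eqn_add2r c) dX cI.
rewrite dI (take_by_exp hm1 hm2).
have dd : \dim {:subvs_of (flat C)} = #|I| by rewrite dimvf -dI.
have NC := flat_mx_flat C; set N := flat_mx C in NC.
have [y ey] := flat_point NC xC.
have [lM hM _ _] := sM.
pose i0 : 'I_l := Ordinal (leq_ltn_trans (leq0n c) cl).
pose f (t : 'I_(\dim {:subvs_of (flat C)})) := nth i0 (by_exp e I) t.
have fI t : f t \in I by rewrite -(mem_by_exp e) mem_nth // size_by_exp -dd.
have finj : injective f.
  move=> t t' /eqP; rewrite nth_uniq ?uniq_by_exp ?size_by_exp -?dd // => /eqP.
  exact: val_inj.
pose M' := \matrix_(t, j) (restd N (row (f t) M)) 0 j.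
have rM' t : row t M' = restd N (row (f t) M).
  by apply/rowP => j; rewrite [LHS]mxE [LHS]mxE.
have tg t a : a \in C -> mdvd (lin a) (app (row (f t) M) a).
  by move=> aC; apply: lM; apply: Cs.
have lM' t : logd (flat_forms C s) (row t M').
  move=> w /nc_sub /mapP [a]; rewrite mem_filter => /andP [_ sa] ->.
  rewrite rM' (restd_app NC _ (tg t)); have [r ->] := lM (f t) a sa.
  by exists (r \mPo rest N); rewrite rmorphM /= rest_lin.
have hM' t j : M' t j \is (e (f t)).-homog.
  rewrite mxE; apply: restd_homog => i; rewrite mxE; exact: hM.
(* A relation between the rows at [y], the coordinates of [x] in the flat, becomes through the
   inclusion [N] a relation between the values at [x] of the members of [I]. *)
have detM' : \det M' != 0.
  apply/negP => /eqP /(congr1 (meval (y 0))); rewrite meval0 -det_map_mx.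
  move/eqP/det0P => [v v0 hv]; case/eqP: v0; apply: (mul_rowsub1_eq0 finj).
  apply: Iindep => [i iI|].
    rewrite mxE big1 // => t _; rewrite !mxE.
    by case: eqP => [h|]; rewrite ?mulr0 //; rewrite -h fI in iI.
  rewrite -mulmxA mul_rowsub_mx mul1mx.
  suff -> : rowsub f (map_mx (meval (x 0)) M) = map_mx (meval (y 0)) M' *m N.
    by rewrite mulmxA hv mul0mx.
  apply/row_matrixP => t; apply: ev_inj => a.
  have -> : row t (rowsub f (map_mx (meval (x 0)) M)) = map_mx (meval (x 0)) (row (f t) M).
    by apply/rowP => j; rewrite !mxE.
  have evA (w : 'rV[K]_(\dim {:subvs_of (flat C)})) : ev (w *m N) a = ev w (N *m a).
    by rewrite /ev mulmxA.
  by rewrite row_mul -map_row rM' evA -!app_ev (restd_app NC _ (tg t)) rest_ev -ey.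
have nF := noncollinear_flat_forms C s.
have sumE : (\sum_t e (f t) = \sum_(i in I) e i)%N.
  transitivity (\sum_(i <- by_exp e I) e i)%N; last first.
    by rewrite (perm_big (enum I)) ?big_enum //= perm_sort.
  by rewrite (big_nth i0) big_mkord size_by_exp -dd.
have sF : size (flat_forms C s) = (\sum_t e (f t))%N.
  apply/eqP; rewrite eqn_leq (saito_le nF lM' hM' detM') sumE.
  exact: leq_trans hsum (cnt_flat_forms C s).
apply: (@saito_free _ _ _ (flat_forms C s) _ M') => //.
- by rewrite size_map size_by_exp.
- exact: flat_represents.
have nthE t : nth 0%N [seq e i | i <- by_exp e I] (nat_of_ord t) = e (f t).
  by rewrite (nth_map i0) // size_by_exp -dd.
split=> //; first by move=> t j; rewrite nthE.
by rewrite sF; apply: eq_bigr => t _; apply: nthE.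
Qed.

Theorem mat_free_accurate : size (level s ht 1) = l -> accurate A.
Proof.
move=> h1; have [e [M [sM flats]]] := mat_free_flats mf h1.
have sE : size [seq e i | i <- by_exp e setT] == l.
  by rewrite size_map size_by_exp cardsT card_ord.
exists (Tuple sE); split; first exact: leq_sorted_by_exp.
  have [lM hM eM dM] := sM.
  have [l0|l0] := posnP l.
    apply: (@saito_free _ _ _ s _ M) => //; first exact/eqP.
    have no (i : 'I_l) : False by case: i => i; rewrite l0.
    split=> //.
    by rewrite -eM; apply: eq_bigr => i; case: (no i).
  pose i0 : 'I_l := Ordinal l0.
  pose f (t : 'I_l) := nth i0 (by_exp e setT) t.
  have szl : size (by_exp e setT) = l by rewrite size_by_exp cardsT card_ord.
  have finj : injective f.
    move=> t t' /eqP; rewrite nth_uniq ?uniq_by_exp ?szl // => /eqP.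
    exact: val_inj.
  have nthE t : nth 0%N [seq e i | i <- by_exp e setT] (nat_of_ord t) = e (f t).
    by rewrite (nth_map i0) // szl.
  apply: (@saito_free _ _ _ s _ (row_perm (perm finj) M)) => //; first exact/eqP.
  split=> [i|i j||].
  - have -> : row i (row_perm (perm finj) M) = row (f i) M.
      by apply/rowP => j; rewrite !mxE permE.
    exact: lM.
  - by rewrite mxE permE /= nthE.
  - rewrite -eM [RHS](reindex_inj finj) /=; apply: eq_bigr => t _; exact: nthE.
  by rewrite row_permE det_mulmx det_perm mulf_neq0 // signr_eq0.
move=> d /andP [d1 d2].
have [k fd] : exists k, flat_data s (l - d) k M e.
  have [c0|c0] := posnP (l - d)%N; first by rewrite c0; apply: flat_data0.
  by apply: flats; rewrite c0 leq_subr.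
have [|X [XL dX fX]] := flat_free sM fd.
  by rewrite -subn_gt0 subKn.
have ed : \dim X = d by apply/eqP; rewrite -(eqn_add2r (l - d)) dX subnKC.
by exists X; rewrite ed in fX.
Qed.

End Accurate.

(** * Heights in crystallographic root systems *)

Lemma int_ge1 (R : realType) (x : R) : x \is a Num.int -> 0 < x -> 1 <= x.
Proof. by move=> /intrP [m ->]; rewrite ltr0z ler1z gtz0_ge1. Qed.

Lemma size_filter_sub (T : eqType) (s : seq T) (p q : pred T) x :
  {subset p <= q} -> x \in s -> q x -> ~~ p x ->
  (size (filter p s) < size (filter q s))%N.
Proof.
move=> pq xs qx px; rewrite !size_filter; elim: s xs => //= y s IH.
have mono : (count p s <= count q s)%N by apply: sub_count => z; apply: pq.
rewrite in_cons => /predU1P [<-|xs].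
  by rewrite qx (negbTE px) add0n add1n ltnS.
rewrite -addnS leq_add // ?IH //; case py: (p y) => //.
by have := pq y py; rewrite unfold_in => ->.
Qed.

Section Euclidean.
Variables (R : realType) (E : vectType R) (dot : E -> E -> R).
Hypotheses (dotC : forall x y, dot x y = dot y x)
  (dotDl : forall x y z, dot (x + y) z = dot x z + dot y z)
  (dotZl : forall c x y, dot (c *: x) y = c * dot x y)
  (dot_gt0 : forall x, x != 0 -> 0 < dot x x).

Lemma dotDr x y z : dot x (y + z) = dot x y + dot x z.
Proof. by rewrite dotC dotDl !(dotC x). Qed.
Lemma dotZr c x y : dot x (c *: y) = c * dot x y.
Proof. by rewrite dotC dotZl (dotC x). Qed.
Lemma dot0l y : dot 0 y = 0.
Proof. by rewrite -(scale0r 0) dotZl mul0r. Qed.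
Lemma dotNl x y : dot (- x) y = - dot x y.
Proof. by rewrite -scaleN1r dotZl mulN1r. Qed.
Lemma dotNr x y : dot x (- y) = - dot x y.
Proof. by rewrite dotC dotNl dotC. Qed.
Lemma dotBl x y z : dot (x - y) z = dot x z - dot y z.
Proof. by rewrite dotDl dotNl. Qed.
Lemma dotBr x y z : dot x (y - z) = dot x y - dot x z.
Proof. by rewrite dotDr dotNr. Qed.
Lemma dot_suml (I : Type) (r : seq I) (P : pred I) (F : I -> E) y :
  dot (\sum_(i <- r | P i) F i) y = \sum_(i <- r | P i) dot (F i) y.
Proof. by elim/big_rec2: _ => [|i a b _ <-]; rewrite ?dot0l // dotDl. Qed.
Lemma dot_sumr (I : Type) (r : seq I) (P : pred I) (F : I -> E) y :
  dot y (\sum_(i <- r | P i) F i) = \sum_(i <- r | P i) dot y (F i).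
Proof. by rewrite dotC dot_suml; apply: eq_bigr => i _; rewrite dotC. Qed.

Lemma dot_ge0 x : 0 <= dot x x.
Proof. by have [->|/dot_gt0/ltW//] := eqVneq x 0; rewrite dot0l. Qed.
Lemma dot_eq0 x : (dot x x == 0) = (x == 0).
Proof.
have [->|x0] := eqVneq x 0; first by rewrite dot0l eqxx.
by rewrite gt_eqF // dot_gt0.
Qed.

(* Obtuse vectors in an open half space are independent: the positive and the
   negative part of a linear relation have a nonpositive inner product. *)
Lemma obtuse_free (X : seq E) v : uniq X -> (forall a, a \in X -> 0 < dot a v) ->
  (forall a b, a \in X -> b \in X -> a != b -> dot a b <= 0) -> free X.
Proof.
move=> uX Xv ob; apply/(freeP (X := in_tuple X)) => k; rewrite /= => hk.
pose x (i : 'I_(size X)) := X`_i.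
have xX i : x i \in X by rewrite mem_nth.
pose P := \sum_(i | 0 < k i) k i *: x i; pose Q := \sum_(i | ~~ (0 < k i)) (- k i) *: x i.
have PQ : P = Q.
  apply/eqP; rewrite -subr_eq0 -[X in _ == X]hk; apply/eqP.
  rewrite [RHS](bigID (fun i => 0 < k i)) /=; congr (_ + _).
  by rewrite /Q -sumrN; apply: eq_bigr => i _; rewrite scaleNr opprK.
have P0 : P = 0.
  apply/eqP; rewrite -dot_eq0 eq_le dot_ge0 andbT {2}PQ dot_suml sumr_le0 // => i ki.
  rewrite dot_sumr sumr_le0 // => j kj; rewrite dotZl dotZr.
  have ij : x i != x j.
    rewrite nth_uniq //; apply: contraNneq kj => e.
    by rewrite -(val_inj e).
  have := ob _ _ (xX i) (xX j) ij; move: ki kj; rewrite -leNgt => h1 h2 h3.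
  by apply: mulr_ge0_le0; [exact: ltW | apply: mulr_ge0_le0; rewrite ?oppr_ge0].
have Pi i : 0 < k i -> False.
  move=> ki; have : 0 < dot P v.
    rewrite dot_suml (bigD1 i) //= ltr_wpDr //.
      by apply: sumr_ge0 => j /andP [kj _]; rewrite dotZl mulr_ge0 ?ltW ?Xv.
    by rewrite dotZl mulr_gt0 ?Xv.
  by rewrite P0 dot0l ltxx.
have ki0 i : k i <= 0 by rewrite leNgt; apply/negP/Pi.
have Q0 : dot Q v = 0 by rewrite -PQ P0 dot0l.
move=> i; apply/eqP; rewrite eq_le ki0 leNgt; apply/negP => ki.
have : 0 < dot Q v.
  rewrite dot_suml (bigD1 i) /=; last by rewrite -leNgt ki0.
  rewrite ltr_wpDr //.
    by apply: sumr_ge0 => j /andP [_ _]; rewrite dotZl mulr_ge0 ?oppr_ge0 // ltW ?Xv.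
  by rewrite dotZl mulr_gt0 ?oppr_gt0 ?Xv.
by rewrite Q0 ltxx.
Qed.

Definition cart (b a : E) : R := 2 * dot b a / dot a a.
Definition refl (a b : E) : E := b - cart b a *: a.

Lemma cartDl x y a : cart (x + y) a = cart x a + cart y a.
Proof. by rewrite /cart dotDl mulrDr mulrDl. Qed.
Lemma cartZl c x a : cart (c *: x) a = c * cart x a.
Proof. by rewrite /cart dotZl; ring. Qed.
Lemma cartBl x y a : cart (x - y) a = cart x a - cart y a.
Proof. by rewrite cartDl -scaleN1r cartZl mulN1r. Qed.
Lemma cartaa a : a != 0 -> cart a a = 2.
Proof. by move=> /dot_gt0 h; rewrite /cart mulfK // gt_eqF. Qed.
Lemma cart_gt0 b a : a != 0 -> (0 < cart b a) = (0 < dot b a).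
Proof. by move=> /dot_gt0 h; rewrite /cart pmulr_lgt0 ?invr_gt0 // pmulr_rgt0. Qed.
Lemma cart_lt0 b a : a != 0 -> (cart b a < 0) = (dot b a < 0).
Proof. by move=> /dot_gt0 h; rewrite /cart pmulr_llt0 ?invr_gt0 // pmulr_rlt0. Qed.
Lemma dot_refll a x y : a != 0 -> dot (refl a x) (refl a y) = dot x y.
Proof.
move=> /dot_gt0 h; rewrite /refl !dotBl !dotBr !dotZl !dotZr /cart (dotC a y).
by field; rewrite gt_eqF.
Qed.
Lemma refl_dot a x y : a != 0 -> dot (refl a x) y = dot x (refl a y).
Proof.
move=> /dot_gt0 h; rewrite /refl !dotBl !dotBr !dotZl !dotZr /cart (dotC a y).
by field; rewrite gt_eqF.
Qed.
Lemma reflK a : a != 0 -> involutive (refl a).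
Proof.
move=> a0 x; rewrite /refl cartBl cartZl cartaa //.
by rewrite (_ : cart x a - _ = - cart x a) ?scaleNr ?opprK ?subrK //; ring.
Qed.
Lemma refl_self a : a != 0 -> refl a a = - a.
Proof. by move=> a0; rewrite /refl cartaa // scaler_nat mulr2n opprD addrA subrr sub0r. Qed.

(** Reduced and crystallographic, of any rank up to the dimension of [E], so that the roots in a
    subspace again qualify. *)
Definition rootsys (Phi : seq E) : Prop :=
  [/\ uniq Phi, 0 \notin Phi,
      forall a b, a \in Phi -> b \in Phi -> refl a b \in Phi,
      forall a b, a \in Phi -> b \in Phi -> cart b a \is a Num.int
    & forall a b, a \in Phi -> b \in Phi -> a \in <[b]>%VS -> a = b \/ a = - b].

Variable v : E.

Definition positive (Phi : seq E) : seq E := [seq a <- Phi | 0 < dot a v].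
(* Half the pairing with the sum of the positive coroots. *)
Definition hgt (Phi : seq E) (b : E) : R := 2^-1 * \sum_(c <- positive Phi) cart b c.
Definition htn (Phi : seq E) (b : E) : nat := Num.truncn (hgt Phi b).
Definition simple_root (Phi : seq E) (a : E) : bool :=
  (a \in positive Phi) && all (fun b => a - b \notin positive Phi) (positive Phi).

Section RootSystem.
Variable Phi : seq E.
Hypotheses (rs : rootsys Phi) (vreg : forall a, a \in Phi -> dot a v != 0).
Notation pos := (positive Phi).
Notation h := (hgt Phi).
Notation ht := (htn Phi).
Notation simple := (simple_root Phi).

Lemma root_neq0 a : a \in Phi -> a != 0.
Proof. by case: rs => _ h _ _ _; apply: contraTneq => ->. Qed.
Lemma root_opp a : a \in Phi -> - a \in Phi.
Proof. by move=> aP; rewrite -refl_self ?root_neq0 //; case: rs => _ _ h _ _; apply: h. Qed.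
Lemma posP a : (a \in pos) = (a \in Phi) && (0 < dot a v).
Proof. by rewrite mem_filter andbC. Qed.
Lemma pos_root a : a \in pos -> a \in Phi.
Proof. by rewrite posP => /andP []. Qed.
Lemma pos_gt0 a : a \in pos -> 0 < dot a v.
Proof. by rewrite posP => /andP []. Qed.
Lemma pos_neq0 a : a \in pos -> a != 0.
Proof. by move=> /pos_root/root_neq0. Qed.
Lemma pos_or a : a \in Phi -> a \in pos \/ - a \in pos.
Proof.
move=> aP; rewrite !posP aP root_opp // dotNl oppr_gt0.
by have := vreg aP; rewrite neq_lt => /orP []; auto.
Qed.
Lemma pos_not_opp a : a \in pos -> - a \notin pos.
Proof. by move=> /pos_gt0 h; rewrite posP dotNl oppr_gt0 negb_and orbC ltNge ltW. Qed.
Lemma pos_uniq : uniq pos.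
Proof. by case: rs => h _ _ _ _; apply: filter_uniq. Qed.
Lemma pos_line a b : a \in pos -> b \in pos -> a \in <[b]>%VS -> a = b.
Proof.
case: rs => _ _ _ _ h pa pb ab; case: (h _ _ (pos_root pa) (pos_root pb) ab) => // e.
by move: (pos_not_opp pb); rewrite -e pa.
Qed.
Lemma pos_noncollinear : noncollinear pos.
Proof.
apply/andP; split; first by apply/negP => /pos_neq0; rewrite eqxx.
rewrite map_inj_in_uniq ?pos_uniq // => a b pa pb e.
by apply: pos_line => //; rewrite -e memv_line.
Qed.

(** If one of the two positive Cartan integers is 1, a reflection gives the difference up to sign.
    If both are at least 2, then [a - b] has nonpositive norm. *)
Lemma root_sub a b : a \in Phi -> b \in Phi -> a != b -> 0 < dot a b -> a - b \in Phi.
Proof.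
move=> aP bP ab hab; have [_ _ cl int red] := rs.
have a0 := root_neq0 aP; have b0 := root_neq0 bP.
have p1 : 1 <= cart a b by apply: int_ge1; [apply: int | rewrite cart_gt0].
have p2 : 1 <= cart b a by apply: int_ge1; [apply: int | rewrite cart_gt0 // dotC].
have [e1|n1] := eqVneq (cart a b) 1.
  by have := cl _ _ bP aP; rewrite /refl e1 scale1r.
have [e2|n2] := eqVneq (cart b a) 1.
  by have := root_opp (cl _ _ aP bP); rewrite /refl e2 scale1r opprB.
have ge2 x y : x \in Phi -> y \in Phi -> 1 <= cart x y -> cart x y != 1 -> 2 <= cart x y.
  move=> xP yP h1 h2; rewrite -lerBrDr; apply: int_ge1.
    by rewrite rpredB ?int ?rpred1.
  by rewrite subr_gt0 lt_neqAle eq_sym h2.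
have {}p1 := ge2 _ _ aP bP p1 n1; have {}p2 := ge2 _ _ bP aP p2 n2.
have A := dot_gt0 a0; have B := dot_gt0 b0.
have h1 : dot b b <= dot a b.
  by move: p1; rewrite /cart ler_pdivlMr // ler_pM2l.
have h2 : dot a a <= dot a b.
  by move: p2; rewrite /cart ler_pdivlMr // ler_pM2l // dotC.
have : dot (a - b) (a - b) <= 0.
  by rewrite dotBl !dotBr (dotC b a); lra.
move=> h3; case/eqP: ab; apply/eqP; rewrite -subr_eq0 -dot_eq0 eq_le h3.
exact: dot_ge0.
Qed.

Lemma simple_pos a : simple a -> a \in pos.
Proof. by case/andP. Qed.

Lemma simple_sub a b : simple a -> b \in pos -> a - b \notin pos.
Proof. by case/andP => _ /allP h /h. Qed.

Lemma pos_ind (P : E -> Prop) :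
  (forall a, simple a -> P a) ->
  (forall a b, a \in pos -> b \in pos -> a + b \in pos -> P a -> P b -> P (a + b)) ->
  forall a, a \in pos -> P a.
Proof.
move=> h1 h2 a.
have [m] := ubnP (size [seq c <- pos | dot c v < dot a v]).
elim: m a => // m IH a hm pa; have [/h1 //|] := boolP (simple a).
rewrite /simple_root pa /= => /allPn [b pb]; rewrite negbK => pab.
have sub c : c \in pos -> dot c v < dot a v -> P c.
  move=> pc ca; apply: IH => //; rewrite -ltnS; apply: leq_trans hm.
  rewrite ltnS; apply: (@size_filter_sub _ _ _ _ c) => //; last by rewrite /= ltxx.
  by move=> x /= hx; rewrite unfold_in; apply: lt_trans ca.
have e : a = b + (a - b) by rewrite addrC subrK.
rewrite e; apply: h2 => //; rewrite -?e //; apply: sub => //.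
  by rewrite -subr_gt0 -dotBl (pos_gt0 pab).
by rewrite dotBl gtrDl oppr_lt0 (pos_gt0 pb).
Qed.

(** Induction on a bound for [cart b d]. If it is nonpositive, the reflection adds a nonnegative
    multiple of [d]. Otherwise [b - d] is a positive root with Cartan integer smaller by 2, and
    [refl d b] is [refl d (b - d) - d], which cannot be negative because [d] is simple. *)
Lemma refl_simple d b : simple d -> b \in pos -> b != d -> refl d b \in pos.
Proof.
move=> sd; have pd := simple_pos sd; have d0 := pos_neq0 pd; have dP := pos_root pd.
have [_ _ cl int red] := rs.
have [m] : exists m : nat, cart b d <= m%:R.
  by exists (Num.truncn (cart b d)).+1; apply/ltW/truncnS_gt.
elim: m b => [|m IH] b hm pb bd.
  rewrite posP cl ?(pos_root pb) //= dotBl dotZl subr_gt0.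
  apply: le_lt_trans (pos_gt0 pb); rewrite mulr_le0_ge0 //; exact/ltW/pos_gt0.
have [|gt] := lerP (cart b d) m%:R; first by move=> h; apply: IH.
have pbd : 0 < dot b d by rewrite -(cart_gt0 _ d0) (le_lt_trans _ gt).
have bdP : b - d \in Phi by apply: root_sub => //; apply: pos_root.
have pbd' : b - d \in pos.
  case: (pos_or bdP) => //; rewrite opprB => h; by case/negP: (simple_sub sd pb).
have nbd : b - d != d.
  rewrite subr_eq; apply/negP => /eqP e; case/negP: bd; apply/eqP.
  by apply: pos_line => //; rewrite e memvD // memv_line.
have cb : cart (b - d) d = cart b d - 2 by rewrite cartBl cartaa.
have {IH} pg : refl d (b - d) \in pos.
  apply: IH => //; rewrite cb; move: hm; rewrite -natr1; lra.
have e : refl d b = refl d (b - d) - d.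
  rewrite /refl cb scalerBl scaler_nat mulr2n opprB !addrA subrK.
  by rewrite [b + d - _]addrAC addrK.
case: (pos_or (cl _ _ dP (pos_root pb))) => //; rewrite e opprB => hn.
by case/negP: (simple_sub sd pg).
Qed.

Lemma hgtD a b : h (a + b) = h a + h b.
Proof.
rewrite /hgt -mulrDr -big_split /=; congr (_ * _).
by apply: eq_bigr => c _; rewrite cartDl.
Qed.
Lemma hgtZ k a : h (k *: a) = k * h a.
Proof.
rewrite /hgt mulrCA; congr (_ * _); rewrite mulr_sumr.
by apply: eq_bigr => c _; rewrite cartZl.
Qed.
Lemma hgtN a : h (- a) = - h a.
Proof. by rewrite -scaleN1r hgtZ mulN1r. Qed.
Lemma hgtB a b : h (a - b) = h a - h b.
Proof. by rewrite hgtD hgtN. Qed.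

(** The reflection in [d] permutes the positive roots other than [d] and changes the sign of
    [cart d c]; so these terms cancel and only [cart d d = 2] remains. *)
Lemma hgt_simple d : simple d -> h d = 1.
Proof.
move=> sd; have pd := simple_pos sd; have d0 := pos_neq0 pd.
have cr c : c != 0 -> cart d (refl d c) = - cart d c.
  move=> c0; rewrite /cart dot_refll // -refl_dot // refl_self // dotNl.
  by rewrite mulrN mulNr.
suff h0 : \sum_(c <- rem d pos) cart d c = 0.
  by rewrite /hgt (big_rem _ pd) /= h0 addr0 cartaa // mulVf // pnatr_eq0.
have sub c : c \in rem d pos -> c \in pos /\ c != d.
  by rewrite (mem_rem_uniq _ pos_uniq) inE => /andP [].
have pe : perm_eq (map (refl d) (rem d pos)) (rem d pos).
  have um : uniq (map (refl d) (rem d pos)).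
    by rewrite (map_inj_uniq (inv_inj (reflK d0))) rem_uniq // pos_uniq.
  apply: uniq_perm => //; first by rewrite rem_uniq // pos_uniq.
  have [||_ //] := uniq_min_size (s2 := rem d pos) um; last by rewrite size_map.
  move=> _ /mapP [c /sub [pc cd] ->]; rewrite (mem_rem_uniq _ pos_uniq) inE /=.
  rewrite refl_simple // andbT; apply: contraTneq pc => /(congr1 (refl d)).
  by rewrite reflK // refl_self // => ->; apply: pos_not_opp.
have e : \sum_(c <- rem d pos) cart d c = - \sum_(c <- rem d pos) cart d c.
  rewrite -{1}(perm_big _ pe) big_map -sumrN big_seq [RHS]big_seq.
  by apply: eq_bigr => c /sub [/pos_neq0 c0 _]; apply: cr.
by apply/eqP; move/eqP: e; rewrite -addr_eq0 -mulr2n -mulr_natr mulf_eq0 pnatr_eq0 orbF.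
Qed.

Lemma hgt_nat b : b \in pos -> exists n, h b = n.+1%:R.
Proof.
move: b; apply: pos_ind => [a /hgt_simple ->|a b _ _ _ [n hn] [m hm]]; first by exists 0%N.
by exists (n + m).+1; rewrite hgtD hn hm -natrD addnS addSn.
Qed.

Lemma htE b : b \in pos -> (ht b)%:R = h b.
Proof. by move=> /hgt_nat [n e]; rewrite /htn e natrK. Qed.

Lemma ht_gt0 b : b \in pos -> (0 < ht b)%N.
Proof. by move=> /hgt_nat [n e]; rewrite /htn e natrK. Qed.

Lemma hgt_gt0 b : b \in pos -> 0 < h b.
Proof. by move=> pb; rewrite -htE // ltr0n ht_gt0. Qed.

Lemma hgt_neq0 b : b \in Phi -> h b != 0.
Proof.
move=> bP; case: (pos_or bP) => [/hgt_gt0/lt0r_neq0 //|/hgt_gt0].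
by rewrite hgtN oppr_gt0 => /ltr0_neq0.
Qed.

Lemma hgt_pos b : b \in Phi -> 0 < h b -> b \in pos.
Proof.
move=> bP hb; case: (pos_or bP) => // /hgt_gt0; rewrite hgtN oppr_gt0 => h1.
by have := lt_trans hb h1; rewrite ltxx.
Qed.

Lemma ht_simple d : simple d -> ht d = 1%N.
Proof. by move=> /hgt_simple e; rewrite /htn e (natrK 1). Qed.

Lemma htD a b : a \in pos -> b \in pos -> a + b \in pos -> ht (a + b) = (ht a + ht b)%N.
Proof.
move=> pa pb pab; apply/eqP; rewrite -(eqr_nat R) htE // hgtD -!htE //.
by rewrite natrD.
Qed.

Lemma ht1_simple d : d \in pos -> ht d = 1%N -> simple d.
Proof.
move=> pd h1; rewrite /simple_root pd; apply/allP => b pb; apply/negP => pdb.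
have e : d = b + (d - b) by rewrite addrC subrK.
move: h1; rewrite e htD // -?e //.
have := ht_gt0 pb; have := ht_gt0 pdb; by case: (ht b) => // n; case: (ht (d - b)) => // m; rewrite addnS.
Qed.

(** At an acute angle the difference would be a root of height 0. *)
Lemma same_hgt_obtuse a b : a \in Phi -> b \in Phi -> a != b -> h a = h b ->
  dot a b <= 0.
Proof.
move=> aP bP ab e; rewrite leNgt; apply/negP => hab.
have := hgt_neq0 (root_sub aP bP ab hab).
by rewrite hgtB e subrr eqxx.
Qed.

Lemma mem_level_ht a k : (a \in level pos ht k) = (ht a == k) && (a \in pos).
Proof. by rewrite mem_filter. Qed.

Lemma level_hgt a k : a \in level pos ht k -> h a = k%:R.
Proof. by rewrite mem_level_ht => /andP [/eqP <- pa]; rewrite htE. Qed.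

Lemma level_free k : free (level pos ht k).
Proof.
apply: (@obtuse_free _ v); first by rewrite filter_uniq // pos_uniq.
  by move=> a; rewrite mem_level_ht => /andP [_]; apply: pos_gt0.
move=> a b la lb ab; apply: same_hgt_obtuse => //.
- by move: la; rewrite mem_level_ht => /andP [_ /pos_root].
- by move: lb; rewrite mem_level_ht => /andP [_ /pos_root].
by rewrite !(level_hgt la) (level_hgt lb).
Qed.

Lemma nonsimple_sub b : b \in pos -> ~~ simple b ->
  exists d, [/\ simple d, b - d \in pos & h (b - d) = h b - 1].
Proof.
move=> pb nb; have [d sd bd] : exists2 d, simple d & 0 < dot b d.
  case: (boolP (has (fun d => simple d && (0 < dot b d)) pos)) => [|/hasPn no].
    by case/hasP => d _ /andP [sd bd]; exists d.
  have /(_ b pb) : forall c, c \in pos -> dot c b <= 0.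
    apply: pos_ind => [d sd|x y _ _ _ hx hy].
      by have := no _ (simple_pos sd); rewrite sd /= dotC -leNgt.
    by rewrite dotDl -[0]addr0 lerD.
  by rewrite leNgt dot_gt0 ?(pos_neq0 pb).
have bneqd : b != d by apply: contraNneq nb => ->.
have bdP := root_sub (pos_root pb) (pos_root (simple_pos sd)) bneqd bd.
exists d; split=> //; last by rewrite hgtB (hgt_simple sd).
case: (pos_or bdP) => //; rewrite opprB => hn.
by case/negP: (simple_sub sd pb).
Qed.

Lemma pos_span1 b : b \in pos -> b \in <<level pos ht 1>>%VS.
Proof.
move: b; apply: pos_ind => [d sd|a b _ _ _]; last exact: memvD.
by apply: memv_span; rewrite mem_level_ht ht_simple // eqxx simple_pos.
Qed.

End RootSystem.

Lemma sub_rootsys (Phi : seq E) (p : pred E) : rootsys Phi ->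
  (forall a b, a \in Phi -> b \in Phi -> p a -> p b -> p (refl a b)) ->
  rootsys [seq a <- Phi | p a].
Proof.
move=> [u h0 cl int red] hp; split.
- exact: filter_uniq.
- by rewrite mem_filter (negbTE h0) andbF.
- move=> a b; rewrite !mem_filter => /andP [pa aP] /andP [pb bP].
  by rewrite hp // cl.
- by move=> a b; rewrite !mem_filter => /andP [_ aP] /andP [_ bP]; apply: int.
by move=> a b; rewrite !mem_filter => /andP [_ aP] /andP [_ bP]; apply: red.
Qed.

(** * The span of a level of roots *)

Section LevelSpan.
Variable Phi : seq E.
Hypotheses (rs : rootsys Phi) (vreg : forall a, a \in Phi -> dot a v != 0).
Notation pos := (positive Phi).
Notation h := (hgt Phi).
Notation ht := (htn Phi).
Variable k : nat.
Notation L := (level pos ht k).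

Lemma level_pos a : a \in L -> a \in pos.
Proof. by rewrite mem_filter => /andP []. Qed.

(* The roots of span L with height divisible by k form a root system in which
   the elements of L are simple; hence its height is (hgt Phi)/k on span L. *)
Lemma half_height g : g \in pos -> g \in <<L>>%VS -> (ht g < k)%N -> (2 * ht g = k)%N.
Proof.
move=> pg gL gk; have k0 : (0 < k)%N by apply: leq_ltn_trans gk.
have kR : 0 < k%:R :> R by rewrite ltr0n.
pose p a := (a \in <<L>>%VS) && (h a / k%:R \is a Num.int).
pose Phi' := [seq a <- Phi | p a].
have rs' : rootsys Phi'.
  apply: sub_rootsys => // a b aP bP /andP [aL ak] /andP [bL bk]; apply/andP; split.
    by rewrite /refl memvB // memvZ.
  rewrite /refl hgtB hgtZ mulrBl -(mulrA (cart b a)); apply: rpredB; first exact: bk.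
  by apply: rpredM; [case: rs => _ _ _ int _; apply: int | exact: ak].
have vreg' a : a \in Phi' -> dot a v != 0.
  by rewrite mem_filter => /andP [_]; apply: vreg.
have posE a : (a \in positive Phi') = (a \in pos) && p a.
  by rewrite !mem_filter -andbA [p a && _]andbC.
have hk c : c \in positive Phi' -> k%:R <= h c.
  rewrite posE => /andP [pc /andP [_ ck]].
  have : 1 <= h c / k%:R by apply: int_ge1; rewrite // divr_gt0 // hgt_gt0.
  by rewrite ler_pdivlMr // mul1r.
have L1 b : b \in L -> hgt Phi' b = 1.
  move=> bL; have pb := level_pos bL; apply: hgt_simple => //.
  have pb' : b \in positive Phi'.
    by rewrite posE pb /p memv_span // (level_hgt rs vreg bL) divff ?rpred1 // gt_eqF.
  rewrite /simple_root pb'; apply/allP => c pc; apply/negP => /hk; rewrite hgtB (level_hgt rs vreg bL).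
  by have := hk _ pc; lra.
have hE x : x \in <<L>>%VS -> h x = k%:R * hgt Phi' x.
  move=> /(@coord_span _ _ _ (in_tuple L)) ->.
  elim/big_rec: _ => [|i y _ IH]; first by rewrite -(scale0r 0) !hgtZ !mul0r mulr0.
  have iL : (in_tuple L)`_i \in L by rewrite mem_nth.
  by rewrite !hgtD IH !hgtZ (L1 _ iL) (level_hgt rs vreg iL) mulrDr mulr1 mulrC.
(* A height is half a sum of Cartan integers. Here it lies strictly between 0 and 1, and must be
   1/2. *)
have int2 : 2 * (h g / k%:R) \is a Num.int.
  rewrite hE // [k%:R * _]mulrC mulfK ?gt_eqF // /hgt mulrA divff ?pnatr_eq0 //.
  rewrite mul1r big_seq rpred_sum // => c; rewrite posE => /andP [pc _].
  by case: rs => _ _ _ int _; apply: int; [exact: pos_root pc | exact: pos_root pg].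
have hg : h g < k%:R by rewrite -htE // ltr_nat.
have x0 : 0 < h g / k%:R by rewrite divr_gt0 // (hgt_gt0 rs vreg).
have x1 : h g / k%:R < 1 by rewrite ltr_pdivrMr // mul1r.
have y1 : 1 <= 2 * (h g / k%:R) by apply: int_ge1 => //; lra.
have y2 : 1 <= 2 - 2 * (h g / k%:R) by apply: int_ge1; [rewrite rpredB // rpred_nat | lra].
have {y1 y2} e1 : h g / k%:R = 2^-1 by lra.
have e2 : h g = 2^-1 * k%:R by rewrite -e1 divfK // gt_eqF.
apply/eqP; rewrite -(eqr_nat R) natrM htE // e2.
by rewrite mulrA divff ?pnatr_eq0 // mul1r.
Qed.

(** Let [G] be the roots of height k/2 in the span, and [G0] the members of [L] obtuse to all of
    [G]. Together they are pairwise obtuse, hence independent, so [size G <= size G1]. Each member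
    of [G1] is a sum of two distinct members of [G], whose unit vectors then have product at most
    -1/2. As the sum of all unit vectors of [G] has positive norm, [size G1 < size G], just as a
    forest has fewer edges than vertices. *)
Lemma level_span g : g \in pos -> (ht g < k)%N -> g \notin <<L>>%VS.
Proof.
move=> pg gk; apply/negP => gL; have hgk := half_height pg gL gk.
have k0 : (0 < k)%N by apply: leq_ltn_trans gk.
pose G := [seq c <- pos | (c \in <<L>>%VS) && (2 * ht c == k)%N].
have GP c : c \in G = [&& c \in pos, c \in <<L>>%VS & (2 * ht c == k)%N].
  by rewrite mem_filter andbC.
have uG : uniq G by rewrite filter_uniq // pos_uniq.
have Ghgt c : c \in G -> h c = k%:R / 2.
  rewrite GP => /and3P [pc _ /eqP <-]; rewrite natrM htE // mulrC mulKf //.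
  by rewrite pnatr_eq0.
have Lhgt := level_hgt rs vreg.
have kR : 0 < k%:R :> R by rewrite ltr0n.
pose G0 := [seq b <- L | all (fun c => dot b c <= 0) G].
pose G1 := [seq b <- L | ~~ all (fun c => dot b c <= 0) G].
have sL : size L = (size G0 + size G1)%N.
  by rewrite -(count_predC (fun b => all (fun c => dot b c <= 0) G) L) -!size_filter.
have uL : uniq L by rewrite filter_uniq // pos_uniq.
have Gpos c : c \in G -> c \in pos by rewrite GP => /and3P [].
have obG a b : a \in G -> b \in G -> a != b -> dot a b <= 0.
  move=> ga gb ab; apply: (same_hgt_obtuse rs vreg) => //.
  - exact: pos_root (Gpos _ ga).
  - exact: pos_root (Gpos _ gb).
  by rewrite (Ghgt _ ga) (Ghgt _ gb).
have fr : free (G ++ G0).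
  apply: (@obtuse_free _ v).
  - rewrite cat_uniq uG filter_uniq // andbT; apply/hasPn => b.
    rewrite mem_filter => /andP [_ /Lhgt hb]; apply/negP => /Ghgt; rewrite hb.
    lra.
  - move=> a; rewrite mem_cat => /orP [/Gpos/pos_gt0 //|].
    by rewrite mem_filter => /andP [_ /level_pos /pos_gt0].
  move=> a b; rewrite !mem_cat => /orP [ga|ga] /orP [gb|gb] ab.
  - exact: obG.
  - by move: gb; rewrite mem_filter dotC => /andP [/allP /(_ _ ga)].
  - by move: ga; rewrite mem_filter => /andP [/allP /(_ _ gb)].
  have inL x : x \in G0 -> x \in L by rewrite mem_filter => /andP [].
  have aL := inL _ ga; have bL := inL _ gb.
  apply: (same_hgt_obtuse rs vreg) => //.
  - exact: pos_root (level_pos aL).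
  - exact: pos_root (level_pos bL).
  by rewrite (Lhgt _ _ aL) (Lhgt _ _ bL).
have : (size (G ++ G0) <= size L)%N.
  have lf : free L by apply: level_free.
  move: fr lf; rewrite /free => /eqP <- /eqP <-; apply: dimvS; apply/span_subvP => a.
  rewrite mem_cat => /orP [|]; first by rewrite GP => /and3P [].
  by rewrite mem_filter => /andP [_ aL]; apply: memv_span.
rewrite size_cat sL addnC leq_add2l; apply/negP; rewrite -ltnNge.
have split_G1 b : b \in G1 -> exists c, [/\ c \in G, b - c \in G & c != b - c].
  rewrite mem_filter => /andP [/allPn [c cG]]; rewrite -ltNge => hbc bL.
  have pc := Gpos _ cG; have pb := level_pos bL.
  have hbcE : h (b - c) = k%:R / 2 by rewrite hgtB (Lhgt _ _ bL) (Ghgt _ cG); field.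
  have bc : b != c.
    by apply: contraTneq cG => <-; apply/negP => /Ghgt; rewrite (Lhgt _ _ bL); lra.
  have bcP : b - c \in Phi by apply: root_sub => //; apply: pos_root.
  have pbc : b - c \in pos by apply: hgt_pos => //; rewrite hbcE divr_gt0.
  exists c; split=> //.
    have cL : c \in <<L>>%VS by move: cG; rewrite GP => /and3P [].
    rewrite GP pbc memvB ?(memv_span bL) //=.
    rewrite -(eqr_nat R) natrM htE // hbcE mulrC divfK ?pnatr_eq0 //.
  apply/negP => /eqP e; have : c \in <[b]>%VS.
    apply/vlineP; exists 2^-1; apply: (scalerI (a := 2)); rewrite ?pnatr_eq0 //.
    rewrite scalerA divff ?pnatr_eq0 // scale1r scaler_nat mulr2n.
    by rewrite {1}e subrK.
  by move/(pos_line rs pc pb) => cb; rewrite cb eqxx in bc.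
have acute c d : c \in G -> d \in G -> c != d -> c + d \in L -> dot c d < 0.
  move=> cG dG cd cdL; rewrite lt_neqAle obG // andbT; apply/negP => /eqP e.
  have d0 := pos_neq0 rs (Gpos _ dG).
  have : refl d (c + d) \in Phi.
    case: rs => _ _ cl _ _; apply: cl; first exact: pos_root (Gpos _ dG).
    exact: pos_root (level_pos cdL).
  have -> : refl d (c + d) = c - d.
    rewrite /refl cartDl cartaa // {1}/cart e mulr0 mul0r add0r scaler_nat mulr2n.
    by rewrite opprD addrA addrK.
  move/(hgt_neq0 rs vreg); rewrite hgtB (Ghgt _ cG) (Ghgt _ dG) subrr eqxx //.
pose nrm c := Num.sqrt (dot c c).
have nrm_gt0 c : c \in G -> 0 < nrm c.
  by move=> cG; rewrite sqrtr_gt0 dot_gt0 // (pos_neq0 rs (Gpos _ cG)).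
have nrmE c : nrm c ^+ 2 = dot c c by rewrite sqr_sqrtr // dot_ge0.
pose w c d := dot ((nrm c)^-1 *: c) ((nrm d)^-1 *: d).
have wcc c : c \in G -> w c c = 1.
  by move=> cG; rewrite /w dotZl dotZr -nrmE; field; rewrite gt_eqF // nrm_gt0.
(* When the sum lies in [G1], both Cartan integers are at most -1, so the larger squared norm, and
   with it the product of the norms, is at most [- (2 * dot c d)]. *)
have wcd c d : c \in G -> d \in G -> c != d -> w c d <= - (2^-1 * ((c + d) \in G1)%:R).
  move=> cG dG cd; have n1 := nrm_gt0 _ cG; have n2 := nrm_gt0 _ dG.
  rewrite /w dotZl dotZr mulrA -invfM; set t := nrm c * nrm d.
  have t0 : 0 < t by rewrite mulr_gt0.
  rewrite mulrC ler_pdivrMr //; case: (boolP (c + d \in G1)) => [|_]; last first.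
    by rewrite mulr0 oppr0 mul0r obG.
  rewrite mulr1 mem_filter => /andP [_ cdL]; have lt0 := acute _ _ cG dG cd cdL.
  have cint x y : x \in G -> y \in G -> dot x y < 0 -> dot y y <= - (2 * dot x y).
    move=> xG yG xy; have y0 := pos_neq0 rs (Gpos _ yG).
    have : 1 <= - cart x y.
      apply: int_ge1; last by rewrite oppr_gt0 cart_lt0.
      rewrite rpredN; case: rs => _ _ _ int _; apply: int; exact/pos_root/Gpos.
    by rewrite /cart -mulNr ler_pdivlMr ?dot_gt0 // mul1r.
  have h1 := cint _ _ cG dG lt0; have h2 := cint _ _ dG cG; rewrite dotC in h2.
  have {}h2 := h2 lt0; rewrite -!nrmE in h1 h2.
  have : t <= - (2 * dot c d); last by lra.
  have [le|/ltW le] := lerP (nrm c) (nrm d).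
    by apply: le_trans h1; rewrite expr2 /t ler_pM2r.
  by apply: le_trans h2; rewrite expr2 /t ler_pM2l.
have total : 0 < \sum_(c <- G) \sum_(d <- G) w c d.
  have -> : \sum_(c <- G) \sum_(d <- G) w c d =
      dot (\sum_(c <- G) (nrm c)^-1 *: c) (\sum_(c <- G) (nrm c)^-1 *: c).
    by rewrite dot_suml; apply: eq_bigr => c _; rewrite dot_sumr.
  apply: dot_gt0; apply/eqP => s0.
  have : 0 < dot (\sum_(c <- G) (nrm c)^-1 *: c) v.
    have gG : g \in G by rewrite GP pg gL hgk eqxx.
    rewrite dot_suml (big_rem g) //= ltr_pwDl //.
      by rewrite dotZl mulr_gt0 ?invr_gt0 ?nrm_gt0 // (pos_gt0 pg).
    rewrite big_seq sumr_ge0 // => c /mem_rem cG.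
    by rewrite dotZl mulr_ge0 ?invr_ge0 ?sqrtr_ge0 // ltW // (pos_gt0 (Gpos _ cG)).
  by rewrite s0 dot0l ltxx.
pose m c d : nat := (c != d) && (c + d \in G1).
have le1 : \sum_(c <- G) \sum_(d <- G) w c d <=
    \sum_(c <- G) \sum_(d <- G) ((c == d)%:R - 2^-1 * (m c d)%:R).
  rewrite big_seq [X in _ <= X]big_seq ler_sum // => c cG.
  rewrite big_seq [X in _ <= X]big_seq ler_sum // => d dG; rewrite /m.
  have [<-|cd] := eqVneq c d; first by rewrite wcc // mulr0 subr0.
  by rewrite sub0r /= wcd.
have sum1 : \sum_(c <- G) \sum_(d <- G) (c == d)%:R = (size G)%:R :> R.
  rewrite -sum1_size natr_sum big_seq [RHS]big_seq; apply: eq_bigr => c cG.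
  rewrite (big_rem c) //= eqxx big_seq big1 ?addr0 // => d.
  by rewrite (mem_rem_uniq _ uG) inE => /andP [dc _]; rewrite eq_sym (negbTE dc).
(* A root [b] of [G1] is counted twice, once for each order of [c] and [b - c]. *)
have count2 : (2 * size G1 <= \sum_(c <- G) \sum_(d <- G) m c d)%N.
  have -> : (\sum_(c <- G) \sum_(d <- G) m c d =
      \sum_(b <- G1) \sum_(c <- G) (((b - c)%R \in G) && (c != (b - c)%R)))%N.
    rewrite [RHS]exchange_big /=; apply: eq_bigr => c _.
    have -> : (\sum_(d <- G) m c d = count (fun d => (c != d) && ((c + d)%R \in G1)) G)%N.
      by rewrite -sum1_count [RHS]big_mkcond; apply: eq_bigr => d _; rewrite /m; case: ifP.
    have -> : (\sum_(b <- G1) (((b - c)%R \in G) && (c != (b - c)%R)) =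
        count (fun b => ((b - c)%R \in G) && (c != (b - c)%R)) G1)%N.
      by rewrite -sum1_count [RHS]big_mkcond; apply: eq_bigr => d _; case: ifP.
    rewrite -!size_filter -[LHS](size_map (fun d => c + d)); apply/perm_size/uniq_perm.
    - by rewrite (map_inj_uniq (addrI c)) filter_uniq.
    - by rewrite filter_uniq // filter_uniq.
    move=> b; rewrite [RHS]mem_filter; apply/mapP/idP => [[d]|].
      by rewrite mem_filter => /andP [/andP [cd cdG] dG] ->; rewrite [c + d]addrC addrK dG cd addrC.
    case/andP => /andP [bcG cbc] bG; exists (b - c); last by rewrite addrC subrK.
    by rewrite mem_filter bcG cbc [c + _]addrC subrK bG.
  rewrite -sum1_size big_distrr /= big_seq [X in (_ <= X)%N]big_seq.
  apply: leq_sum => b bG1; have [c [cG bcG cbc]] := split_G1 b bG1.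
  rewrite (big_rem c) //= bcG cbc (big_rem (b - c)) /=; last first.
    by rewrite (mem_rem_uniq _ uG) inE eq_sym cbc.
  by rewrite opprB [b + _]addrC subrK cG eq_sym cbc.
have : \sum_(c <- G) \sum_(d <- G) ((c == d)%:R - 2^-1 * (m c d)%:R) =
    (size G)%:R - 2^-1 * (\sum_(c <- G) \sum_(d <- G) m c d)%:R :> R.
  rewrite -sum1 natr_sum mulr_sumr -sumrB; apply: eq_bigr => c _.
  by rewrite natr_sum mulr_sumr -sumrB.
move=> e; rewrite e in le1; have := lt_le_trans total le1.
move: count2; rewrite -(ler_nat R) natrM => c2 c3.
by rewrite -(ltr_nat R); lra.
Qed.

End LevelSpan.

(** * Heights in rank two *)

Section RankTwo.
Variables (Psi : seq E) (P : {vspace E}) (H : E -> R).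
Hypotheses (rs : rootsys Psi) (vreg : forall a, a \in Psi -> dot a v != 0).
Hypotheses (dimP : (\dim P <= 2)%N) (PsiP : {subset Psi <= P}).
Hypotheses (HD : forall a b, H (a + b) = H a + H b)
  (Hpos : forall a, a \in positive Psi -> 0 < H a).
Notation pos := (positive Psi).
Notation ht := (htn Psi).
Notation simple := (simple_root Psi).

Lemma free_size2 X : free X -> {subset X <= pos} -> (size X <= 2)%N.
Proof.
rewrite /free => /eqP <- hX; apply: leq_trans dimP; apply: dimvS.
by apply/span_subvP => a /hX /pos_root /PsiP.
Qed.

Lemma simple_level a : simple a -> a \in level pos ht 1.
Proof. by move=> sa; rewrite mem_level_ht (ht_simple rs vreg) // eqxx simple_pos. Qed.

Lemma level_subpos k : {subset level pos ht k <= pos}.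
Proof. by move=> a; rewrite mem_level_ht => /andP []. Qed.

Lemma simple_two a b c : simple a -> simple b -> a != b -> simple c -> c = a \/ c = b.
Proof.
move=> sa sb ab sc; have [->|ca] := eqVneq c a; first by left.
have [->|cb] := eqVneq c b; first by right.
have : (size [:: a; b; c] <= size (level pos ht 1))%N.
  apply: uniq_leq_size; first by rewrite /= !inE negb_or ab eq_sym ca eq_sym cb.
  by move=> x; rewrite !inE => /or3P [] /eqP ->; apply: simple_level.
have := free_size2 (level_free rs vreg 1) (@level_subpos 1).
by move=> h1 h2; have := leq_trans h2 h1.
Qed.

Lemma nonsimple_ht b : b \in pos -> ~~ simple b ->
  exists d, [/\ simple d, b - d \in pos & ht b = (ht (b - d)).+1].
Proof.
move=> pb nb; have [d [sd pbd _]] := nonsimple_sub rs vreg pb nb.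
exists d; split=> //; have e := htD rs vreg pbd (simple_pos sd).
by rewrite subrK (ht_simple rs vreg sd) addn1 in e; apply: e.
Qed.

Lemma ht_interm b j : b \in pos -> (0 < j <= ht b)%N -> exists2 c, c \in pos & ht c = j.
Proof.
have [m] := ubnP (ht b); elim: m b => // m IH b hm pb /andP [j0 jb].
have [e|ne] := eqVneq j (ht b); first by exists b.
have nb : ~~ simple b.
  apply/negP => /(ht_simple rs vreg) h; move: jb ne j0; rewrite h.
  by case: (j) => // -[].
have [d [sd pbd hE]] := nonsimple_ht pb nb.
apply: (IH (b - d)) => //; first by rewrite -ltnS -hE.
by rewrite j0 /= -ltnS -hE ltn_neqAle ne.
Qed.

(** Two roots of the same height would span [P], and then a root of height 1 would lie in the span
    of a higher level, against [level_span]. *)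
Lemma ht_unique b c : b \in pos -> c \in pos -> ht b = ht c -> (1 < ht b)%N -> b = c.
Proof.
move=> pb pc e hb; apply/eqP; apply: contraT => bc.
have b1 : (0 < 1 <= ht b)%N by rewrite /= ltnW.
have [d pd hd] := ht_interm pb b1.
have := level_span rs vreg (k := ht b) pd; rewrite hd => /(_ hb) /negP [].
have fL := level_free rs vreg (ht b).
suff e2 : (P <= <<level pos ht (ht b)>>)%VS by apply: (subvP e2); apply/PsiP/pos_root.
have sub : (<<level pos ht (ht b)>> <= P)%VS.
  by apply/span_subvP => x /level_subpos /pos_root /PsiP.
suff h : (2 <= size (level pos ht (ht b)))%N.
  have /eqP -> : <<level pos ht (ht b)>>%VS == P.
    rewrite eqEdim sub; apply: leq_trans dimP _.
    by move: fL; rewrite /free => /eqP ->.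
  exact: subvv.
rewrite -[2%N]/(size [:: b; c]); apply: uniq_leq_size; first by rewrite /= inE bc.
by move=> x; rewrite !inE mem_level_ht => /orP [] /eqP ->; rewrite ?pb ?pc ?e eqxx.
Qed.

(** [H] stands for the height in an ambient system. It orders the roots of the plane as their own
    height does, except that it may separate the two simple roots. *)
Lemma H_mono b c : b \in pos -> c \in pos -> (ht c < ht b)%N -> (1 < ht b)%N -> H c < H b.
Proof.
have [m] := ubnP (ht b); elim: m b => // m IH b hm pb pc cb hb.
have nb : ~~ simple b.
  by apply/negP => /(ht_simple rs vreg) h; rewrite h in hb.
have [d [sd pbd hE]] := nonsimple_ht pb nb.
have HE : H b = H (b - d) + H d by rewrite -HD subrK.
have Hd := Hpos (simple_pos sd); have Hbd := Hpos pbd.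
have [lt|ge] := ltnP (ht c) (ht (b - d)).
  have h2 : (1 < ht (b - d))%N by apply: leq_ltn_trans lt; apply: (ht_gt0 rs vreg).
  have : H c < H (b - d) by apply: IH => //; rewrite -ltnS -hE.
  by move=> h; rewrite HE; apply: lt_trans h _; rewrite ltrDl.
have e : ht c = ht (b - d) by apply/eqP; rewrite eqn_leq ge andbT -ltnS -hE.
have [h2|h2] := ltnP 1 (ht c).
  by rewrite (ht_unique pc pbd e h2) HE ltrDl.
have h1 : ht c = 1%N by apply/eqP; rewrite eqn_leq h2 (ht_gt0 rs vreg).
have sc := ht1_simple rs vreg pc h1.
have sbd : simple (b - d) by apply: (ht1_simple rs vreg) => //; rewrite -e.
have neq : d != b - d.
  apply: contraTneq pb => e3; have e4 : b = d + d by rewrite {2}e3 addrC subrK.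
  apply/negP => pb; case/negP: nb; rewrite [b](pos_line rs pb (simple_pos sd)) //.
  by rewrite e4 memvD // memv_line.
by rewrite HE; case: (simple_two sd sbd neq sc) => ->; rewrite ?ltrDl ?ltrDr.
Qed.

(** There are at most two roots of height 1 and one of each greater height that occurs. A nonsimple
    root of height h thus has h lower roots. A simple root has none or one, depending on [H]; the
    subtracted boolean makes the result 0 in both cases. *)
Lemma rank2_count a : a \in pos ->
  ((ht a).-1 = count (fun c => (H c < H a)%R) pos
    - (0 < count (fun c => (H c < H a)%R) pos))%N.
Proof.
move=> pa; have [sa|na] := boolP (simple a).
  rewrite (ht_simple rs vreg sa) /=.
  suff : (count (fun c => (H c < H a)%R) pos <= 1)%N by case: (count _ _) => [|[]].
  have [d hd] : exists d, forall c, c \in pos -> H c < H a -> c \in <[d]>%VS.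
    pose d := nth 0 [seq c <- level pos ht 1 | c != a] 0.
    exists d; apply: pos_ind => [c sc|c1 c2 p1 p2 _ h1 h2].
      move=> hc; have ca : c != a by apply: contraTneq hc => ->; rewrite ltxx.
      have cin : c \in [seq c <- level pos ht 1 | c != a].
        by rewrite mem_filter ca simple_level.
      have din : d \in [seq c <- level pos ht 1 | c != a].
        by apply: mem_nth; case: [seq c <- _ | _] cin.
      move: din; rewrite mem_filter => /andP [da /[!mem_level_ht] /andP [/eqP h1 pd]].
      have sd := ht1_simple rs vreg pd h1.
      have [->|cd] := eqVneq c d; first exact: memv_line.
      case: (simple_two sa sc _ sd) => [|e|e]; first by rewrite eq_sym.
        by rewrite e eqxx in da.
      by rewrite e eqxx in cd.
    rewrite HD => hc; apply: memvD; [apply: h1|apply: h2]; apply: lt_trans hc.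
      by rewrite ltrDl Hpos.
    by rewrite ltrDr Hpos.
  rewrite -size_filter; case e : [seq c <- pos | H c < H a] => [|c1 [|c2 t]] //.
  have in1 : c1 \in [seq c <- pos | H c < H a] by rewrite e mem_head.
  have in2 : c2 \in [seq c <- pos | H c < H a] by rewrite e !inE eqxx orbT.
  have : uniq [seq c <- pos | H c < H a] by rewrite filter_uniq // pos_uniq.
  rewrite e /= inE negb_or => /andP [/andP [/negP c12 _] _]; case: c12.
  have [h1 q1] : H c1 < H a /\ c1 \in pos by apply/andP; rewrite -(mem_filter (fun c => H c < H a)).
  have [h2 q2] : H c2 < H a /\ c2 \in pos by apply/andP; rewrite -(mem_filter (fun c => H c < H a)).
  have l1 := hd _ q1 h1; have l2 := hd _ q2 h2.
  apply/eqP; apply: (pos_line rs q1 q2).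
  case/vlineP: l2 => k ek; have k0 : k != 0.
    by apply: contraNneq (pos_neq0 rs q2) => k0; rewrite ek k0 scale0r.
  case/vlineP: l1 => k' ->; rewrite ek; apply/vlineP; exists (k' / k).
  by rewrite scalerA divfK.
have [d [sd pbd hE]] := nonsimple_ht pa na.
have ha : (1 < ht a)%N by rewrite hE ltnS (ht_gt0 rs vreg).
have lowE c : c \in pos -> (H c < H a) = (ht c < ht a)%N.
  move=> pc; have [lt|ge] := ltnP (ht c) (ht a); first by apply: H_mono.
  have [gt|le] := ltnP (ht a) (ht c).
    by apply/negbTE; rewrite -leNgt ltW // H_mono // (leq_trans ha) // ltnW.
  have e : ht a = ht c by apply/eqP; rewrite eqn_leq le ge.
  by rewrite (ht_unique pa pc e ha) ltxx.
pose T := [seq c <- pos | (ht c < ht a)%N].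
have -> : count (fun c => H c < H a) pos = size T.
  by rewrite size_filter; apply: eq_in_count.
have dT : d \in T by rewrite mem_filter (ht_simple rs vreg sd) ha simple_pos.
have uT : uniq T by rewrite filter_uniq // pos_uniq.
have szT : size T = (size (rem d T)).+1.
  by rewrite size_rem // prednK //; case: (T) dT.
have inR c : c \in rem d T -> [/\ c != d, c \in pos & (ht c < ht a)%N].
  by rewrite (mem_rem_uniq _ uT) inE => /andP [cd]; rewrite mem_filter => /andP [h p].
rewrite szT subn1 /=.
(* Without the simple root [d], the lower roots have the heights 1, ..., [(ht a).-1], once each. *)
suff pe : perm_eq [seq ht c | c <- rem d T] (iota 1 (ht a).-1).
  by rewrite -(size_map ht) (perm_size pe) size_iota.
apply: uniq_perm; last 1 first.
- move=> j; rewrite mem_iota addnC addn1 prednK; last by apply: ltnW.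
  apply/mapP/idP => [[c /inR [cd pc hc] ->]|/andP [j1 j2]].
    by rewrite hc (ht_gt0 rs vreg).
  have [h1|h1] := eqVneq j 1%N; last first.
    have j12 : (0 < j <= ht a)%N by rewrite j1 ltnW.
    have [c pc hc] := ht_interm pa j12.
    exists c => //; rewrite (mem_rem_uniq _ uT) inE mem_filter pc hc j2 !andbT.
    by apply: contraNneq h1 => cd; rewrite -hc cd (ht_simple rs vreg sd).
  have [d' sd' dd'] : exists2 d', simple d' & d' != d.
    case: (boolP (has (fun c => simple c && (c != d)) pos)) => [|/hasPn no].
      by case/hasP => c _ /andP []; exists c.
    have al b : b \in pos -> b \in <[d]>%VS.
      move: b; apply: pos_ind => [c sc|c1 c2 _ _ _]; last exact: memvD.
      have := no _ (simple_pos sc); rewrite sc /= negbK => /eqP ->; exact: memv_line.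
    by case/negP: na; rewrite (pos_line rs pa (simple_pos sd) (al _ pa)).
  exists d'; last by rewrite h1 (ht_simple rs vreg sd').
  rewrite (mem_rem_uniq _ uT) inE /= dd' mem_filter (ht_simple rs vreg sd') ha.
  by rewrite simple_pos.
- rewrite map_inj_in_uniq ?rem_uniq // => c1 c2 /inR [n1 p1 _] /inR [n2 p2 _] e.
  have [h|h] := ltnP 1 (ht c1); first exact: ht_unique.
  have h1 : ht c1 = 1%N by apply/eqP; rewrite eqn_leq h (ht_gt0 rs vreg).
  have s1 := ht1_simple rs vreg p1 h1; rewrite h1 in e.
  have s2 := ht1_simple rs vreg p2 (esym e).
  by case: (simple_two sd s1 _ s2) => [|h3|//]; [rewrite eq_sym|rewrite h3 eqxx in n2].
exact: iota_uniq.
Qed.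

End RankTwo.

Lemma sum_by_class (T C : eqType) (s : seq T) (f : T -> C) (g : T -> R) :
  \sum_(x <- s) g x = \sum_(P <- undup (map f s)) \sum_(x <- s | f x == P) g x.
Proof.
rewrite (exchange_big_dep xpredT) //= big_seq [RHS]big_seq; apply: eq_bigr => x xs.
have fx : f x \in undup (map f s) by rewrite mem_undup map_f.
rewrite -big_filter (_ : [seq P <- undup (map f s) | f x == P] = [:: f x]) ?big_seq1 //.
have : uniq (undup (map f s)) by apply: undup_uniq.
elim: (undup _) fx => //= P r IH; rewrite in_cons => /predU1P [<-|fr] /andP [Pr ur].
  rewrite eqxx; congr (_ :: _); rewrite -(filter_pred0 r); apply: eq_in_filter => Q Qr.
  by apply/negbTE; apply: contraNneq Pr => ->.
rewrite IH //; case: eqP => // e; by rewrite -e fr in Pr.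
Qed.

Section PlaneCount.
Variable Phi : seq E.
Hypotheses (rs : rootsys Phi) (vreg : forall a, a \in Phi -> dot a v != 0).
Notation pos := (positive Phi).
Notation h := (hgt Phi).
Notation ht := (htn Phi).

(* Half of the sum of the Cartan integers of a with the roots of a plane through
   a is the height of a in the rank two system of that plane, which depends only
   on the number of its roots lower than a. *)
Lemma plane_count a : a \in pos ->
  size (below pos ht (ht a)) =
    ((ht a).-1 + size (undup [seq plane a b | b <- below pos ht (ht a)]))%N.
Proof.
move=> pa; have a0 := pos_neq0 rs pa; pose f b := plane a b; pose s := rem a pos.
have sP b : b \in s -> b \in pos /\ b != a.
  by rewrite (mem_rem_uniq _ (pos_uniq rs)) inE => /andP [].
have nab b : b \in s -> b \notin <[a]>%VS.
  by move=> /sP [pb ba]; apply: contra ba => /(pos_line rs pb pa) ->.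
have fP b c : b \in s -> c \in s -> (f b == f c) = (b \in f c).
  move=> bs cs; apply/eqP/idP => [<-|h]; first exact: mem_planer.
  by apply: plane_eq => //; apply: nab.
pose n (P : {vspace E}) := count (fun c => (c \in P) && (h c < h a)) pos.
have local P : P \in undup (map f s) ->
    \sum_(b <- s | f b == P) cart a b = 2 * ((n P)%:R - (0 < n P)%N%:R).
  rewrite mem_undup => /mapP [c cs eP].
  pose Psi := [seq b <- Phi | b \in P].
  have rsP : rootsys Psi.
    by apply: sub_rootsys => // x y _ _ xP yP; rewrite /refl memvB // memvZ.
  have vP x : x \in Psi -> dot x v != 0 by rewrite mem_filter => /andP [_ /vreg].
  have posPsi : positive Psi = [seq b <- pos | b \in P].
    by rewrite /positive /Psi -!filter_predI; apply: eq_filter => x /=; rewrite andbC.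
  have aP : a \in P by rewrite eP mem_planel.
  have paP : a \in positive Psi by rewrite posPsi mem_filter aP.
  have dP : (\dim P <= 2)%N.
    by rewrite eP; apply: leq_trans (dimv_add_leqif _ _) _; rewrite !dim_vline; do 2 case: (_ != 0).
  have := rank2_count rsP vP dP _ (hgtD Phi) _ paP.
  move=> /(_ _ _) hc.
  have {}hc : ((htn Psi a).-1 = n P - (0 < n P))%N.
    rewrite hc; last 2 first.
    - by move=> x; rewrite mem_filter => /andP [].
    - by move=> x; rewrite posPsi mem_filter => /andP [_]; apply: hgt_gt0.
    rewrite posPsi count_filter /n.
    by rewrite (eq_count (a2 := fun c => (c \in P) && (h c < h a))) // => x /=; rewrite andbC.
  have hE : 2 * hgt Psi a = 2 + \sum_(b <- s | f b == P) cart a b.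
    rewrite /hgt mulrA divff ?pnatr_eq0 // mul1r posPsi (big_rem a) -?posPsi //=.
    rewrite cartaa //; congr (_ + _).
    rewrite /s !(rem_filter a (pos_uniq _)) // posPsi -[RHS]big_filter.
    rewrite -!(filter_predI _ _ pos); congr (\sum_(b <- _) _).
    apply: eq_in_filter => b pb /=; case ba: (b == a) => //=.
      by rewrite andbF.
    by rewrite andbT eP fP // (mem_rem_uniq _ (pos_uniq rs)) inE /= ba.
  have h1 := htE rsP vP paP; have h0 := ht_gt0 rsP vP paP.
  have : (htn Psi a)%:R = 1 + ((n P)%:R - (0 < n P)%N%:R) :> R.
    rewrite -natrB; last by case: (n P).
    by rewrite -hc -(natrD _ 1) add1n prednK.
  by rewrite h1 => h2; move: hE; rewrite h2; lra.
have tot : \sum_(b <- s) cart a b = 2 * (h a - 1).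
  rewrite /hgt mulrBr mulrA divff ?pnatr_eq0 // mul1r mulr1 [in RHS](big_rem a) //= cartaa //.
  by rewrite [2 + _]addrC addrK.
have below_s : below pos ht (ht a) = [seq b <- s | (ht b < ht a)%N].
  rewrite /below /s (rem_filter a (pos_uniq rs)) -(filter_predI _ _ pos); apply: eq_filter => b /=.
  by case: eqP => [->|]; rewrite ?ltnn ?andbT ?andbF.
have nE P : P \in undup (map f s) -> n P = count (fun b => f b == P) (below pos ht (ht a)).
  rewrite mem_undup => /mapP [c cs eP].
  rewrite below_s count_filter /n -(count_filter _ (fun c => (h c < h a))).
  have -> : [seq c <- pos | h c < h a] = [seq b <- s | (ht b < ht a)%N].
    rewrite -below_s; apply: eq_in_filter => b pb.
    by rewrite -!htE // ltr_nat.
  rewrite count_filter; apply: eq_in_count => b bs /=.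
  by rewrite eP fP.
move: tot; rewrite (sum_by_class s f) (eq_big_seq _ local) -mulr_sumr => /(mulfI _).
rewrite pnatr_eq0 => /(_ isT) tot.
have usub : undup [seq f b | b <- below pos ht (ht a)] =i
    [seq P <- undup (map f s) | (0 < n P)%N].
  move=> P; rewrite mem_undup mem_filter; apply/idP/idP.
    move=> /mapP [b bb eP]; have Ps : P \in undup (map f s).
      by rewrite mem_undup eP map_f //; move: bb; rewrite below_s mem_filter => /andP [].
    by rewrite Ps nE // -has_count andbT; apply/hasP; exists b; rewrite ?eP.
  by case/andP => [n0 Ps]; move: n0; rewrite nE // -has_count => /hasP [b bb /eqP <-]; apply: map_f.
have s1 : (\sum_(P <- undup (map f s)) (0 < n P) =
    size (undup [seq f b | b <- below pos ht (ht a)]))%N.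
  rewrite (perm_size (uniq_perm _ _ usub)) ?undup_uniq ?filter_uniq ?undup_uniq //.
  by rewrite size_filter -sum1_count [RHS]big_mkcond; apply: eq_bigr => P _; case: ltnP.
have s2 : (\sum_(P <- undup (map f s)) n P = size (below pos ht (ht a)))%N.
  rewrite (eq_big_seq _ nE) -sum1_size (eq_bigr _ (fun P _ => esym (sum1_count _ _))).
  rewrite (exchange_big_dep xpredT) //= big_seq [RHS]big_seq; apply: eq_bigr => b bb.
  have fb : f b \in undup (map f s).
    by rewrite mem_undup map_f //; move: bb; rewrite below_s mem_filter => /andP [].
  rewrite sum1_count (eq_count (a2 := pred1 (f b))); last by move=> P /=; rewrite eq_sym.
  by rewrite count_uniq_mem ?undup_uniq // fb.
move: tot; rewrite sumrB -!natr_sum s1 s2 -(htE rs vreg pa) => tot.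
apply/eqP; rewrite -(eqr_nat R) natrD -/f -subr_eq tot.
by rewrite -{1}(prednK (ht_gt0 rs vreg pa)) -addn1 natrD addrK.
Qed.

End PlaneCount.

Section Cryst.
Variable Phi : seq E.
Hypotheses (rs : rootsys Phi) (vreg : forall a, a \in Phi -> dot a v != 0).

Theorem rootsys_mat_free : mat_free (positive Phi) (htn Phi).
Proof.
split.
- exact: pos_noncollinear.
- by move=> a; apply: ht_gt0.
- by move=> k; apply: level_free.
- by move=> k a ap; apply: level_span.
exact: plane_count.
Qed.

End Cryst.
End Euclidean.

(** * Constructions of MAT-free families *)

(** A subspace that does not contain [v] contains at most one of the points [u + m%:R *: v], so a
    large [m] avoids them all. *)
Lemma exists_avoiding (K : numFieldType) (V : vectType K) (U : {vspace V})
    (Hs : seq {vspace V}) : (forall H, H \in Hs -> ~~ (U <= H)%VS) ->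
  exists2 v, v \in U & forall H, H \in Hs -> v \notin H.
Proof.
elim: Hs => [|H Hs IH] hU; first by exists 0; rewrite ?mem0v.
have [|v vU vH] := IH; first by move=> H' H's; apply: hU; rewrite inE H's orbT.
have /subvPn [u uU uH] := hU _ (mem_head H Hs).
have [vH1|vH1] := boolP (v \in H); last first.
  by exists v => // H'; rewrite inE => /predU1P [->|/vH].
have [N hN] : exists N, forall m, (N < m)%N -> forall H', H' \in Hs -> u + m%:R *: v \notin H'.
  elim: Hs vH {IH hU} => [|H' Hs IH] vH; first by exists 0%N.
  have [|N hN] := IH; first by move=> J Js; apply: vH; rewrite inE Js orbT.
  have [[m0 hm0]|no] := pselect (exists m : nat, u + m%:R *: v \in H'); last first.
    exists N => m lt J; rewrite inE => /predU1P [->|Js]; last exact: hN.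
    by apply/negP => h; apply: no; exists m.
  exists (maxn N m0) => m; rewrite gtn_max => /andP [lt1 lt2] J.
  rewrite inE => /predU1P [->|Js]; last exact: hN.
  apply/negP => hm; case/negP: (vH _ (mem_head H' Hs)).
  have := memvB hm hm0; rewrite opprD addrACA subrr add0r -scalerBl -natrB ?(ltnW lt2) //.
  by rewrite rpredZeq pnatr_eq0 subn_eq0 leqNgt lt2.
exists (u + N.+1%:R *: v); first by rewrite memvD // memvZ.
move=> J; rewrite inE => /predU1P [->|Js]; last exact: hN.
by rewrite rpredDr // rpredZ.
Qed.

Section Transfer.
Variables (K : fieldType) (E F : vectType K) (f : 'Hom(E, F)).
Hypothesis f0 : (lker f == 0)%VS.

Lemma mem_limg_ker0 U a : (f a \in (f @: U)%VS) = (a \in U).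
Proof. by rewrite !memvE -limg_line limg_ker0. Qed.

Lemma free_map_ker0 X : free (map f X) = free X.
Proof.
rewrite /free size_map -limg_span limg_dim_eq //.
by apply/eqP; rewrite -subv0 (eqP f0) capvSr.
Qed.

Lemma noncollinear_map s : noncollinear s -> noncollinear (map f s).
Proof.
have finj := lker0P f0; rewrite /noncollinear => /andP [s0 u].
apply/andP; split; first by rewrite -(linear0 f) mem_map.
rewrite -map_comp (eq_map (g := (fun U => f @: U)%VS \o (fun a => <[a]>%VS))); last first.
  by move=> a /=; rewrite limg_line.
by rewrite map_comp map_inj_uniq // => U U' /eqP; rewrite eq_limg_ker0 // => /eqP.
Qed.

Lemma mat_free_map s ht ht' : {in s, forall a, ht' (f a) = ht a} ->
  mat_free s ht -> mat_free (map f s) ht'.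
Proof.
move=> e [nc h0 fl nsp cnt]; split.
- exact: noncollinear_map.
- by move=> _ /mapP [a sa ->]; rewrite e // h0.
- move=> k; suff -> : level (map f s) ht' k = map f (level s ht k).
    by rewrite free_map_ker0.
  by rewrite /level filter_map; congr map; apply: eq_in_filter => a sa /=; rewrite e.
- move=> k _ /mapP [a sa ->]; rewrite e // => lt.
  suff -> : level (map f s) ht' k = map f (level s ht k).
    by rewrite -limg_span mem_limg_ker0 nsp.
  by rewrite /level filter_map; congr map; apply: eq_in_filter => b sb /=; rewrite e.
move=> _ /mapP [a sa ->]; rewrite e //.
have -> : below (map f s) ht' (ht a) = map f (below s ht (ht a)).
  by rewrite /below filter_map; congr map; apply: eq_in_filter => b sb /=; rewrite e.
rewrite size_map cnt // -map_comp; congr (_ + _)%N; apply: size_undup_map_eq => b c _ _.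
rewrite /= /plane -!limg_line -!limgD; split=> [/eqP|->] //.
by rewrite eq_limg_ker0 // => /eqP.
Qed.

End Transfer.

Section Union.
Variables (K : fieldType) (E : vectType K).
Implicit Types (s t : seq E) (ht : E -> nat).

Lemma noncollinear_eq s a b : noncollinear s -> a \in s -> b \in s ->
  b \in <[a]>%VS -> a = b.
Proof.
move=> nc sa sb ba; apply/eqP; apply: contraT => ab.
by have := noncollinear_notin nc sa sb ab; rewrite ba.
Qed.

Lemma cap0_eq0 (U V : {vspace E}) x : (U :&: V = 0)%VS -> x \in U -> x \in V -> x = 0.
Proof. by move=> e xU xV; apply/eqP; rewrite -memv0 -e memv_cap xU. Qed.

Lemma noncollinear_cat s1 s2 : (<<s1>> :&: <<s2>> = 0)%VS ->
  noncollinear s1 -> noncollinear s2 -> noncollinear (s1 ++ s2).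
Proof.
move=> cap n1 n2; have [z1 u1] := andP n1; have [z2 u2] := andP n2.
rewrite /noncollinear mem_cat negb_or z1 z2 map_cat cat_uniq u1 u2 /= andbT.
apply/hasPn => _ /mapP [b b2 ->]; apply/negP => /mapP [a a1 e].
have a0 := noncollinear_neq0 n1 a1; case/eqP: a0; apply: (cap0_eq0 cap).
  exact: memv_span.
have : a \in <[b]>%VS by rewrite e memv_line.
by move/vlineP => [k ->]; rewrite memvZ // memv_span.
Qed.

(** Every form of [s2] spans with [a] a plane of its own, different from those of [s1]. Hence [s2]
    adds the same number to both sides of the count. *)
Lemma mat_free_half t s1 s2 ht a : perm_eq t (s1 ++ s2) ->
  (<<s1>> :&: <<s2>> = 0)%VS -> noncollinear s2 -> mat_free s1 ht -> a \in s1 ->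
  (forall k, (ht a < k)%N -> a \notin <<level t ht k>>%VS) /\
  size (below t ht (ht a)) =
    ((ht a).-1 + size (undup [seq plane a b | b <- below t ht (ht a)]))%N.
Proof.
move=> pe cap n2 [n1 _ _ nsp cnt] a1; have a0 := noncollinear_neq0 n1 a1.
have sub1 (p : pred E) : (<<filter p s1>> <= <<s1>>)%VS.
  by apply: sub_span => x; rewrite mem_filter => /andP [].
have sub2 (p : pred E) : (<<filter p s2>> <= <<s2>>)%VS.
  by apply: sub_span => x; rewrite mem_filter => /andP [].
have as1 : a \in <<s1>>%VS by apply: memv_span.
split=> [k ak|].
  have -> : <<level t ht k>>%VS = <<level s1 ht k ++ level s2 ht k>>%VS.
    by rewrite -filter_cat; apply: eq_span; apply: perm_mem; apply: perm_filter.
  apply/negP; rewrite span_cat => /memv_addP [x xL [y yL e]].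
  have y0 : y = 0.
    apply: (cap0_eq0 cap); last exact: subvP (sub2 _) _ yL.
    have -> : y = a - x by rewrite e addrC addKr.
    by rewrite memvB // (subvP (sub1 _) _ xL).
  by have := nsp k a a1 ak; rewrite e y0 addr0 xL.
have pb : perm_eq (below t ht (ht a)) (below s1 ht (ht a) ++ below s2 ht (ht a)).
  by rewrite -filter_cat; apply: perm_filter.
rewrite (perm_size pb) (perm_size (perm_undup (perm_mem (perm_map (plane a) pb)))).
rewrite map_cat undup_cat !size_cat cnt // -!addnA; congr (_ + (_ + _))%N.
  congr size; apply/esym/all_filterP/allP => P.
  rewrite mem_undup => /mapP [b bb ->]; apply/negP => /mapP [c cc e].
  have cs2 : c \in <<s2>>%VS by apply: (subvP (sub2 _)); apply: memv_span cc.
  have c0 : c != 0 by apply: (noncollinear_neq0 n2); move: cc; rewrite mem_filter => /andP [].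
  case/eqP: c0; apply: (cap0_eq0 cap) => //.
  have : c \in plane a b by rewrite e mem_planer.
  case/mem_plane => m [n ->]; rewrite memvD ?memvZ //.
  by apply: (subvP (sub1 _)); apply: memv_span bb.
rewrite undup_id ?size_map // map_inj_in_uniq.
  by rewrite filter_uniq // noncollinear_uniq.
move=> b c; rewrite !mem_filter => /andP [_ b2] /andP [_ c2] e.
apply: (noncollinear_eq n2) => //.
have : c \in plane a b by rewrite e mem_planer.
case/mem_plane => m [n ec]; have e0 : m *: a = 0.
  apply: (cap0_eq0 cap); first by rewrite memvZ.
  have -> : m *: a = c - n *: b by rewrite ec addrK.
  by rewrite memvB ?memvZ ?memv_span.
by rewrite ec e0 add0r memvZ // memv_line.
Qed.

Lemma eq_in_mat_free s ht ht' : {in s, ht =1 ht'} -> mat_free s ht -> mat_free s ht'.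
Proof.
move=> e mf; have f0 : (lker (\1%VF : 'Hom(E, E)) == 0)%VS.
  by apply/lker0P => x y; rewrite !lfunE.
have := mat_free_map f0 (s := s) (ht := ht) (ht' := ht') _ mf.
rewrite (eq_map (g := id)) ?map_id; last by move=> x; rewrite lfunE.
by apply=> x xs; rewrite lfunE /= e.
Qed.

Lemma mat_free_cat s1 s2 ht : (<<s1>> :&: <<s2>> = 0)%VS ->
  mat_free s1 ht -> mat_free s2 ht -> mat_free (s1 ++ s2) ht.
Proof.
move=> cap m1 m2; have [n1 h1 f1 _ _] := m1; have [n2 h2 f2 _ _] := m2.
have cap' : (<<s2>> :&: <<s1>> = 0)%VS by rewrite capvC.
have half1 a := mat_free_half (perm_refl (s1 ++ s2)) cap n2 m1 (a := a).
have pe : perm_eq (s1 ++ s2) (s2 ++ s1) by rewrite perm_catC.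
have half2 a := mat_free_half pe cap' n1 m2 (a := a).
split.
- exact: noncollinear_cat.
- by move=> a; rewrite mem_cat => /orP [/h1|/h2].
- move=> k; rewrite /level filter_cat cat_free f1 f2 /= directv_addE.
  rewrite !directv_trivial //= -subv0 -cap capvS //.
    by apply: sub_span => x; rewrite mem_filter => /andP [].
  by apply: sub_span => x; rewrite mem_filter => /andP [].
- by move=> k a; rewrite mem_cat => /orP [/half1|/half2] [h _]; apply: h.
by move=> a; rewrite mem_cat => /orP [/half1|/half2] [].
Qed.

End Union.

Section Levels.
Variables (K : fieldType) (E : vectType K).
Implicit Types (s t A l : seq E) (ls : seq (seq E)).

(** [k] is the height of the next level minus one, and [A] collects the lower forms. *)
Fixpoint mat_levels k A ls : bool :=
  if ls is l :: ls' then
    [&& free l, all (fun a => a \notin <<l>>%VS) A,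
        all (fun b => size A == k + size (undup [seq plane b a | a <- A]))%N l
      & mat_levels k.+1 (A ++ l) ls']
  else true.

Definition level_ht ls (a : E) : nat := (find (fun l => a \in l) ls).+1.

Lemma level_htE ls k a : uniq (flatten ls) -> a \in nth [::] ls k -> level_ht ls a = k.+1.
Proof.
rewrite /level_ht => u ak; congr _.+1; elim: ls k u ak => [|l ls IH] [|k] //=.
  by move=> _ ->.
rewrite cat_uniq => /and3P [_ /hasPn no u] ak; rewrite ifN ?(IH k) //.
apply: no; apply/flattenP; exists (nth [::] ls k) => //.
by apply: mem_nth; rewrite ltnNge; apply: contraTN ak => h; rewrite nth_default.
Qed.

Lemma filter_flatten (ht : E -> nat) ls o k :
  (forall j a, a \in nth [::] ls j -> ht a = (o + j).+1) ->
  [seq a <- flatten ls | ht a == (o + k).+1] = nth [::] ls k /\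
  [seq a <- flatten ls | (ht a < (o + k).+1)%N] = flatten (take k ls).
Proof.
elim: ls o k => [|l ls IH] o k h; first by rewrite /= nth_nil.
have hl a : a \in l -> ht a = o.+1 by move=> al; rewrite (h 0%N) ?addn0.
have hls j a : a \in nth [::] ls j -> ht a = (o.+1 + j).+1.
  by move=> aj; rewrite (h j.+1) // addnS.
have gt a : a \in flatten ls -> (o.+1 < ht a)%N.
  by case/flattenP => l' /(nthP [::]) [j _ <-] /hls ->; rewrite addSn !ltnS leq_addr.
rewrite /= !filter_cat; case: k => [|k] /=.
  rewrite addn0; split.
    rewrite (_ : [seq a <- flatten ls | _] = [::]) ?cats0.
      by rewrite -[RHS]filter_predT; apply: eq_in_filter => a /hl ->; rewrite eqxx.
    rewrite -(filter_pred0 (flatten ls)); apply: eq_in_filter => a /gt lt /=.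
    by apply/negbTE; rewrite neq_ltn lt orbT.
  rewrite -!(filter_pred0 (l ++ flatten ls)) filter_cat; congr (_ ++ _).
    by apply: eq_in_filter => a /hl ->; rewrite ltnn.
  by apply: eq_in_filter => a /gt lt /=; apply/negbTE; rewrite -leqNgt ltnW.
have [e1 e2] := IH o.+1 k hls; rewrite -!addSnnS e1 e2; split.
  rewrite (_ : [seq a <- l | _] = [::]) //.
  rewrite -(filter_pred0 l); apply: eq_in_filter => a /hl -> /=.
  by apply/negbTE; rewrite neq_ltn addSn !ltnS leq_addr.
congr (_ ++ _); rewrite -[RHS]filter_predT; apply: eq_in_filter => a /hl ->.
by rewrite addSn !ltnS leq_addr.
Qed.

Lemma mat_levelsP k A ls j : mat_levels k A ls -> (j < size ls)%N ->
  [/\ free (nth [::] ls j),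
      forall a, a \in A ++ flatten (take j ls) -> a \notin <<nth [::] ls j>>%VS
    & forall b, b \in nth [::] ls j -> size (A ++ flatten (take j ls)) =
        (k + j + size (undup [seq plane b a | a <- A ++ flatten (take j ls)]))%N].
Proof.
elim: ls k A j => // l ls IH k A [|j] /and4P [fl /allP nsp /allP cnt rec] /= lt.
  rewrite cats0 addn0; split=> // b /cnt /eqP //.
by rewrite -addSnnS catA; apply: IH.
Qed.

Lemma mat_free_levels ls : noncollinear (flatten ls) -> mat_levels 0 [::] ls ->
  mat_free (flatten ls) (level_ht ls).
Proof.
move=> nc ml; have u := noncollinear_uniq nc; set ht := level_ht ls.
have hj j a : a \in nth [::] ls j -> ht a = (0 + j).+1 by apply: level_htE.
have lE k := (filter_flatten k hj).1; have bE k := (filter_flatten k hj).2.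
have level0 : level (flatten ls) ht 0 = [::].
  by rewrite -(filter_pred0 (flatten ls)); apply: eq_in_filter.
have ex a : a \in flatten ls -> exists2 j, (j < size ls)%N & a \in nth [::] ls j.
  by case/flattenP => l /(nthP [::]) [j lt <-] al; exists j.
split=> //.
- case=> [|k]; first by rewrite level0 nil_free.
  rewrite /level (lE k); have [lt|ge] := ltnP k (size ls).
    by have [] := mat_levelsP ml lt.
  by rewrite nth_default // nil_free.
- case=> // k a as_ lt; rewrite /level (lE k); have [kl|ge] := ltnP k (size ls).
    have [_ h _] := mat_levelsP ml kl; apply: h.
    by rewrite /= -(bE k) mem_filter add0n lt.
  by rewrite nth_default // span_nil memv0 (noncollinear_neq0 nc).
move=> a /ex [j lt aj]; have [_ _ h] := mat_levelsP ml lt.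
by rewrite (hj j) // /below (bE j) add0n (h a aj).
Qed.

Lemma mem_level1 ls a : uniq (flatten ls) -> (0 < size ls)%N ->
  (a \in level (flatten ls) (level_ht ls) 1) = (a \in head [::] ls).
Proof.
move=> u; case: ls u => // l ls u _; have hj := fun j a => @level_htE _ j a u.
by have [e _] := @filter_flatten (level_ht (l :: ls)) (l :: ls) 0 0 hj; rewrite /level e.
Qed.

End Levels.

Section RankTwoLevels.
Variables (K : fieldType) (E : vectType K).

(** All forms lie in [P], so the lower ones define a single plane through the new form [c], and the
    count reads [size A = k + 1]: each further form needs a level of its own. *)
Lemma mat_levels_pencil (P : {vspace E}) (A l : seq E) k : (\dim P <= 2)%N ->
  (1 < size A)%N -> size A = k.+1 -> noncollinear (A ++ l) -> {subset A ++ l <= P} ->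
  mat_levels k A [seq [:: c] | c <- l].
Proof.
move=> dP; elim: l A k => //= c l IH A k A1 sA nc sub.
have cA : c \in A ++ c :: l by rewrite mem_cat mem_head orbT.
have uA := noncollinear_uniq nc.
have cb b : b \in A -> b \notin <[c]>%VS.
  move=> bA; apply: (noncollinear_notin nc) => //; first by rewrite mem_cat bA.
  apply: contraTneq bA => <-; move: uA; rewrite cat_uniq => /and3P [_ /hasPn h _].
  by apply: h; rewrite mem_head.
have planeE b : b \in A -> plane c b = P.
  move=> bA; apply/eqP; rewrite eqEdim; apply/andP; split.
    rewrite /plane subv_add -!memvE !sub //; by rewrite mem_cat bA.
  apply: leq_trans dP _; have : free [:: b; c].
    by rewrite free_cons span_seq1 cb // seq1_free (noncollinear_neq0 nc cA).
  rewrite /free => /eqP /= <-; rewrite span_cons span_seq1 addvC; exact: leqnn.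
apply/and4P; split.
- by rewrite seq1_free (noncollinear_neq0 nc cA).
- by apply/allP => b bA; rewrite span_seq1 cb.
- rewrite /= andbT sA -[X in X == _]addn1 eqn_add2l eq_sym; apply/eqP.
  have -> : [seq plane c a | a <- A] = nseq (size A) P.
    rewrite -(size_map (plane c) A); apply/all_pred1P/allP => _ /mapP [b bA ->] /=.
    by rewrite planeE.
  case: (size A) A1 => // q _; elim: q => // q IHq.
  by rewrite -[RHS]IHq /= in_cons eqxx.
have e : (A ++ [:: c]) ++ l = A ++ c :: l by rewrite -catA.
by apply: IH; rewrite ?e // size_cat /= addn1 ?sA // -sA ltnS ltnW.
Qed.

Lemma mat_free_pencil (P : {vspace E}) a b l : (\dim P <= 2)%N ->
  noncollinear [:: a, b & l] -> {subset [:: a, b & l] <= P} ->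
  let ls := [:: a; b] :: [seq [:: c] | c <- l] in
  flatten ls = [:: a, b & l] /\ mat_free (flatten ls) (level_ht ls).
Proof.
move=> dP nc sub ls; have e : flatten ls = [:: a, b & l].
  by rewrite /= flatten_seq1.
split=> //; apply: mat_free_levels; first by rewrite e.
have := nc; rewrite noncollinear_cons /= => /and3P [a0 /andP [ba _] nc'].
have b0 := noncollinear_neq0 nc' (mem_head b l).
rewrite /= free_cons span_seq1 seq1_free b0 andbT.
rewrite (mat_levels_pencil dP) // andbT; apply: contra ba => /vlineP [k e1].
have k0 : k != 0 by apply: contraNneq a0 => k0; rewrite e1 k0 scale0r.
by apply/vlineP; exists k^-1; rewrite e1 scalerA mulVf // scale1r.
Qed.

End RankTwoLevels.

(** * The golden root systems *)

(* (a, b) stands for a + b phi, where phi is the golden ratio. *)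
Definition zphi : Type := (BinNums.Z * BinNums.Z)%type.
Definition z0 : zphi := (0, 0).
Definition zsub (x y : zphi) : zphi := (x.1 - y.1, x.2 - y.2).
Definition zmul (x y : zphi) : zphi :=
  (x.1 * y.1 + x.2 * y.2, x.1 * y.2 + x.2 * y.1 + x.2 * y.2).

Section Check.
Variable N : nat.
Implicit Types (a b v : seq zphi) (l A : seq (seq zphi)).

Definition zelim p a b : seq zphi :=
  mkseq (fun i => zsub (zmul (nth z0 a p) (nth z0 b i)) (zmul (nth z0 b p) (nth z0 a i))) N.

Definition pivot a : nat := find (fun i => nth z0 a i != z0) (iota 0 N).

(** Gaussian elimination without division. The fuel [k] bounds the length of the list, whose tail is
    not a structural subterm after elimination. *)
Fixpoint zfree (k : nat) l : bool :=
  match k, l with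
  | _, [::] => true
  | 0, _ => false
  | k'.+1, a :: t => let p := pivot a in (p < N)%N && zfree k' [seq zelim p a b | b <- t]
  end.

(* The number of planes spanned by b and a member of A. *)
Fixpoint zclasses b A : nat :=
  if A is c :: A' then
    (~~ has (fun d => ~~ zfree 3 [:: c; d; b]) A' + zclasses b A')%N else 0.

Fixpoint zmat_levels k A (ls : seq (seq (seq zphi))) : bool :=
  if ls is l :: ls' then
    [&& zfree N l, all (fun a => zfree N.+1 (a :: l)) A,
        all (fun b => size A == k + zclasses b A)%N l
      & zmat_levels k.+1 (A ++ l) ls']
  else true.

Fixpoint znoncollinear l : bool :=
  if l is a :: t then
    [&& zfree 1 [:: a], all (fun b => zfree 2 [:: b; a]) t & znoncollinear t]
  else true.

Definition zunit i : seq zphi := mkseq (fun j => if j == i then (1, 0) else z0) N.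

(** The numbers 2 cos (pi / m) for a path of nodes 0, 1, 2, ... whose first edge has the label 5 and
    the others the label 3. *)
Definition zlabel i j : zphi :=
  if ((i == 0) && (j == 1) || (i == 1) && (j == 0))%N then (0, 1)
  else if ((i == j.+1) || (j == i.+1))%N then (1, 0) else z0.

(** A simple reflection in simple root coordinates: coordinate [i] becomes the weighted sum of its
    neighbours minus itself. Addition is written as a double subtraction. *)
Definition zrefl i v : seq zphi :=
  mkseq (fun j => if j == i then
     zsub (foldr (fun k acc => zsub acc (zsub z0 (zmul (zlabel i k) (nth z0 v k)))) z0 (iota 0 N))
       (nth z0 v i) else nth z0 v j) N.

(** The unit vector is excepted because its own reflection sends it to its opposite, on the same
    line. *)
Definition zclosed l : bool :=
  all (fun v => all (fun i => (v == zunit i) || (zrefl i v \in l)) (iota 0 N)) l.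

(* The members of l obtained from unit vectors by at most k reflections in l. *)
Fixpoint zgen (k : nat) l : seq (seq zphi) :=
  if k is k'.+1 then let cur := zgen k' l in
    [seq v <- l | has (fun i => (v == zunit i) || (zrefl i v \in cur)) (iota 0 N)]
  else [::].

Definition zcheck k (ls : seq (seq (seq zphi))) : bool :=
  [&& head [::] ls == [seq zunit i | i <- iota 0 N],
      znoncollinear (flatten ls), zmat_levels 0 [::] ls, zclosed (flatten ls)
    & zgen k (flatten ls) == flatten ls].

End Check.

(* The positive roots of H3 and H4 in the basis of simple roots, arranged by a
   computer search in levels that satisfy [mat_free]. *)
Definition h3_levels : seq (seq (seq zphi)) :=
  [:: [:: [:: (1,0); (0,0); (0,0)]; [:: (0,0); (1,0); (0,0)]; [:: (0,0); (0,0); (1,0)]];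
  [:: [:: (0,1); (1,0); (0,0)]; [:: (0,0); (1,0); (1,0)]];
  [:: [:: (0,1); (0,1); (0,0)]; [:: (0,1); (1,0); (1,0)]];
  [:: [:: (1,0); (0,1); (0,0)]; [:: (0,1); (0,1); (0,1)]];
  [:: [:: (1,0); (0,1); (0,1)]; [:: (1,1); (1,1); (1,0)]];
  [:: [:: (0,1); (1,1); (1,0)]];
  [:: [:: (1,1); (1,1); (0,1)]];
  [:: [:: (0,1); (1,1); (0,1)]];
  [:: [:: (1,1); (0,2); (0,1)]]].

Definition h4_levels : seq (seq (seq zphi)) :=
  [:: [:: [:: (1,0); (0,0); (0,0); (0,0)]; [:: (0,0); (1,0); (0,0); (0,0)]; [:: (0,0); (0,0); (1,0); (0,0)]; [:: (0,0); (0,0); (0,0); (1,0)]];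
  [:: [:: (1,0); (0,1); (0,0); (0,0)]; [:: (0,0); (1,0); (1,0); (0,0)]; [:: (0,0); (0,0); (1,0); (1,0)]];
  [:: [:: (0,1); (1,0); (0,0); (0,0)]; [:: (1,0); (0,1); (0,1); (0,0)]; [:: (0,0); (1,0); (1,0); (1,0)]];
  [:: [:: (0,1); (0,1); (0,0); (0,0)]; [:: (1,0); (0,1); (0,1); (0,1)]; [:: (0,1); (1,1); (0,1); (0,0)]];
  [:: [:: (0,1); (0,1); (0,1); (0,0)]; [:: (0,1); (1,1); (1,0); (0,0)]; [:: (0,1); (1,1); (0,1); (0,1)]];
  [:: [:: (0,1); (1,0); (1,0); (0,0)]; [:: (0,1); (0,1); (0,1); (0,1)]; [:: (0,1); (1,1); (1,0); (1,0)]];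
  [:: [:: (0,1); (1,0); (1,0); (1,0)]; [:: (1,1); (1,1); (1,0); (0,0)]; [:: (0,1); (1,1); (1,1); (0,1)]];
  [:: [:: (1,1); (1,1); (0,1); (0,0)]; [:: (1,1); (1,1); (1,0); (1,0)]; [:: (0,1); (1,1); (1,1); (1,0)]];
  [:: [:: (1,1); (0,2); (0,1); (0,0)]; [:: (1,1); (1,1); (0,1); (0,1)]; [:: (1,1); (1,1); (1,1); (1,0)]];
  [:: [:: (1,1); (0,2); (0,1); (0,1)]; [:: (1,1); (1,1); (1,1); (0,1)]; [:: (1,1); (1,2); (1,1); (1,0)]];
  [:: [:: (1,1); (0,2); (0,2); (0,1)]; [:: (1,1); (1,2); (1,1); (0,1)]; [:: (1,2); (1,2); (1,1); (1,0)]];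
  [:: [:: (1,1); (1,2); (0,2); (0,1)]; [:: (1,2); (2,2); (1,1); (0,1)]];
  [:: [:: (1,2); (2,2); (1,1); (1,0)]; [:: (1,2); (1,3); (1,2); (1,1)]];
  [:: [:: (1,2); (1,2); (1,1); (0,1)]; [:: (1,2); (1,3); (0,2); (0,1)]];
  [:: [:: (1,2); (2,2); (2,1); (1,1)]; [:: (1,2); (1,3); (1,2); (0,1)]];
  [:: [:: (1,2); (2,2); (2,1); (1,0)]; [:: (2,2); (2,3); (1,2); (1,1)]];
  [:: [:: (1,2); (2,2); (1,2); (1,1)]; [:: (2,2); (2,3); (1,2); (0,1)]];
  [:: [:: (1,2); (2,2); (1,2); (0,1)]; [:: (2,2); (1,3); (0,2); (0,1)]];
  [:: [:: (1,2); (1,2); (0,2); (0,1)]; [:: (1,3); (3,3); (2,2); (1,1)]];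
  [:: [:: (2,3); (2,4); (1,3); (0,2)]];
  [:: [:: (2,3); (3,3); (2,2); (1,1)]];
  [:: [:: (2,3); (2,4); (1,3); (1,1)]];
  [:: [:: (2,2); (2,3); (2,2); (1,1)]];
  [:: [:: (2,2); (1,3); (1,2); (1,1)]];
  [:: [:: (1,3); (2,3); (1,2); (1,1)]];
  [:: [:: (1,3); (2,3); (1,2); (0,1)]];
  [:: [:: (1,3); (2,3); (2,2); (1,1)]];
  [:: [:: (2,2); (1,3); (1,2); (0,1)]];
  [:: [:: (2,3); (2,4); (2,2); (1,1)]]].

Lemma h3_check : zcheck 3 20 h3_levels.
Proof. by vm_compute. Qed.

Lemma h4_check : zcheck 4 40 h4_levels.
Proof. by vm_compute. Qed.

(* As 5 b ^ 2 = (2 a + b) ^ 2 and 5 is not a square. *)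
Lemma golden_norm_eq0 (a b : int) : a ^+ 2 + a * b = b ^+ 2 -> b = 0.
Proof.
move=> e; have : (2 * a + b) ^+ 2 = 5 * b ^+ 2.
  have e1 : (2 * a + b) ^+ 2 = 4 * (a ^+ 2 + a * b) + b ^+ 2 by ring.
  by rewrite e1 e; ring.
move/(congr1 absz); rewrite abszM !abszX => {}e.
apply/eqP; rewrite -absz_eq0; apply: contraT; rewrite -lt0n => b0.
have x0 : (0 < `|(2 * a + b)%R|)%N by rewrite lt0n; apply/eqP => x0; move: e; rewrite x0; nia.
move: (congr1 (logn 5) e); rewrite lognX lognM ?expn_gt0 ?b0 // lognX.
by rewrite (_ : logn 5 `|5%R : int| = 1%N) //; lia.
Qed.

Section Golden.
Variables (R : numFieldType) (phi : R).
Hypothesis phi2 : phi ^+ 2 = phi + 1.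

Definition zev (x : zphi) : R :=
  (int_of_Z x.1)%:~R + (int_of_Z x.2)%:~R * phi.

Lemma zev0 : zev z0 = 0.
Proof. by rewrite /zev /= mul0r addr0. Qed.

Lemma zevB x y : zev (zsub x y) = zev x - zev y.
Proof. by rewrite /zev /= !rmorphB /=; ring. Qed.

Lemma zevM x y : zev (zmul x y) = zev x * zev y.
Proof.
have key (a b c d : R) : a * c + b * d + (a * d + b * c + b * d) * phi =
    (a + b * phi) * (c + d * phi).
  apply/eqP; rewrite -subr_eq0; apply/eqP.
  rewrite [X in X = _](_ : _ = - b * d * (phi ^+ 2 - (phi + 1))); last by ring.
  by rewrite phi2 subrr mulr0.
by rewrite /zev /= !rmorphD !rmorphM /= key.
Qed.

(** A zero a + b phi gives a = - b phi, hence a^2 + a b = b^2, and [golden_norm_eq0] applies. So the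
    tests on integer pairs are exact over the reals. *)
Lemma zev_eq0 x : (zev x == 0) = (x == z0).
Proof.
apply/eqP/eqP => [|->]; last exact: zev0.
case: x => x y; rewrite /zev /= => e.
have e2 : (int_of_Z x) ^+ 2 + int_of_Z x * int_of_Z y = (int_of_Z y) ^+ 2.
  apply: (@intr_inj R); rewrite rmorphD !rmorphXn rmorphM /=.
  move: e; set a := (int_of_Z x)%:~R; set b := (int_of_Z y)%:~R => e.
  have -> : a = - (b * phi) by apply/eqP; rewrite -addr_eq0 e.
  apply/eqP; rewrite -subr_eq0; apply/eqP.
  rewrite [X in X = _](_ : _ = b ^+ 2 * (phi ^+ 2 - (phi + 1))); last by ring.
  by rewrite phi2 subrr mulr0.
have y0 := golden_norm_eq0 e2; rewrite y0 mulr0 addr0 expr0n in e2.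
have x0 : int_of_Z x = 0 by apply/eqP; rewrite -sqrf_eq0 e2.
by rewrite -[x]int_of_ZK -[y]int_of_ZK x0 y0.
Qed.

Variable N : nat.
Notation E := 'rV[R]_N.

Definition zvec v : E := \row_i zev (nth z0 v i).

Definition eliminate (p : 'I_N) (a : E) (b : E) : E := a 0 p *: b - b 0 p *: a.

Lemma eliminate_is_linear (p : 'I_N) (a : E) : linear (eliminate p a).
Proof.
by move=> c x y; apply/rowP => j; rewrite /eliminate !mxE; ring.
Qed.

Lemma zelimE (p : 'I_N) (a b : seq zphi) : zvec (zelim N p a b) = eliminate p (zvec a) (zvec b).
Proof.
apply/rowP => i; rewrite !mxE nth_mkseq ?ltn_ord // zevB !zevM.
by rewrite [zev (nth z0 b p) * _]mulrC.
Qed.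

(** The kernel of [eliminate p a] is the line of [a], so the dimension of the span of [t] drops by
    one exactly when it contains [a]. *)
Lemma free_eliminate (p : 'I_N) (a : E) (t : seq E) : a 0 p != 0 ->
  free (a :: t) = free [seq eliminate p a b | b <- t].
Proof.
move=> ap; pose M := GRing.isLinear.Build _ _ _ _ (eliminate p a) (eliminate_is_linear p a).
pose fE : {linear E -> E} := HB.pack (eliminate p a) M.
pose f := linfun fE.
have fEE b : f b = eliminate p a b by rewrite lfunE.
have ker : (lker f = <[a]>)%VS.
  apply/vspaceP => b; rewrite memv_ker fEE; apply/eqP/vlineP => [e|[k ->]].
    exists (b 0 p / a 0 p); apply: (scalerI ap); rewrite scalerA mulrCA divff // mulr1.
    by apply/eqP; rewrite -subr_eq0; apply/eqP; exact: e.
  by apply/rowP => j; rewrite /eliminate !mxE; ring.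
have mapE : [seq eliminate p a b | b <- t] = map f t by apply: eq_map => b; rewrite fEE.
have a0 : a != 0 by apply: contraNneq ap => ->; rewrite mxE.
have dimE := limg_ker_dim f <<t>>; rewrite ker in dimE.
rewrite mapE free_cons /free size_map -limg_span.
have [at_|at_] /= := boolP (a \in <<t>>%VS).
  have c1 : (\dim (<<t>> :&: <[a]>) = 1)%N.
    by rewrite (capv_idPr _) ?dim_vline ?a0 // -memvE.
  apply/esym/negbTE; rewrite neq_ltn.
  apply/orP; left; apply: leq_trans (dim_span t); rewrite -dimE c1.
  by rewrite add1n.
suff c0 : (\dim (<<t>> :&: <[a]>) = 0)%N by rewrite -dimE c0 add0n.
apply/eqP; rewrite dimv_eq0 -subv0; apply/subvP => x.
rewrite memv_cap => /andP [xt /vlineP [k ek]]; move: xt; rewrite ek rpredZeq.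
by rewrite (negbTE at_) orbF => /eqP ->; rewrite scale0r mem0v.
Qed.

Lemma zfreeP k l : (size l <= k)%N -> zfree N k l = free [seq zvec a | a <- l].
Proof.
elim: k l => [|k IH] [|a t] //= st; rewrite ?nil_free //.
have [lt|ge] /= := ltnP (pivot N a) N; last first.
  rewrite free_cons (_ : zvec a = 0) ?mem0v //; apply/rowP => i; rewrite !mxE.
  apply/eqP; rewrite zev_eq0; apply: contraLR ge => ai; rewrite -ltnNge.
  have : has (fun i => nth z0 a i != z0) (iota 0 N).
    by apply/hasP; exists (val i); rewrite // mem_iota ltn_ord.
  by rewrite has_find size_iota.
rewrite (free_eliminate (p := Ordinal lt)); last first.
  rewrite mxE zev_eq0 /=.
  have : has (fun i => nth z0 a i != z0) (iota 0 N) by rewrite has_find size_iota.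
  by move/(nth_find 0%N); rewrite nth_iota.
rewrite IH ?size_map // -!map_comp; congr free; apply: eq_map => b /=.
exact: (zelimE (Ordinal lt)).
Qed.

Lemma zclassesP b A : all (fun c => zfree N 2 [:: c; b]) A ->
  zclasses N b A = size (undup [seq plane (zvec b) (zvec c) | c <- A]).
Proof.
elim: A => //= c A IH /andP [cb Ab]; rewrite IH //.
have memE d : zfree N 2 [:: d; b] -> zvec d \notin <[zvec b]>%VS.
  by rewrite zfreeP //= free_cons span_seq1 => /andP [].
suff -> : has (fun d => ~~ zfree N 3 [:: c; d; b]) A =
    (plane (zvec b) (zvec c) \in [seq plane (zvec b) (zvec d) | d <- A]).
  by case: (_ \in _).
have key d : d \in A -> ~~ zfree N 3 [:: c; d; b] = (zvec c \in plane (zvec b) (zvec d)).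
  move=> dA; have db : free [:: zvec d; zvec b].
    by have : zfree N 2 [:: d; b] := allP Ab _ dA; rewrite zfreeP.
  by rewrite zfreeP //= free_cons db andbT span_cons span_seq1 addvC negbK.
rewrite (eq_in_has key).
apply/hasP/mapP => [[d dA h]|[d dA e]]; exists d => //.
  by apply: plane_eq => //; apply: memE.
by rewrite -e mem_planer.
Qed.

Lemma znoncollinearP l : znoncollinear N l -> noncollinear [seq zvec a | a <- l].
Proof.
elim: l => // a t IH; rewrite -[znoncollinear N _]/([&& zfree N 1 [:: a],
  all (fun b => zfree N 2 [:: b; a]) t & znoncollinear N t]).
case/and3P => a0 /allP h nc; rewrite noncollinear_cons IH // andbT.
move: a0; rewrite zfreeP // seq1_free => -> /=.
apply/allP => _ /mapP [b bt ->]; have : zfree N 2 [:: b; a] := h b bt.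
by rewrite zfreeP //= free_cons span_seq1 => /andP [].
Qed.

Lemma zfree_size k l : zfree N k l -> (size l <= k)%N.
Proof. by elim: k l => [|k IH] [|a t] //= /andP [_ /IH]; rewrite size_map. Qed.

Lemma zmat_levelsP k A ls : znoncollinear N (A ++ flatten ls) -> zmat_levels N k A ls ->
  mat_levels k [seq zvec a | a <- A] [seq [seq zvec a | a <- l] | l <- ls].
Proof.
elim: ls k A => //= l ls IH k A nc /and4P [fl /allP sp /allP cnt rec].
have sl := zfree_size fl.
have fl' : free [seq zvec a | a <- l] by rewrite -(zfreeP sl).
rewrite fl' /=; apply/and3P; split.
- apply/allP => _ /mapP [a aA ->]; have : zfree N N.+1 (a :: l) := sp a aA.
  by rewrite zfreeP //= free_cons => /andP [].
- apply/allP => _ /mapP [b bl ->]; rewrite size_map (eqP (cnt b bl)) zclassesP -?map_comp //.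
  apply/allP => c cA; have /znoncollinearP nc' := nc.
  rewrite zfreeP //= free_cons span_seq1 seq1_free.
  have bz : zvec b \in [seq zvec a | a <- A ++ l ++ flatten ls].
    by rewrite map_f // !mem_cat bl orbT.
  rewrite (noncollinear_neq0 nc' bz) andbT.
  apply: (noncollinear_notin nc') => //; first by rewrite map_f // mem_cat cA.
  move: (noncollinear_uniq nc'); rewrite map_cat cat_uniq => /and3P [_ /hasPn h _].
  have := h (zvec b); rewrite map_f ?mem_cat ?bl // => /(_ isT).
  by apply: contraNneq => ->; apply: (map_f zvec cA).
by rewrite -map_cat; apply: IH; rewrite // -catA.
Qed.

Definition glabel (i j : 'I_N) : R := zev (zlabel i j).

Definition grefl (i : 'I_N) (x : E) : E :=
  x - (2 * x 0 i - \sum_j glabel i j * x 0 j) *: delta_mx 0 i.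

Lemma zunitE (i : 'I_N) : zvec (zunit N i) = delta_mx 0 i.
Proof.
apply/rowP => j; rewrite !mxE nth_mkseq // eqxx /= -val_eqE.
by case: eqP; rewrite /zev /= ?mul0r ?addr0.
Qed.

Lemma zreflE (i : 'I_N) v : zvec (zrefl N i v) = grefl i (zvec v).
Proof.
apply/rowP => j; rewrite !mxE nth_mkseq // eqxx /= -val_eqE.
case: eqP => [e|_]; last by rewrite mulr0 subr0.
rewrite zevB mulr1 -(val_inj e).
have -> : zev (foldr (fun k acc => zsub acc (zsub z0 (zmul (zlabel j k) (nth z0 v k))))
    z0 (iota 0 N)) = \sum_k glabel j k * zvec v 0 k.
  rewrite (eq_bigr (fun k : 'I_N => zev (zlabel j k) * zev (nth z0 v k))); last first.
    by move=> k _; rewrite mxE.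
  rewrite -(big_mkord xpredT (fun k => zev (zlabel j k) * zev (nth z0 v k))).
  rewrite /index_iota subn0; elim: (iota 0 N) => [|k s IH] /=; first by rewrite big_nil zev0.
  by rewrite big_cons zevB zevB zevM zev0 IH sub0r opprK addrC.
by ring.
Qed.

(** The last clause is an induction along the reflections that lead from a root to a unit vector; it
    serves to show that every listed root is conjugate to a simple one. *)
Lemma zcheckP k ls : zcheck N k ls ->
  exists vs : seq (seq E),
    [/\ mat_free (flatten vs) (level_ht vs),
        forall i, delta_mx 0 i \in level (flatten vs) (level_ht vs) 1,
        forall v i, v \in flatten vs -> v = delta_mx 0 i \/ grefl i v \in flatten vs
      & forall P : E -> Prop, (forall i, P (delta_mx 0 i)) ->
          (forall i v, P (grefl i v) -> P v) -> forall v, v \in flatten vs -> P v].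
Proof.
case/and5P => /eqP hd nc ml cl /eqP gen.
exists [seq [seq zvec a | a <- l] | l <- ls]; rewrite -map_flatten.
have nc' := znoncollinearP nc; have ml' := zmat_levelsP (A := [::]) nc ml.
split.
- by have := @mat_free_levels _ _ [seq [seq zvec a | a <- l] | l <- ls]; rewrite -map_flatten; apply.
- move=> i; rewrite -[flatten ls]map_id map_id.
  have := @mem_level1 _ _ [seq [seq zvec a | a <- l] | l <- ls] (delta_mx 0 i).
  rewrite -map_flatten => -> //; last first.
  + case: (ls) hd => //= hd; have : (0 < size [seq zunit N i | i <- iota 0 N])%N.
      by rewrite size_map size_iota; apply: leq_ltn_trans (ltn_ord i).
    by rewrite -hd.
  + exact: noncollinear_uniq.
  have -> : head [::] [seq [seq zvec a | a <- l] | l <- ls] = [seq zvec a | a <- head [::] ls].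
    by case: (ls).
  by rewrite hd -zunitE map_f // (map_f (zunit N)) // mem_iota ltn_ord.
- move=> _ i /mapP [v vl ->].
  have := allP (allP cl v vl) (val i); rewrite mem_iota ltn_ord => /(_ isT).
  case/orP => [/eqP ->|h]; first by left; rewrite zunitE.
  by right; rewrite -zreflE map_f.
move=> P P1 P2 _ /mapP [v vl ->]; move: vl; rewrite -gen.
elim: k v {gen} => //= k IH v; rewrite mem_filter => /andP [/hasP [i]].
rewrite mem_iota add0n => /andP [_ lt] /orP [/eqP ->|h] vl.
  by rewrite (zunitE (Ordinal lt)).
by apply: (P2 (Ordinal lt)); rewrite -zreflE; apply: IH.
Qed.

End Golden.

(** * The invariant form and the reflections of a Coxeter group *)

Section CoxeterGeometry.
Variables (R : realType) (n : nat) (W : finGroupType) (m : 'M[nat]_n)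
  (s : 'I_n -> W) (rho : mx_representation R [set: W] n).
Hypotheses (cs : coxeter_system m s) (rr : reflection_representation m s rho).
Notation C := (coxeter_form R m).
Notation E := 'rV[R]_n.

Definition unit_row (i : 'I_n) : E := delta_mx 0 i.
Local Notation e := unit_row.

Definition cform (x y : E) : R := (x *m C *m y^T) 0 0.
Local Notation B := cform.

Lemma cformDl x y z : B (x + y) z = B x z + B y z.
Proof. by rewrite /cform !mulmxDl mxE. Qed.
Lemma cformDr x y z : B z (x + y) = B z x + B z y.
Proof. by rewrite /cform linearD mulmxDr mxE. Qed.
Lemma cformZl c x y : B (c *: x) y = c * B x y.
Proof. by rewrite /cform -!scalemxAl mxE. Qed.
Lemma cformZr c x y : B y (c *: x) = c * B y x.
Proof. by rewrite /cform linearZ -scalemxAr mxE. Qed.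
Lemma cform_e i j : B (e i) (e j) = C i j.
Proof.
rewrite /cform /unit_row -rowE trmx_delta -colE !mxE; congr (- cos (_ / _)).
Qed.
Lemma cform_er x i : B x (e i) = (x *m col i C) 0 0.
Proof. by rewrite /cform /unit_row trmx_delta -mulmxA -colE. Qed.

Lemma row_e (x : E) : x = \sum_i x 0 i *: e i.
Proof. exact: row_sum_delta. Qed.

Lemma cform_suml (I : finType) (F : I -> E) y : B (\sum_i F i) y = \sum_i B (F i) y.
Proof. by rewrite /cform !mulmx_suml summxE. Qed.
Lemma cform_sumr (I : finType) (F : I -> E) y : B y (\sum_i F i) = \sum_i B y (F i).
Proof. by rewrite /cform linear_sum mulmx_sumr summxE. Qed.

Lemma cform_ii i : B (e i) (e i) = 1.
Proof.
rewrite cform_e mxE; case: cs => [[-> _] _ _ _].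
by rewrite divr1 cospi opprK.
Qed.

Lemma cox_sym i j : C i j = C j i.
Proof.
rewrite !mxE; have [->//|ij] := eqVneq i j.
by case: cs => [[_ h] _ _ _]; have [-> _] := h i j ij.
Qed.

Lemma cformC x y : B x y = B y x.
Proof.
rewrite [x]row_e [y]row_e !cform_suml; under eq_bigr do rewrite cform_sumr.
rewrite exchange_big [RHS]/=; apply: eq_bigr => i _; rewrite cform_sumr.
by apply: eq_bigr => j _; rewrite !cformZl !cformZr !cform_e cox_sym; ring.
Qed.

Lemma act1 (x : E) : x *m rho 1%g = x.
Proof. by rewrite repr_mx1 mulmx1. Qed.
Lemma actM (x : E) u v : x *m rho (u * v)%g = x *m rho u *m rho v.
Proof. by rewrite repr_mxM ?inE // mulmxA. Qed.
Lemma actK w (x : E) : x *m rho w *m rho w^-1%g = x.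
Proof. by rewrite -actM mulgV act1. Qed.
Lemma actVK w (x : E) : x *m rho w^-1%g *m rho w = x.
Proof. by rewrite -actM mulVg act1. Qed.

Lemma act_s x i : x *m rho (s i) = x - (2 * B x (e i)) *: e i.
Proof.
rewrite rr /simple_reflection mulmxBr mulmx1 -scalemxAr mulmxA; congr (_ - _).
by rewrite [x *m _]mx11_scalar -cform_er mul_scalar_mx scalerA.
Qed.

Lemma cox_ind (P : W -> Prop) : P 1%g -> (forall i w, P w -> P (w * s i)%g) ->
  forall w, P w.
Proof.
move=> P1 PM w; have : w \in <<[set s i | i : 'I_n]>>%g by case: cs => _ _ -> _; rewrite inE.
case/gen_prodgP => k [c hc ->]; elim: k c hc => [|k IH] c hc; first by rewrite big_ord0.
rewrite big_ord_recr /=; have /imsetP [i _ ->] := hc ord_max.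
by apply: PM; apply: IH => j; apply: hc.
Qed.

Lemma cform_s x y i : B (x *m rho (s i)) (y *m rho (s i)) = B x y.
Proof.
rewrite !act_s -!scaleNr !(cformDl, cformDr, cformZl, cformZr) cform_ii.
by rewrite (cformC (e i) y); ring.
Qed.

Lemma cform_act w x y : B (x *m rho w) (y *m rho w) = B x y.
Proof.
elim/cox_ind: w x y => [|i w IH] x y; first by rewrite !act1.
by rewrite !actM cform_s IH.
Qed.

(* An invariant inner product; as each simple root is orthogonal to its mirror,
   avg x (e i) is proportional to B x (e i), whence B is positive definite. *)
Definition avg (x y : E) : R := \sum_w ((x *m rho w) *m (y *m rho w)^T) 0 0.

Lemma avgDl x y z : avg (x + y) z = avg x z + avg y z.
Proof. by rewrite -big_split; apply: eq_bigr => w _; rewrite !mulmxDl mxE. Qed.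
Lemma avgZl c x y : avg (c *: x) y = c * avg x y.
Proof. by rewrite mulr_sumr; apply: eq_bigr => w _; rewrite -!scalemxAl mxE. Qed.
Lemma avgC x y : avg x y = avg y x.
Proof.
apply: eq_bigr => w _; rewrite !mxE; apply: eq_bigr => j _.
by rewrite ![_^T _ _]mxE mulrC.
Qed.
Lemma avgZr c x y : avg y (c *: x) = c * avg y x.
Proof. by rewrite avgC avgZl (avgC y). Qed.
Lemma avg_suml (I : finType) (F : I -> E) y : avg (\sum_i F i) y = \sum_i avg (F i) y.
Proof.
elim/big_rec2: _ => [|i a b _ <-]; last by rewrite avgDl.
by rewrite -(scale0r 0) avgZl mul0r.
Qed.
Lemma avg_act w x y : avg (x *m rho w) (y *m rho w) = avg x y.
Proof.
rewrite /avg [RHS](reindex_inj (mulgI w)); apply: eq_bigr => u _.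
by rewrite !actM.
Qed.
Lemma row_sqr_ge0 (x : E) : 0 <= (x *m x^T) 0 0.
Proof. by rewrite mxE sumr_ge0 // => i _; rewrite mxE -expr2 sqr_ge0. Qed.
Lemma row_sqr_gt0 (x : E) : x != 0 -> 0 < (x *m x^T) 0 0.
Proof.
move=> x0; rewrite lt_neqAle row_sqr_ge0 andbT eq_sym; apply: contra x0 => /eqP.
rewrite mxE => h; apply/eqP/rowP => i; rewrite mxE; apply/eqP.
have /psumr_eq0P : forall i, true -> 0 <= x 0 i * x^T i 0.
  by move=> j _; rewrite mxE -expr2 sqr_ge0.
by move=> /(_ h i isT); rewrite mxE => /eqP; rewrite mulf_eq0 orbb.
Qed.
Lemma avg_gt0 x : x != 0 -> 0 < avg x x.
Proof.
move=> x0; rewrite /avg (bigD1 1%g) //= act1 ltr_wpDr ?row_sqr_gt0 //.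
by apply: sumr_ge0 => w _; apply: row_sqr_ge0.
Qed.

Lemma e_neq0 i : e i != 0.
Proof.
apply/eqP => /rowP /(_ i); rewrite !mxE !eqxx => /eqP; by rewrite oner_eq0.
Qed.

Lemma avg_e x i : avg x (e i) = B x (e i) * avg (e i) (e i).
Proof.
have se : e i *m rho (s i) = - e i.
  by rewrite act_s cform_ii mulr1 scaler_nat mulr2n opprD addrA subrr sub0r.
have := avg_act (s i) x (e i); rewrite se act_s -scaleNr -[- e i]scaleN1r avgZr avgDl avgZl.
by move=> h; lra.
Qed.

Lemma cform_pos x : x != 0 -> 0 < B x x.
Proof.
pose Nm i := avg (e i) (e i); have Nm0 i : 0 < Nm i by apply/avg_gt0/e_neq0.
pose r i := Num.sqrt (Nm i); have r0 i : 0 < r i by rewrite sqrtr_gt0.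
move=> x0; pose y := \sum_i (x 0 i / r i) *: e i.
have -> : B x x = avg y y.
  rewrite {1 2}[x]row_e cform_suml avg_suml; apply: eq_bigr => i _.
  rewrite cform_sumr avgC avg_suml; apply: eq_bigr => j _.
  rewrite cformZl cformZr avgZl avgZr (avg_e (e j)) !cform_e -/(Nm i) (cox_sym i j).
  have [c0|c0] := eqVneq (C j i) 0; first by rewrite c0; ring.
  (* Both forms are symmetric, so [avg_e] read in the two orders gives equal norms to nodes joined
     by an edge. Rescaling by [r] therefore turns [B] into [avg]. *)
  have nij : Nm i = Nm j.
    have := avg_e (e j) i; rewrite avgC avg_e !cform_e cox_sym -/(Nm i) -/(Nm j).
    by move/(mulfI c0).
  have rij : r i = r j by rewrite /r nij.
  have e2 : r i ^+ 2 = Nm i by rewrite sqr_sqrtr // ltW.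
  by rewrite -rij -e2; field; rewrite gt_eqF.
apply: avg_gt0; apply: contra x0 => /eqP/rowP y0; apply/eqP/rowP => i.
have := y0 i; rewrite /y summxE (bigD1 i) //= big1 => [|j ji].
  rewrite !mxE !eqxx mulr1 addr0 => /eqP; rewrite mulf_eq0 invr_eq0 (gt_eqF (r0 i)) orbF.
  by move/eqP.
by rewrite !mxE eqxx [i == j]eq_sym (negbTE ji) mulr0.
Qed.

Lemma act_inj w (x : E) : (x *m rho w == 0) = (x == 0).
Proof.
apply/eqP/eqP => [h|->]; last by rewrite mul0mx.
by rewrite -[x](actK w) h mul0mx.
Qed.

End CoxeterGeometry.

Lemma hyp_is_hyperplane (K : fieldType) (V : vectType K) (a : 'cV[K]_(\dim {:V})) :
  a != 0 -> is_hyperplane (hyp a).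
Proof.
move=> a0; have [v av] := lform_neq0 a0.
have img : (limg (lform a) = <[1 : K^o]>)%VS.
  apply/vspaceP => x; apply/idP/idP => _; first by apply/vlineP; exists x; rewrite [_ *: _]mulr1.
  by apply/memv_imgP; exists ((x : K) *: v); rewrite ?memvf // linearZ /= av [_ *: _]mulr1.
have := limg_ker_dim (lform a) fullv; rewrite capfv img dim_vline oner_eq0 addn1.
by move=> h; apply/eqP.
Qed.

Section CoxeterHyperplanes.
Variables (R : realType) (n : nat) (W : finGroupType) (m : 'M[nat]_n)
  (s : 'I_n -> W) (rho : mx_representation R [set: W] n).
Hypotheses (cs : coxeter_system m s) (rr : reflection_representation m s rho).
Notation C := (coxeter_form R m).
Notation E := 'rV[R]_n.
Notation e := (@unit_row R n).
Notation B := (@cform R n m).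

Definition root_col (b : E) : 'cV[R]_(\dim {:E}) := \col_i B (vbasis {:E})`_i b.

Lemma root_col_is_linear : linear root_col.
Proof. by move=> c x y; apply/colP => i; rewrite !mxE cformDr cformZr. Qed.

HB.instance Definition _ := GRing.isLinear.Build R E 'cV[R]_(\dim {:E}) *:%R root_col
  root_col_is_linear.

Lemma lform_root_col b v : lform (root_col b) v = B v b.
Proof.
rewrite lformE {2}(coord_vbasis (memvf v)) cform_suml; apply: eq_bigr => i _.
by rewrite mxE cformZl.
Qed.

Lemma mem_hyp_root b v : (v \in hyp (root_col b)) = (B v b == 0).
Proof. by rewrite mem_hyp lform_root_col. Qed.

Lemma cform_eq0 x : (B x x == 0) = (x == 0).
Proof.
have [->|/(cform_pos cs rr) h] := eqVneq x 0; last by rewrite gt_eqF.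
by rewrite -(scale0r 0) cformZl mul0r eqxx.
Qed.

Definition root_colh : 'Hom(E, 'cV[R]_(\dim {:E})) := linfun root_col.

Lemma root_colhE b : root_colh b = root_col b.
Proof. by rewrite lfunE. Qed.

Lemma root_colh_ker0 : (lker root_colh == 0)%VS.
Proof.
apply/lker0P => x y; rewrite !root_colhE => h; apply/eqP; rewrite -subr_eq0.
have h0 : root_col (x - y) = 0 by rewrite linearB /= h subrr.
by rewrite -cform_eq0 -lform_root_col h0 lformE big1 // => i _; rewrite mxE mulr0.
Qed.

Lemma root_col_eq0 b : (root_col b == 0) = (b == 0).
Proof.
apply/eqP/eqP => [h|->]; last by rewrite linear0.
by apply: (lker0P root_colh_ker0); rewrite !root_colhE linear0.
Qed.

Lemma root_col_line a b : (root_col b \in <[root_col a]>%VS) = (b \in <[a]>%VS).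
Proof. by rewrite -!root_colhE -limg_line mem_limg_ker0 // root_colh_ker0. Qed.

Lemma hyp_root_is_hyperplane b : b != 0 -> is_hyperplane (hyp (root_col b)).
Proof. by rewrite -root_col_eq0; apply: hyp_is_hyperplane. Qed.

Lemma mem_fixed w (v : E) : (v \in fixed_space rho w) = (v *m rho w == v).
Proof. by apply/fixedSpaceP/eqP; rewrite lfunE. Qed.

Definition simple_span (J : {set 'I_n}) : {vspace E} := <<[seq e i | i <- enum J]>>%VS.

(** Only the lines matter for the hyperplanes. The lengths are left free, so that root systems with
    several lengths and chosen representatives of lines are both covered. *)
Definition root_lines (J : {set 'I_n}) (rs : seq E) : Prop :=
  [/\ noncollinear rs, {subset rs <= simple_span J},
      forall i b, i \in J -> b \in rs -> exists2 c, c \in rs & b *m rho (s i) \in <[c]>%VS,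
      forall i, i \in J -> exists2 b, b \in rs & e i \in <[b]>%VS
    & forall b, b \in rs -> exists i w, i \in J /\ b \in <[e i *m rho w]>%VS].

Section Lines.
Variable rs : seq E.
Hypothesis rl : root_lines setT rs.

Let Q (v : E) := \prod_(b <- rs) B v b.

Lemma act_line w (a b : E) : (a *m rho w \in <[b *m rho w]>%VS) = (a \in <[b]>%VS).
Proof.
apply/vlineP/vlineP => [[k h]|[k ->]]; exists k; last by rewrite -scalemxAl.
by rewrite -[a](actK rho w) h -scalemxAl actK.
Qed.

Lemma s_invol i : (s i * s i = 1)%g.
Proof. by case: cs => [[mii _] rel _ _]; have := rel i i; rewrite mii expg1. Qed.

Lemma act_ss i (x : E) : x *m rho (s i) *m rho (s i) = x.
Proof. by rewrite -actM s_invol act1. Qed.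

Lemma e_act_s i : e i *m rho (s i) = - e i.
Proof.
by rewrite (act_s rr) (cform_ii R cs) mulr1 scaler_nat mulr2n opprD addrA subrr sub0r.
Qed.

(** The reflection negates [b0] and permutes the other lines, so the rest of the product is
    multiplied by a constant [k]. A point on the mirror of [b0] and off the other mirrors is fixed
    and has nonzero product, whence [k = 1]. *)
Lemma root_prod_s i v : Q (v *m rho (s i)) = - Q v.
Proof.
have [nc _ cl ex _] := rl; have [b0 b0s eb0] := ex i (in_setT i).
have u := noncollinear_uniq nc; pose rs' := rem b0 rs.
have b00 := noncollinear_neq0 nc b0s.
have b0e : b0 \in <[e i]>%VS.
  case/vlineP: eb0 => k ek; have k0 : k != 0.
    by apply: contraNneq (e_neq0 R i) => k0; rewrite -/(e i) ek k0 scale0r.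
  by apply/vlineP; exists k^-1; rewrite ek scalerA mulVf // scale1r.
have b0s' : b0 *m rho (s i) = - b0.
  by case/vlineP: b0e => k ->; rewrite -scalemxAl e_act_s scalerN.
have in' b : b \in rs' -> b \in rs /\ b != b0.
  by rewrite (mem_rem_uniq _ u) inE => /andP [].
pose g b := nth 0 rs (find (fun c => b *m rho (s i) \in <[c]>%VS) rs).
have hasg b : b \in rs -> has (fun c => b *m rho (s i) \in <[c]>%VS) rs.
  by move=> bs; apply/hasP; have [c cs' h] := cl i b (in_setT i) bs; exists c.
have gs b : b \in rs -> g b \in rs by move/hasg; rewrite has_find; apply: mem_nth.
have gl b : b \in rs -> b *m rho (s i) \in <[g b]>%VS by move/hasg/(nth_find 0).
pose c b := B (b *m rho (s i)) (g b) / B (g b) (g b).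
have gc b : b \in rs -> b *m rho (s i) = c b *: g b.
  move=> bs; have g0 := noncollinear_neq0 nc (gs _ bs).
  rewrite /c; case/vlineP: (gl _ bs) => k ->; rewrite cformZl mulfK //.
  by rewrite cform_eq0.
have ginj b b' : b \in rs -> b' \in rs -> g b = g b' -> b = b'.
  move=> bs bs' eg; apply: (noncollinear_eq nc) => //.
  rewrite -(act_line (s i)) (gc _ bs) (gc _ bs') -eg.
  have c0 : c b != 0.
    apply: contraNneq (noncollinear_neq0 nc bs) => c0.
    by rewrite -(act_inj rho (s i)) (gc _ bs) c0 scale0r.
  by apply/vlineP; exists (c b' / c b); rewrite scalerA divfK.
have gs' b : b \in rs' -> g b \in rs'.
  move=> /in' [bs bb0]; rewrite (mem_rem_uniq _ u) inE gs // andbT.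
  apply: contra bb0 => /eqP gb; apply/eqP/esym/(noncollinear_eq nc) => //.
  rewrite -(act_line (s i)) (gc _ bs) gb b0s'.
  by apply/vlineP; exists (- c b); rewrite scaleNr scalerN opprK.
pose Q' (v : E) := \prod_(b <- rs') B v b.
have QE x : Q x = B x b0 * Q' x by rewrite /Q (big_rem b0).
have pe : perm_eq [seq g b | b <- rs'] rs'.
  have ur' : uniq rs' by rewrite rem_uniq.
  apply: uniq_perm => //.
    by rewrite map_inj_in_uniq // => b b' /in' [bs _] /in' [bs' _]; apply: ginj.
  have um : uniq [seq g b | b <- rs'].
    by rewrite map_inj_in_uniq // => b b' /in' [bs _] /in' [bs' _]; apply: ginj.
  have sub : {subset [seq g b | b <- rs'] <= rs'} by move=> _ /mapP [b br ->]; apply: gs'.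
  by have [] := uniq_min_size um sub; rewrite ?size_map.
pose k := \prod_(b <- rs') c b.
have Q's x : Q' (x *m rho (s i)) = k * Q' x.
  rewrite {2}/Q' -(perm_big _ pe) big_map /k -big_split /= /Q' big_seq [RHS]big_seq.
  apply: eq_bigr => b /in' [bs _]; rewrite -[b in LHS](act_ss i) (cform_s cs rr).
  by rewrite (gc _ bs) cformZr.
have [|x] := @exists_avoiding _ _ (hyp (root_col b0)) [seq hyp (root_col b) | b <- rs'].
  move=> _ /mapP [b /in' [bs bb0] ->]; apply: contra bb0 => /hyp_line.
  rewrite root_col_eq0 root_col_line => /(_ b00) h; apply/eqP/esym.
  exact: (noncollinear_eq nc).
rewrite mem_hyp_root => /eqP xb0 xav.
have xs : x *m rho (s i) = x.
  rewrite (act_s rr); case/vlineP: eb0 => k0 ->.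
  by rewrite cformZr xb0 !mulr0 scale0r subr0.
have Qx0 : Q' x != 0.
  rewrite prodf_seq_neq0; apply/allP => b br /=; rewrite -mem_hyp_root.
  by apply: xav; apply: map_f.
have k1 : k = 1 by apply: (mulIf Qx0); rewrite mul1r -Q's xs.
rewrite !QE Q's k1 mul1r; have -> : B (v *m rho (s i)) b0 = - B v b0.
  by rewrite -[b0 in LHS](act_ss i) (cform_s cs rr) b0s' -scaleN1r cformZr mulN1r.
by rewrite mulNr.
Qed.

Lemma det_reflection (M : 'M[R]_n) (u : E) (f : 'cV[R]_n) : (u *m f) 0 0 = - 2 ->
  M = 1%:M + f *m u -> \det M = -1.
Proof.
move=> uf ->; rewrite det_sylvester [u *m f]mx11_scalar uf.
by rewrite -raddfD /= det_scalar1; ring.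
Qed.

Lemma root_prod_act w v : Q (v *m rho w) = \det (rho w) * Q v.
Proof.
elim/(cox_ind cs): w v => [|i w IH] v; first by rewrite act1 repr_mx1 det1 mul1r.
rewrite actM root_prod_s IH repr_mxM ?inE // det_mulmx.
rewrite (@det_reflection (rho (s i)) (e i) (- 2 *: col i C)) ?mulrN1 ?mulNr //.
  by rewrite -scalemxAr mxE -(cform_er m) (cform_ii R cs) mulr1.
by rewrite rr /simple_reflection scaleNr mulNmx -scalemxAl.
Qed.

Lemma root_hyperplane b : b \in rs -> hyp (root_col b) \in hyperplanes (coxeter_arrangement rho).
Proof.
have [nc _ _ _ orb] := rl => bs; have b0 := noncollinear_neq0 nc bs.
have [i [w [_ bl]]] := orb b bs; pose t := (w^-1 * s i * w)%g.
have tE v : v *m rho t = v - (2 * B v (e i *m rho w)) *: (e i *m rho w).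
  rewrite !actM (act_s rr) mulmxBl actVK -scalemxAl.
  by rewrite -(cform_act cs rr w) actVK.
have fixE : fixed_space rho t = hyp (root_col b).
  apply/vspaceP => v; rewrite mem_fixed mem_hyp_root tE.
  rewrite -subr_eq0 addrAC subrr sub0r oppr_eq0 scaler_eq0 mulf_eq0 pnatr_eq0 /=.
  rewrite (negbTE (_ : e i *m rho w != 0)) ?orbF; last by rewrite act_inj e_neq0.
  case/vlineP: bl => k bk; rewrite bk cformZr mulf_eq0.
  by rewrite (negbTE (_ : k != 0)) //; apply: contraNneq b0 => k0; rewrite bk k0 scale0r.
apply/imfsetP; exists t => //=; rewrite inE fixE hyp_root_is_hyperplane //=.
apply/eqP; rewrite -repr_mxM ?inE // (_ : t * t = 1)%g ?repr_mx1 //.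
by rewrite /t !mulgA mulgK -[(w^-1 * s i * s i)%g]mulgA s_invol mulg1 mulVg.
Qed.

(* By root_prod_act, Q vanishes on the fixed space of an element of determinant
   - 1, which is thus contained in a root hyperplane. *)
Lemma hyperplane_root H : H \in hyperplanes (coxeter_arrangement rho) ->
  exists2 b, b \in rs & H = hyp (root_col b).
Proof.
case/imfsetP => w /=; rewrite inE => /andP [/eqP dimH /eqP ww] eH.
have invol x : x *m rho w *m rho w = x by rewrite -mulmxA ww mulmx1.
set F := fixed_space rho w in dimH eH.
have FP v : (v \in F) = (v *m rho w == v) by apply: mem_fixed.
have /subvPn [u0 _ u0F] : ~~ (fullv <= F)%VS.
  by apply/negP => /dimvS; rewrite -dimH ltnn.
(* An eigenvector for -1. It is orthogonal to [F] for the invariant form, which identifies [w] with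
   the orthogonal reflection in [u]. *)
pose u := u0 - u0 *m rho w.
have uw : u *m rho w = - u by rewrite mulmxBl invol opprB.
have u_neq0 : u != 0 by apply: contra u0F => /eqP h; rewrite FP eq_sym -subr_eq0 -/u h.
have full : (F + <[u0]> = fullv)%VS.
  apply/eqP; rewrite eqEdim subvf -dimH -addn1 /=.
  have c0 : (F :&: <[u0]> = 0)%VS.
    apply/eqP; rewrite -subv0; apply/subvP => x; rewrite memv_cap => /andP [xF].
    case/vlineP => k xk; move: xF; rewrite xk rpredZeq (negbTE u0F) orbF => /eqP ->.
    by rewrite scale0r mem0v.
  have u00 : u0 != 0 by apply: contraNneq u0F => ->; rewrite mem0v.
  by rewrite dimv_disjoint_sum // dim_vline u00.
have decomp v : exists2 k, (v - k *: u0) \in F & v *m rho w = v - k *: u.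
  have : v \in (F + <[u0]>)%VS by rewrite full memvf.
  case/memv_addP => h hF [_ /vlineP [k ->] ->]; exists k; first by rewrite addrK.
  move: hF; rewrite FP mulmxDl => /eqP ->; rewrite -scalemxAl /u scalerBr.
  by rewrite opprB addrACA subrr addr0.
have Fu v : v \in F -> B v u = 0.
  rewrite FP => /eqP h; have := cform_act cs rr w v u; rewrite uw h -scaleN1r cformZr.
  by move=> h1; lra.
have u0u : B u u = 2 * B u0 u.
  have e1 : B (u0 *m rho w) u = - B u0 u.
    by rewrite -(cform_act cs rr w) invol uw -scaleN1r cformZr mulN1r.
  by rewrite {1}/u -scaleN1r cformDl cformZl e1; ring.
have Buu : B u u != 0 by rewrite cform_eq0.
have wE v : v *m rho w = v - (2 * B v u / B u u) *: u.
  have [k /Fu h ->] := decomp v; congr (_ - _ *: _).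
  have : B v u = k * B u0 u by move: h; rewrite -scaleNr cformDl cformZl => h; lra.
  move=> ->; move: Buu; rewrite u0u => h2.
  have : B u0 u != 0 by apply: contraNneq h2 => ->; rewrite mulr0.
  by move=> h3; field.
have det1 : \det (rho w) = -1.
  apply: (@det_reflection _ u ((- 2 / B u u) *: (C *m u^T))).
    by rewrite -scalemxAr mxE mulmxA -/(B u u) divfK.
  apply/row_matrixP => i; rewrite !rowE mulmxDr mulmx1 wE mulmxA -scalemxAr.
  congr (_ + _); rewrite -scaleNr [_ *m (C *m _)]mx11_scalar mulmxA -/(B _ u).
  by rewrite -scalemxAl mul_scalar_mx scalerA; congr (_ *: _); ring.
have [/hasP [b bs le]|/hasPn no] := boolP (has (fun b => (F <= hyp (root_col b))%VS) rs).
  exists b => //; rewrite eH; apply/eqP; rewrite eqEdim le /=.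
  have [nc _ _ _ _] := rl; have := hyp_root_is_hyperplane (noncollinear_neq0 nc bs).
  by rewrite /is_hyperplane -dimH eqSS => /eqP ->.
have [|v vF vav] := @exists_avoiding _ _ F [seq hyp (root_col b) | b <- rs].
  by move=> _ /mapP [b bs ->]; apply: no.
have Qv0 : Q v != 0.
  rewrite prodf_seq_neq0; apply/allP => b br /=; rewrite -mem_hyp_root.
  by apply: vav; apply: map_f.
have := root_prod_act w v; move: vF; rewrite FP det1 mulN1r => /eqP -> h.
by case/eqP: Qv0; lra.
Qed.

Lemma represents_roots : represents (coxeter_arrangement rho) [seq root_colh b | b <- rs].
Proof.
move=> H; apply/idP/mapP => [/hyperplane_root [b bs ->]|[_ /mapP [b bs ->] ->]].
  by exists (root_colh b); rewrite ?map_f // root_colhE.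
by rewrite root_colhE; apply: root_hyperplane.
Qed.

End Lines.
End CoxeterHyperplanes.

(** * Roots of a set of nodes of the Coxeter graph *)

Lemma line_representatives (K : fieldType) (E : vectType K) (l : seq E) : 0 \notin l ->
  exists rs, [/\ noncollinear rs, {subset rs <= l}
    & forall a, a \in l -> exists2 b, b \in rs & a \in <[b]>%VS].
Proof.
move=> l0; exists (nc l); split; [exact: noncollinear_nc|exact: nc_sub|].
by move=> a /nc_mem [b bs e]; exists b; rewrite // -e memv_line.
Qed.

Section Good.
Variables (R : realType) (n : nat) (W : finGroupType) (m : 'M[nat]_n)
  (s : 'I_n -> W) (rho : mx_representation R [set: W] n).
Hypotheses (cs : coxeter_system m s) (rr : reflection_representation m s rho).
Notation C := (coxeter_form R m).
Notation E := 'rV[R]_n.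
Notation e := (@unit_row R n).
Notation B := (@cform R n m).
Notation simple_span := (@simple_span R n).
Notation root_lines := (root_lines s rho).
Implicit Types (J : {set 'I_n}) (rs : seq E).

(** No edge of the Coxeter graph leaves [J]: it is a union of connected components. *)
Definition closed_nodes J : Prop := forall i j, i \in J -> j \notin J -> C i j = 0.

(** With all nodes in [J], the last clause makes the first level a basis, as [mat_free_accurate]
    requires. *)
Definition mat_nodes J : Prop := exists rs (ht : E -> nat),
  [/\ root_lines J rs, mat_free rs ht & forall i, i \in J -> e i \in <<level rs ht 1>>%VS].

Lemma span_ind (V : vectType R) (X : seq V) (P : V -> Prop) : P 0 ->
  (forall c x y, P x -> P y -> P (c *: x + y)) -> (forall x, x \in X -> P x) ->
  forall v, v \in <<X>>%VS -> P v.
Proof.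
move=> P0 PD PX v vX; rewrite (@coord_span _ _ _ (in_tuple X) v vX); elim/big_rec: _ => // i x _ Px.
by apply: PD => //; apply: PX; apply: mem_nth; rewrite ?size_tuple.
Qed.

Lemma simple_span0 J (v : E) i : v \in simple_span J -> i \notin J -> v 0 i = 0.
Proof.
move=> vJ iJ; move: v vJ; apply: span_ind => [|c x y hx hy|_ /mapP [j jJ ->]].
- by rewrite mxE.
- by rewrite !mxE hx hy mulr0 addr0.
rewrite mxE eqxx /=; case: eqP => // ij; move: jJ; rewrite mem_enum -ij.
by rewrite (negbTE iJ).
Qed.

Lemma e_simple_span J i : i \in J -> e i \in simple_span J.
Proof. by move=> iJ; apply/memv_span/map_f; rewrite mem_enum. Qed.

Lemma simple_span_s J (x : E) i : i \in J -> x \in simple_span J ->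
  x *m rho (s i) \in simple_span J.
Proof. by move=> iJ xJ; rewrite (act_s rr) memvB // memvZ // e_simple_span. Qed.

Lemma simple_span_fix J (x : E) i : closed_nodes J -> i \notin J -> x \in simple_span J ->
  x *m rho (s i) = x.
Proof.
move=> cJ iJ xJ; rewrite (act_s rr) (_ : B x (e i) = 0) ?mulr0 ?scale0r ?subr0 //.
move: x xJ; apply: span_ind => [|c x y hx hy|_ /mapP [j jJ ->]].
- by rewrite -(scale0r 0) cformZl mul0r.
- by rewrite cformDl cformZl hx hy mulr0 addr0.
by rewrite cform_e cJ // -mem_enum.
Qed.

Lemma simple_span_act J (x : E) w : closed_nodes J -> x \in simple_span J ->
  x *m rho w \in simple_span J.
Proof.
move=> cJ; elim/(cox_ind cs): w x => [|i w IH] x xJ; first by rewrite act1.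
rewrite actM; have [iJ|iJ] := boolP (i \in J); first by apply: simple_span_s => //; apply: IH.
by rewrite (simple_span_fix cJ iJ) ?IH.
Qed.

Lemma mat_nodes_accurate : mat_nodes setT -> accurate (coxeter_arrangement rho).
Proof.
case=> rs [ht [rl mf sp]]; have f0 := root_colh_ker0 cs rr.
set f := @root_colh R n m in f0; pose ht' b := ht ((f^-1)%VF b).
have eht : {in rs, forall a, ht' (f a) = ht a} by move=> a _; rewrite /ht' lker0_lfunK.
apply: (@mat_free_accurate _ _ _ (map f rs) ht').
- exact (mat_free_map f0 eht mf).
- exact (represents_roots cs rr rl).
have -> : level (map f rs) ht' 1 = map f (level rs ht 1).
  by rewrite /level filter_map; congr map; apply: eq_in_filter => a sa /=; rewrite eht.
have [_ _ fl _ _] := mf; have := fl 1%N; rewrite /free size_map => /eqP <-.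
congr (\dim _); apply/vspaceP => v; rewrite memvf [v]row_e.
by rewrite memv_suml // => i _; rewrite memvZ // sp ?inE.
Qed.

Lemma mat_nodes_union J1 J2 : closed_nodes J1 -> closed_nodes J2 -> [disjoint J1 & J2] ->
  mat_nodes J1 -> mat_nodes J2 -> mat_nodes (J1 :|: J2).
Proof.
move=> c1 c2 dis [rs1 [ht1 [rl1 mf1 sp1]]] [rs2 [ht2 [rl2 mf2 sp2]]].
have [nc1 sub1 cl1 ex1 orb1] := rl1; have [nc2 sub2 cl2 ex2 orb2] := rl2.
have cap : (<<rs1>> :&: <<rs2>> = 0)%VS.
  apply/eqP; rewrite -subv0; apply/subvP => x; rewrite memv_cap memv0 => /andP [x1 x2].
  have x1' : x \in simple_span J1 by apply: subvP x1; apply/span_subvP.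
  have x2' : x \in simple_span J2 by apply: subvP x2; apply/span_subvP.
  apply/eqP/rowP => i; rewrite mxE; have [i1|i1] := boolP (i \in J1).
    by apply: (simple_span0 x2'); rewrite (disjointFr dis).
  exact: (simple_span0 x1').
have no b : b \in rs2 -> b \notin rs1.
  move=> b2; apply/negP => b1; have := noncollinear_neq0 nc2 b2; rewrite -memv0 -cap.
  by rewrite memv_cap !memv_span.
pose ht b := if b \in rs1 then ht1 b else ht2 b.
have e1 : {in rs1, ht1 =1 ht} by move=> b b1; rewrite /ht b1.
have e2 : {in rs2, ht2 =1 ht} by move=> b b2; rewrite /ht (negbTE (no _ b2)).
have spanJ i : i \in J1 :|: J2 -> e i \in <<level (rs1 ++ rs2) ht 1>>%VS.
  rewrite /level filter_cat span_cat inE => /orP [/sp1|/sp2] h.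
    by apply: (subvP (addvSl _ _)); rewrite -(eq_in_filter (a1 := fun a => ht1 a == 1%N)) //
      => a /e1 ->.
  by apply: (subvP (addvSr _ _)); rewrite -(eq_in_filter (a1 := fun a => ht2 a == 1%N)) //
    => a /e2 ->.
exists (rs1 ++ rs2), ht; split=> //; last first.
  by apply: mat_free_cat => //; [apply: eq_in_mat_free mf1|apply: eq_in_mat_free mf2].
have spS J J' : J \subset J' -> (simple_span J <= simple_span J')%VS.
  move=> JJ; apply/span_subvP => _ /mapP [i iJ ->]; apply: e_simple_span.
  by apply: (subsetP JJ); rewrite -mem_enum.
split.
- exact: noncollinear_cat.
- move=> b; rewrite mem_cat => /orP [/sub1|/sub2] h.
    by apply: (subvP (spS _ _ (subsetUl _ _))).
  by apply: (subvP (spS _ _ (subsetUr _ _))).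
- move=> i b _; rewrite mem_cat => /orP [b1|b2].
    have [i1|i1] := boolP (i \in J1).
      by have [c c1' h] := cl1 i b i1 b1; exists c; rewrite // mem_cat c1'.
    exists b; first by rewrite mem_cat b1.
    by rewrite (simple_span_fix c1 i1) ?memv_line // sub1.
  have [i2|i2] := boolP (i \in J2).
    by have [c c2' h] := cl2 i b i2 b2; exists c; rewrite // mem_cat c2' orbT.
  exists b; first by rewrite mem_cat b2 orbT.
  by rewrite (simple_span_fix c2 i2) ?memv_line // sub2.
- move=> i; rewrite inE => /orP [/ex1|/ex2] [b bs h]; exists b => //.
    by rewrite mem_cat bs.
  by rewrite mem_cat bs orbT.
move=> b; rewrite mem_cat => /orP [/orb1|/orb2] [i [w [iJ h]]].
  by exists i, w; rewrite inE iJ.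
by exists i, w; rewrite inE iJ orbT.
Qed.

Lemma root_lines_orbit J rs : closed_nodes J -> noncollinear rs ->
  (forall b, b \in rs -> exists i w, i \in J /\ b \in <[e i *m rho w]>%VS) ->
  (forall i w, i \in J -> exists2 b, b \in rs & e i *m rho w \in <[b]>%VS) ->
  root_lines J rs.
Proof.
move=> cJ nc orb cov; split=> //.
- move=> b /orb [i [w [iJ /vlineP [k ->]]]]; rewrite memvZ //.
  by apply: simple_span_act => //; apply: e_simple_span.
- move=> i b iJ /orb [j [w [jJ /vlineP [k ->]]]].
  have [c crs h] := cov j (w * s i)%g jJ; exists c => //.
  by rewrite -scalemxAl memvZ // -actM.
by move=> i iJ; have [b brs] := cov i 1%g iJ; rewrite act1; exists b.
Qed.

Lemma mat_nodes_rank2 i j : i != j -> closed_nodes [set i; j] -> mat_nodes [set i; j].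
Proof.
set J := [set i; j] => ij cJ.
pose l := [seq e k *m rho w | k <- enum J, w <- enum W].
have [|rs [nc sub cov]] := @line_representatives _ _ l.
  by apply/negP => /allpairsP [[k w] [_ _ /esym/eqP]]; rewrite act_inj (negbTE (e_neq0 R k)).
have lP k w : k \in J -> e k *m rho w \in l.
  by move=> kJ; apply: allpairs_f; rewrite mem_enum.
have el k : k \in J -> e k \in l by move=> kJ; rewrite -[e k](act1 rho) lP.
have iJ : i \in J by rewrite !inE eqxx.
have jJ : j \in J by rewrite !inE eqxx orbT.
have [b1 b1s ei] := cov _ (el _ iJ); have [b2 b2s ej] := cov _ (el _ jJ).
have u := noncollinear_uniq nc.
have b12 : b2 != b1.
  apply: contraTneq ei => b12; apply/negP => ei; move: ej; rewrite b12 => /vlineP [k ek].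
  case/vlineP: ei => k' ek'; have k0 : k' != 0.
    by apply: contraNneq (e_neq0 R i) => k0; rewrite ek' k0 scale0r.
  have : e j 0 j = 0.
    have -> : e j = (k / k') *: e i by rewrite ek' scalerA divfK // -ek.
    by rewrite !mxE eqxx eq_sym (negbTE ij) /= mulr0.
  by rewrite mxE !eqxx => /eqP; rewrite oner_eq0.
(* The representatives of the two simple roots come first, because they have to form level 1. *)
pose rs' := [:: b1, b2 & rem b2 (rem b1 rs)].
have pe : perm_eq rs rs'.
  apply: perm_trans (perm_to_rem b1s) _; rewrite perm_cons; apply: perm_to_rem.
  by rewrite (mem_rem_uniq _ u) inE b12.
have nc' : noncollinear rs' by rewrite -(noncollinear_perm pe).
have dP : (\dim (simple_span J) <= 2)%N.
  by apply: leq_trans (dim_span _) _; rewrite size_map -cardE cards2 ij.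
have rl : root_lines J rs'.
  apply: root_lines_orbit => //.
    move=> b; rewrite -(perm_mem pe) => /sub /allpairsP [[k w] [kJ _ ->]].
    by exists k, w; rewrite memv_line -mem_enum.
  by move=> k w /lP -/(_ w)/cov [b bs h]; exists b; rewrite // -(perm_mem pe).
have subP : {subset rs' <= simple_span J} by case: rl.
have [fl mf] := mat_free_pencil dP nc' subP.
set ls := _ :: _ in fl mf; rewrite fl in mf.
exists rs', (level_ht ls); split=> // k; rewrite !inE.
have lev b : b \in [:: b1; b2] -> b \in <<level rs' (level_ht ls) 1>>%VS.
  move=> bb; apply: memv_span; rewrite (_ : rs' = flatten ls) // mem_level1 ?fl //.
  exact: noncollinear_uniq nc'.
case/orP => /eqP ->.
  by case/vlineP: ei => k' ->; rewrite memvZ // lev // mem_head.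
by case/vlineP: ej => k' ->; rewrite memvZ // lev // !inE eqxx orbT.
Qed.

Lemma mat_nodes_golden N (f : 'I_N -> 'I_n) phi k ls : phi ^+ 2 = phi + 1 ->
  zcheck N k ls -> injective f ->
  (forall a b, a != b -> C (f a) (f b) = - glabel phi a b / 2) ->
  closed_nodes [set f a | a : 'I_N] -> mat_nodes [set f a | a : 'I_N].
Proof.
move=> phi2 chk finj Cf; set J := [set f a | a : 'I_N] => cJ.
have [vs [mf lev cl ind]] := zcheckP phi2 chk.
have fJ a : f a \in J by apply: imset_f.
have gl0 a : glabel phi a a = 0 :> R.
  rewrite /glabel /zlabel (_ : (a == a.+1 :> nat) = false) ?orbb.
    by case: (val a) => [|[|?]]; rewrite /= zev0.
  by apply/negbTE; rewrite neq_ltn ltnSn.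
pose gf (x : 'rV[R]_N) : E := \sum_a x 0 a *: e (f a).
have gf_lin : linear gf.
  move=> c x y; rewrite /gf scaler_sumr -big_split; apply: eq_bigr => a _.
  by rewrite !mxE scalerDl scalerA.
pose M := GRing.isLinear.Build _ _ _ _ gf gf_lin.
pose gL : {linear 'rV[R]_N -> E} := HB.pack gf M.
pose g := linfun gL.
have gE x : g x = \sum_a x 0 a *: e (f a) by rewrite lfunE.
have gcoord x a : g x 0 (f a) = x 0 a.
  rewrite gE summxE (bigD1 a) //= big1 => [|b ba]; first by rewrite !mxE !eqxx mulr1 addr0.
  by rewrite !mxE eqxx (inj_eq finj) eq_sym (negbTE ba) mulr0.
have g0 : (lker g == 0)%VS.
  by apply/lker0P => x y h; apply/rowP => a; rewrite -!gcoord h.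
have ge a : g (delta_mx 0 a) = e (f a).
  rewrite gE (bigD1 a) //= big1 => [|b ba]; first by rewrite mxE !eqxx scale1r addr0.
  by rewrite mxE (negbTE ba) andbF scale0r.
have Bg x a : B (g x) (e (f a)) = x 0 a - (\sum_b glabel phi a b * x 0 b) / 2.
  rewrite gE cform_suml (bigD1 a) //= cformZl (cform_ii R cs) mulr1; congr (_ + _).
  rewrite [in RHS](bigD1 a) //= gl0 mul0r add0r mulr_suml -sumrN; apply: eq_bigr => b ba.
  by rewrite cformZl cform_e (cox_sym R cs) Cf ?[a == b]eq_sym //; ring.
have grefl_s a x : g (grefl phi a x) = g x *m rho (s (f a)).
  rewrite (act_s rr) Bg /grefl linearB linearZ /= ge; congr (_ - _ *: _).
  by field.
pose ht' b := level_ht vs ((g^-1)%VF b).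
have eht : {in flatten vs, forall a, ht' (g a) = level_ht vs a}.
  by move=> a _; rewrite /ht' lker0_lfunK.
exists (map g (flatten vs)), ht'; split.
- split.
  + by apply: noncollinear_map => //; case: mf.
  + move=> _ /mapP [v _ ->]; rewrite gE memv_suml // => a _.
    by rewrite memvZ // e_simple_span.
  + move=> _ _ /imsetP [a _ ->] /mapP [v vs' ->].
    case: (cl v a vs') => [->|h].
      exists (g (delta_mx 0 a)); last by rewrite ge (e_act_s cs rr) memvN memv_line.
      by apply: map_f; have := lev a; rewrite mem_filter => /andP [].
    by exists (g (grefl phi a v)); rewrite ?map_f // -grefl_s memv_line.
  + move=> _ /imsetP [a _ ->]; exists (g (delta_mx 0 a)); last by rewrite ge memv_line.
    by apply: map_f; have := lev a; rewrite mem_filter => /andP [].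
  move=> _ /mapP [v vs' ->]; move: v vs'; apply: ind => [a|a v].
    by exists (f a), 1%g; rewrite act1 ge memv_line.
  rewrite grefl_s => -[i [w [iJ /vlineP [c h]]]]; exists i, (w * s (f a))%g; split=> //.
  by rewrite -[g v](act_ss rho cs (f a)) h -scalemxAl -actM memvZ // memv_line.
- exact (mat_free_map g0 eht mf).
move=> _ /imsetP [a _ ->]; rewrite -ge.
have -> : level (map g (flatten vs)) ht' 1 = map g (level (flatten vs) (level_ht vs) 1).
  by rewrite /level filter_map; congr map; apply: eq_in_filter => b sb /=; rewrite eht.
by apply/memv_span/map_f.
Qed.

End Good.

(** The two integers have product 4, which leaves six values for the first. *)
Lemma int_ratio (R : realType) (k : R) : k != 0 ->
  2 * k \is a Num.int -> 2 / k \is a Num.int -> k \in [:: 1; -1; 2; -2; 2^-1; - 2^-1].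
Proof.
move=> k0 /intrP [p hp] /intrP [q hq].
have pq : p * q = 4.
  by apply: (@intr_inj R); rewrite intrM -hp -hq; field.
have hk : k = p%:~R / 2 by rewrite -hp; field.
have : (`|p| %| 4)%N by apply/dvdnP; exists `|q|%N; rewrite mulnC -abszM pq.
move=> /dvdn_leq - /(_ isT) le4.
have : p \in [:: 2; -2; 4; -4; 1; -1].
  rewrite !inE; move: pq le4; clear hp hk.
  by case: p => [[|[|[|[|[|?]]]]]|[|[|[|[|?]]]]] //=; lia.
rewrite hk !inE => /or4P [||| /or3P []] /eqP ->; apply/or4P.
- by apply: Or41; apply/eqP; field.
- by apply: Or42; apply/eqP; field.
- by apply: Or43; apply/eqP; field.
- by apply: Or44; apply/or3P/Or31/eqP; field.
- by apply: Or44; apply/or3P/Or32/eqP; field.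
- by apply: Or44; apply/or3P/Or33/eqP; field.
Qed.

(** * Rescaling the simple roots to a crystallographic root system *)

Section Crystallographic.
Variables (R : realType) (n : nat) (W : finGroupType) (m : 'M[nat]_n)
  (s : 'I_n -> W) (rho : mx_representation R [set: W] n).
Hypotheses (cs : coxeter_system m s) (rr : reflection_representation m s rho).
Notation C := (coxeter_form R m).
Notation E := 'rV[R]_n.
Notation e := (@unit_row R n).
Notation B := (@cform R n m).
Notation simple_span := (@simple_span R n).

Let BC : forall x y, B x y = B y x := cformC cs.
Let BDl := @cformDl R n m.
Let BZl := @cformZl R n m.
Let Bgt0 := cform_pos cs rr.

Variables (J : {set 'I_n}) (L : 'I_n -> R).
Hypotheses (cJ : closed_nodes R m J) (L0 : forall i, i \in J -> 0 < L i)
  (Lint : forall i j, i \in J -> j \in J -> 2 * C i j * L i / L j \is a Num.int).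

Let a i := L i *: e i.
Let Phi0 := undup [seq a i *m rho w | i <- enum J, w <- enum W].
(** Integral Cartan numbers still allow proportional vectors of ratio 2 up to sign; discarding the
    longer ones makes the system reduced. *)
Let Phi := [seq b <- Phi0 | 2^-1 *: b \notin Phi0].

Lemma scaled_rootP x : x \in Phi0 <-> exists i w, i \in J /\ x = a i *m rho w.
Proof.
rewrite mem_undup; split=> [/allpairsP [[i w] [iJ _ ->]]|[i [w [iJ ->]]]].
  by exists i, w; rewrite -mem_enum.
by apply: allpairs_f; rewrite mem_enum.
Qed.

Lemma scaled_simple_neq0 i : i \in J -> a i != 0.
Proof. by move=> iJ; rewrite scaler_eq0 gt_eqF ?L0 //= e_neq0. Qed.

Lemma scaled_root_neq0 x : x \in Phi0 -> x != 0.
Proof. by case/scaled_rootP => i [w [iJ ->]]; rewrite act_inj scaled_simple_neq0. Qed.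

Lemma cart_scaled_simple i x : i \in J -> cart B x (a i) = 2 * B x (e i) / L i.
Proof.
move=> iJ; have l0 := L0 iJ; rewrite /cart /a cformZr cformZl cformZr (cform_ii R cs).
by field; rewrite gt_eqF.
Qed.

Lemma cart_act w x y : cart B (x *m rho w) (y *m rho w) = cart B x y.
Proof. by rewrite /cart !(cform_act cs rr). Qed.

Lemma scaled_root_act x w : x \in Phi0 -> x *m rho w \in Phi0.
Proof.
move=> /scaled_rootP [i [u [iJ ->]]]; apply/scaled_rootP; exists i, (u * w)%g.
by rewrite actM.
Qed.

Lemma refl_act i w x : i \in J -> refl B (a i *m rho w) x = x *m rho (w^-1 * s i * w)%g.
Proof.
move=> iJ; have l0 := L0 iJ.
have -> : refl B (a i *m rho w) x = x - cart B (x *m rho w^-1%g) (a i) *: (a i *m rho w).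
  by rewrite /refl -(cart_act w (x *m _)) actVK.
rewrite cart_scaled_simple // !actM (act_s rr).
rewrite mulmxBl actVK; congr (_ - _); rewrite /a -!scalemxAl scalerA; congr (_ *: _).
by field; rewrite gt_eqF.
Qed.

Lemma scaled_refl x y : x \in Phi0 -> y \in Phi0 -> refl B x y \in Phi0.
Proof.
by case/scaled_rootP => i [w [iJ ->]] yP; rewrite refl_act // scaled_root_act.
Qed.

Lemma scaled_opp x : x \in Phi0 -> - x \in Phi0.
Proof.
move=> xP; rewrite -(refl_self Bgt0 (scaled_root_neq0 xP)).
exact: scaled_refl.
Qed.

(** Induction along a word for [w]: by [Lint] a reflection in [J] changes a Cartan number by an
    integral multiple of another one, and the other generators fix the span of [J]. *)
Lemma cart_int_act x w : x \in simple_span J ->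
  (forall i, i \in J -> cart B x (a i) \is a Num.int) ->
  forall i, i \in J -> cart B (x *m rho w) (a i) \is a Num.int.
Proof.
move=> xJ xi; elim/(cox_ind cs): w => [|k w IH] i iJ; first by rewrite act1 xi.
rewrite actM; set y := x *m rho w.
have yJ : y \in simple_span J by apply: (simple_span_act cs rr).
have [kJ|kJ] := boolP (k \in J); last by rewrite (simple_span_fix rr cJ kJ yJ) IH.
have lk := L0 kJ; have li := L0 iJ.
have -> : cart B (y *m rho (s k)) (a i) =
    cart B y (a i) - cart B y (a k) * (2 * C k i * L k / L i).
  rewrite !cart_scaled_simple // (act_s rr) -scaleNr cformDl cformZl cform_e.
  by field; rewrite !gt_eqF.
by apply: rpredB; [apply: IH|apply: rpredM; [apply: IH|apply: Lint]].
Qed.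

Lemma scaled_cart_int x y : x \in Phi0 -> y \in Phi0 -> cart B y x \is a Num.int.
Proof.
move=> /scaled_rootP [i [w [iJ ->]]] /scaled_rootP [j [u [jJ ->]]].
rewrite -(cart_act w^-1%g) actK -actM; apply: cart_int_act => //.
  by rewrite memvZ // e_simple_span.
move=> k kJ; rewrite cart_scaled_simple // /a cformZl cform_e.
by rewrite (_ : _ / _ = 2 * C j k * L j / L k) ?Lint //; ring.
Qed.

Lemma PhiP x : (x \in Phi) = (x \in Phi0) && (2^-1 *: x \notin Phi0).
Proof. by rewrite mem_filter andbC. Qed.

Lemma cartZ_line k y : y \in Phi0 -> cart B (k *: y) y = 2 * k.
Proof.
by move=> yP; rewrite (cartZl BZl) (cartaa Bgt0) ?scaled_root_neq0 // mulrC.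
Qed.

Lemma scaled_root_ratio k x y : x \in Phi0 -> y \in Phi0 -> x = k *: y ->
  k \in [:: 1; -1; 2; -2; 2^-1; - 2^-1].
Proof.
move=> xP yP e1; have k0 : k != 0.
  by apply: contraNneq (scaled_root_neq0 xP) => k0; rewrite e1 k0 scale0r.
have e2 : y = k^-1 *: x by rewrite e1 scalerA mulVf // scale1r.
apply: int_ratio => //; first by rewrite -(cartZ_line k yP) -e1 scaled_cart_int.
by rewrite -(cartZ_line k^-1 xP) -e2 scaled_cart_int.
Qed.

Lemma indivisible_rootsys : rootsys B Phi.
Proof.
split.
- by rewrite filter_uniq // undup_uniq.
- by rewrite PhiP; apply/negP => /andP [/scaled_root_neq0]; rewrite eqxx.
- move=> x y; rewrite !PhiP => /andP [xP _] /andP [yP hy].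
  rewrite scaled_refl //=; apply: contra hy => h.
  have x0 := scaled_root_neq0 xP.
  have <- : refl B x (2^-1 *: refl B x y) = 2^-1 *: y.
    rewrite -[in RHS](reflK BDl BZl Bgt0 x0 y) {1}/refl (cartZl BZl) -scalerA -scalerBr.
    by [].
  exact: scaled_refl.
- by move=> x y; rewrite !PhiP => /andP [xP _] /andP [yP _]; apply: scaled_cart_int.
move=> x y; rewrite !PhiP => /andP [xP hx] /andP [yP hy] /vlineP [k e1].
have := scaled_root_ratio xP yP e1; rewrite !inE.
case/or4P => [||| /or3P []] /eqP kE; rewrite kE in e1.
- by left; rewrite e1 scale1r.
- by right; rewrite e1 scaleN1r.
- by case/negP: hx; rewrite e1 scalerA mulVf ?pnatr_eq0 // scale1r.
- case/negP: hx; rewrite e1 scalerA mulrN mulVf ?pnatr_eq0 // scaleN1r.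
  exact: scaled_opp.
- by case/negP: hy; rewrite -e1.
by case/negP: hy; rewrite -[_ *: y]opprK -scaleNr -e1 scaled_opp.
Qed.

(* L rescales the simple roots to those of a root system, up to roots divisible
   by 2. *)
Lemma mat_nodes_cryst : mat_nodes s rho J.
Proof.
have rs := indivisible_rootsys.
have [|v _ vav] := @exists_avoiding _ _ fullv [seq hyp (root_col m b) | b <- Phi].
  move=> _ /mapP [b bP ->]; apply/negP => /subvP /(_ b (memvf b)).
  rewrite mem_hyp_root (cform_eq0 cs rr); apply/negP/scaled_root_neq0.
  by move: bP; rewrite PhiP => /andP [].
have vreg b : b \in Phi -> B b v != 0.
  by move=> bP; rewrite BC -mem_hyp_root; apply/vav/map_f.
have mf := rootsys_mat_free BC BDl BZl Bgt0 rs vreg.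
have sp := pos_span1 BC BDl BZl Bgt0 rs vreg.
have cover i w : i \in J -> exists2 b, b \in positive B v Phi & e i *m rho w \in <[b]>%VS.
  move=> iJ; have l0 := L0 iJ.
  have eE : e i *m rho w = (L i)^-1 *: (a i *m rho w).
    by rewrite /a -scalemxAl scalerA mulVf ?scale1r // gt_eqF.
  have [y yP yl] : exists2 y, y \in Phi & e i *m rho w \in <[y]>%VS.
    have xP : a i *m rho w \in Phi0 by apply/scaled_rootP; exists i, w.
    case: (boolP (a i *m rho w \in Phi)) => [h|].
      by exists (a i *m rho w); rewrite // eE memvZ // memv_line.
    rewrite PhiP xP /= negbK => hP; exists (2^-1 *: (a i *m rho w)).
      rewrite PhiP hP scalerA; apply/negP => h4.
      have := scaled_root_ratio h4 xP erefl; rewrite !inE.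
      by case/or4P => [||| /or3P []] /eqP; lra.
    rewrite eE; apply: memvZ; apply/vlineP; exists 2.
    by rewrite scalerA divff ?pnatr_eq0 // scale1r.
  case: (pos_or BZl Bgt0 rs vreg yP) => h; first by exists y.
  exists (- y) => //; case/vlineP: yl => k ->; apply/vlineP; exists (- k).
  by rewrite scaleNr scalerN opprK.
exists (positive B v Phi), (htn B v Phi); split=> //.
  apply: (root_lines_orbit cs rr cJ) => //; first by case: mf.
  move=> b; rewrite mem_filter PhiP => /andP [_ /andP [/scaled_rootP [i [w [iJ ->]]] _]].
  by exists i, w; rewrite /a -scalemxAl memvZ // memv_line.
move=> i iJ; have [b bP] := cover i 1%g iJ; rewrite act1 => /vlineP [k ->].
by rewrite memvZ // sp.
Qed.

End Crystallographic.

(** * The forbidden Coxeter graphs *)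

Section TwoCos.
Variable R : realType.

Definition two_cos (k : nat) : R := 2 * cos (pi / k%:R).

Lemma two_cos_lt k l : (0 < k < l)%N -> two_cos k < two_cos l.
Proof.
case/andP => k0 kl; have l0 : (0 < l)%N by apply: ltn_trans kl.
have inpi j : (0 < j)%N -> (pi / j%:R : R) \in `[0, pi].
  move=> j0; rewrite in_itv /= divr_ge0 ?pi_ge0 ?ler0n //=.
  by rewrite ler_pdivrMr ?ltr0n // ler_peMr ?pi_ge0 // ler1n.
rewrite /two_cos ltr_pM2l ?ltr0n // ltr_cos ?inpi //.
by rewrite ltr_pM2l ?pi_gt0 // ltf_pV2 ?posrE ?ltr0n // ltr_nat.
Qed.

Lemma two_cos_le k l : (0 < k <= l)%N -> two_cos k <= two_cos l.
Proof.
case/andP => k0; rewrite leq_eqVlt => /predU1P [->//|kl].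
by rewrite ltW // two_cos_lt // k0.
Qed.

Lemma two_cos2 : two_cos 2 = 0.
Proof. by rewrite /two_cos cos_pihalf mulr0. Qed.

Lemma two_cos_double (x : R) : 2 * cos (x *+ 2) = (2 * cos x) ^+ 2 - 2.
Proof. by rewrite cos_mulr2n mulr2n; ring. Qed.

Lemma two_cos_pi_sub (x : R) : 2 * cos (pi - x) = - (2 * cos x).
Proof. by rewrite cosB cospi sinpi; ring. Qed.

Lemma two_cos_half k : (0 < k)%N -> two_cos (k * 2) ^+ 2 = 2 + two_cos k.
Proof.
move=> k0; have -> : two_cos k = 2 * cos ((pi / (k * 2)%:R) *+ 2).
  congr (2 * cos _); rewrite natrM; field; rewrite pnatr_eq0 -lt0n k0 //.
by rewrite two_cos_double /two_cos; ring.
Qed.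

Lemma two_cos_ge0 k : (1 < k)%N -> 0 <= two_cos k.
Proof. by move=> k1; rewrite -two_cos2 two_cos_le. Qed.

Lemma two_cos3 : two_cos 3 = 1.
Proof.
have h : two_cos 3 ^+ 2 - 2 = - two_cos 3.
  rewrite /two_cos -two_cos_double -two_cos_pi_sub; congr (2 * cos _).
  by rewrite mulr2n; field.
have h0 := two_cos_ge0 (isT : (1 < 3)%N).
have : (two_cos 3 - 1) * (two_cos 3 + 2) = 0.
  rewrite [LHS](_ : _ = two_cos 3 ^+ 2 - 2 - - two_cos 3); last by ring.
  by rewrite h subrr.
by move/eqP; rewrite mulf_eq0 => /orP [] /eqP; lra.
Qed.

Lemma two_cos4 : two_cos 4 ^+ 2 = 2.
Proof. by rewrite (two_cos_half (isT : (0 < 2)%N)) two_cos2 addr0. Qed.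

Lemma two_cos6 : two_cos 6 ^+ 2 = 3.
Proof. by rewrite (two_cos_half (isT : (0 < 3)%N)) two_cos3; ring. Qed.

(** Doubling the angle maps t = 2 cos x to t^2 - 2. Two doublings of pi / 5 give the supplementary
    angle, so t^4 - 4 t^2 + t + 2 = (t - 1) (t + 2) (t^2 - t - 1) vanishes, and t > 1 selects the
    last factor. *)
Lemma two_cos5 : two_cos 5 ^+ 2 = two_cos 5 + 1.
Proof.
have h : (two_cos 5 ^+ 2 - 2) ^+ 2 - 2 = - two_cos 5.
  rewrite /two_cos -!two_cos_double -two_cos_pi_sub; congr (2 * cos _).
  by rewrite !mulr2n; field.
have c1 : 1 < two_cos 5 by rewrite -two_cos3 two_cos_lt.
have : (two_cos 5 - 1) * ((two_cos 5 + 2) * (two_cos 5 ^+ 2 - two_cos 5 - 1)) = 0.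
  rewrite [LHS](_ : _ = (two_cos 5 ^+ 2 - 2) ^+ 2 - 2 - - two_cos 5); last by ring.
  by rewrite h subrr.
move/eqP; rewrite !mulf_eq0 => /or3P [] /eqP; lra.
Qed.

Lemma two_cos_ge1 k : (2 < k)%N -> 1 <= two_cos k.
Proof. by move=> k2; rewrite -two_cos3 two_cos_le. Qed.

Lemma two_cos_ge4 k : (3 < k)%N -> 7 / 5 <= two_cos k.
Proof.
move=> k3; apply: le_trans (two_cos_le (k := 4) _); last by rewrite k3.
have := two_cos4; have := two_cos_ge0 (isT : (1 < 4)%N); nra.
Qed.

Lemma two_cos5_ge : 8 / 5 <= two_cos 5.
Proof. by have := two_cos5; have := two_cos_ge1 (isT : (2 < 5)%N); nra. Qed.

Lemma two_cos_ge6 k : (5 < k)%N -> 3 <= two_cos k ^+ 2.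
Proof.
move=> k5; have := two_cos_le (k := 6) (l := k); rewrite k5 => /(_ isT).
have := two_cos6; have := two_cos_ge0 (isT : (1 < 6)%N); nra.
Qed.

End TwoCos.

(** * Subgraphs excluded by positive definiteness *)

Section Classification.
Variables (R : realType) (n : nat) (W : finGroupType) (m : 'M[nat]_n)
  (s : 'I_n -> W) (rho : mx_representation R [set: W] n).
Hypotheses (cs : coxeter_system m s) (rr : reflection_representation m s rho).
Notation C := (coxeter_form R m).
Notation E := 'rV[R]_n.
Notation e := (@unit_row R n).
Notation B := (@cform R n m).
Notation closed_nodes := (closed_nodes R m).
Notation mat_nodes := (mat_nodes s rho).

(* 2 cos (pi / m i j) for i <> j. *)
Definition lam i j : R := - (2 * C i j).

Lemma lam_def i j : lam i j = - (2 * C i j).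
Proof. by []. Qed.

(** The norm of a combination of simple roots, nested so that on an explicit list it unfolds to a
    polynomial in the numbers [lam]. *)
Fixpoint qform (l : seq (R * 'I_n)) : R :=
  if l is p :: l' then p.1 ^+ 2 - p.1 * (\sum_(q <- l') q.1 * lam p.2 q.2) + qform l'
  else 0.

Lemma qformE l : qform l = B (\sum_(p <- l) p.1 *: e p.2) (\sum_(p <- l) p.1 *: e p.2).
Proof.
elim: l => [|p l IH] /=; first by rewrite big_nil -(scale0r 0) cformZl mul0r.
rewrite big_cons IH; set y := \sum_(q <- l) q.1 *: e q.2.
have -> : \sum_(q <- l) q.1 * lam p.2 q.2 = - (2 * B (e p.2) y).
  rewrite /y; elim: (l) => [|q l' IH']; first by rewrite !big_nil -(scale0r 0) cformZr; ring.
  by rewrite !big_cons IH' cformDr cformZr cform_e /lam; ring.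
rewrite cformDl !cformDr !cformZl !cformZr (cform_ii R cs) (cformC cs y).
by ring.
Qed.

Lemma qform_gt0 l : uniq (unzip2 l) -> has (fun p => p.1 != 0) l -> 0 < qform l.
Proof.
move=> u /hasP [p pl p0]; rewrite qformE; apply: (cform_pos cs rr).
apply: contraNneq p0 => /rowP /(_ p.2); rewrite mxE summxE => h; apply/eqP; rewrite -h.
rewrite (big_rem p) //= !mxE !eqxx mulr1 big_seq big1 ?addr0 // => q ql.
rewrite !mxE eqxx /=; case: eqP => [pq|]; last by rewrite mulr0.
have ul := map_uniq u; move: ql; rewrite (mem_rem_uniq _ ul) inE => /andP [qp ql].
by case/eqP: qp; apply: (map_uniq_in u).
Qed.

Lemma lamC i j : lam i j = lam j i.
Proof. by rewrite /lam (cox_sym R cs). Qed.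

Lemma m_sym i j : m i j = m j i.
Proof.
have [->//|ij] := eqVneq i j.
by case: cs => [[_ h] _ _ _]; have [] := h i j ij.
Qed.

Lemma m_gt1 i j : i != j -> (1 < m i j)%N.
Proof.
move=> ij; case: (cs) => [[_ h] _ _ _]; have [_ m1] := h i j ij.
suff m0 : m i j != 0%N by move: m0 m1; case: (m i j) => [|[|]].
(* For the entry 0 the quotient by zero is 0, so [lam i j] is 2 cos 0 = 2 and the sum of the two
   simple roots would have norm 0. *)
apply/eqP => m0; have := @qform_gt0 [:: (1, i); (1, j)].
rewrite /= !inE ij oner_eq0 => /(_ isT isT).
rewrite !big_cons !big_nil /lam mxE m0 invr0 mulr0 cos0 /=; lra.
Qed.

Lemma lamE i j : lam i j = two_cos R (m i j).
Proof. by rewrite /lam mxE /two_cos; ring. Qed.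

Lemma lam_ge0 i j : i != j -> 0 <= lam i j.
Proof. by move=> ij; rewrite lamE two_cos_ge0 // m_gt1. Qed.

Lemma lam_ge1 i j : i != j -> lam i j != 0 -> (2 < m i j)%N.
Proof.
move=> ij; rewrite lamE ltn_neqAle m_gt1 // andbT; apply: contraNneq => <-.
by rewrite two_cos2.
Qed.

Lemma lam_eq0 i j : (lam i j == 0) = (C i j == 0).
Proof. by rewrite oppr_eq0 mulf_eq0 pnatr_eq0. Qed.

Lemma closed_or_neighbour (K : {set 'I_n}) :
  closed_nodes K \/ exists a b, [/\ a \in K, b \notin K & (2 < m a b)%N].
Proof.
have [/existsP [a /existsP [b /and3P [aK bK ab]]]|no] :=
    boolP [exists a, exists b, [&& a \in K, b \notin K & C a b != 0]].
  right; exists a, b; split=> //; apply: lam_ge1; last by rewrite lam_eq0.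
  by apply: contraNneq bK => <-.
left=> a b aK bK; apply/eqP; apply: contraNT no => ab.
by apply/existsP; exists a; apply/existsP; exists b; rewrite aK bK.
Qed.

(* The Coxeter graphs excluded below are those of indefinite forms, with an
   explicit vector of nonpositive norm; the coordinates 8/5 and 7/5 approximate
   [2 cos (pi / 5)] and [2 cos (pi / 4)]. *)
Section Forbidden.
Variables i j k : 'I_n.
Hypotheses (uijk : uniq [:: i; j; k]) (mij : (m i j = 5%N)) (mjk : (2 < m j k)%N).

Let lij : 8 / 5 <= lam i j. Proof. by rewrite lamE mij two_cos5_ge. Qed.
Let ljk : 1 <= lam j k. Proof. by rewrite lamE two_cos_ge1. Qed.

Lemma qform_ijk a b c : a != 0 ->
  0 < a ^+ 2 + b ^+ 2 + c ^+ 2 - a * b * lam i j - b * c * lam j k - a * c * lam i k.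
Proof.
move=> a0; have := @qform_gt0 [:: (a, i); (b, j); (c, k)] uijk; rewrite /= a0 => /(_ isT).
by rewrite !big_cons !big_nil /=; congr (0 < _); ring.
Qed.

Lemma no_triangle : (m i k <= 2)%N.
Proof.
rewrite leqNgt; apply/negP => h; have lik : 1 <= lam i k by rewrite lamE two_cos_ge1.
have := @qform_ijk 1 1 1; rewrite oner_eq0 => /(_ isT); move: lij ljk; lra.
Qed.

Let lik : 0 <= lam i k.
Proof. by apply: lam_ge0; move: uijk => /=; rewrite !inE negb_or => /andP [/andP []]. Qed.

Lemma no_54 : (m j k = 3)%N.
Proof.
apply/eqP; rewrite eqn_leq mjk andbT leqNgt; apply/negP => h.
have ljk' : 7 / 5 <= lam j k by rewrite lamE two_cos_ge4.
(* An end node takes half of its neighbour's coordinate times the bound for the label, which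
   minimizes the form: 2 * (8 / 5) / 2 and 2 * (7 / 5) / 2. *)
have := @qform_ijk (8 / 5) 2 (7 / 5); rewrite mulf_eq0 invr_eq0 !pnatr_eq0 /= => /(_ isT).
move: lij lik; lra.
Qed.

Section Fourth.
Variable l : 'I_n.
Hypothesis ul : l \notin [:: i; j; k].

Let uijkl : uniq [:: i; j; k; l].
Proof. by rewrite -[[:: i; j; k; l]]/(rcons [:: i; j; k] l) rcons_uniq ul uijk. Qed.

Lemma qform_ijkl a b c d : a != 0 ->
  0 < a ^+ 2 + b ^+ 2 + c ^+ 2 + d ^+ 2 - a * b * lam i j - b * c * lam j k - a * c * lam i k
    - d * (a * lam i l + b * lam j l + c * lam k l).
Proof.
move=> a0; have := @qform_gt0 [:: (a, i); (b, j); (c, k); (d, l)] uijkl.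
rewrite /= a0 => /(_ isT).
by rewrite !big_cons !big_nil /=; congr (0 < _); ring.
Qed.

Let nl a : a \in [:: i; j; k] -> 0 <= lam a l.
Proof. by move=> h; apply: lam_ge0; apply: contraNneq ul => <-. Qed.
Let lil : 0 <= lam i l. Proof. by apply: nl; rewrite !inE eqxx. Qed.
Let ljl : 0 <= lam j l. Proof. by apply: nl; rewrite !inE eqxx orbT. Qed.
Let lkl : 0 <= lam k l. Proof. by apply: nl; rewrite !inE eqxx !orbT. Qed.

Lemma no_353 : (m i l <= 2)%N.
Proof.
rewrite leqNgt; apply/negP => h; have lil' : 1 <= lam i l by rewrite lamE two_cos_ge1.
have := @qform_ijkl 2 2 1 1; rewrite pnatr_eq0 => /(_ isT); move: lij ljk lik ljl lkl; lra.
Qed.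

Lemma no_star_j : (m j l <= 2)%N.
Proof.
rewrite leqNgt; apply/negP => h; have ljl' : 1 <= lam j l by rewrite lamE two_cos_ge1.
have := @qform_ijkl (8 / 5) 2 1 1; rewrite mulf_eq0 invr_eq0 !pnatr_eq0 /= => /(_ isT).
move: lij ljk lik lil lkl; lra.
Qed.

Lemma no_534 : (m k l <= 3)%N.
Proof.
rewrite leqNgt; apply/negP => h; have lkl' : 7 / 5 <= lam k l by rewrite lamE two_cos_ge4.
have := @qform_ijkl (8 / 5) 2 2 (7 / 5).
rewrite mulf_eq0 invr_eq0 !pnatr_eq0 /= => /(_ isT); move: lij ljk lik lil ljl; lra.
Qed.

Section Fifth.
Variable p : 'I_n.
Hypotheses (up : p \notin [:: i; j; k; l]) (mkl : (2 < m k l)%N).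

Let lkl' : 1 <= lam k l. Proof. by rewrite lamE two_cos_ge1. Qed.

Lemma qform_ijklp a b c d x : a != 0 ->
  0 < a ^+ 2 + b ^+ 2 + c ^+ 2 + d ^+ 2 + x ^+ 2
    - a * b * lam i j - b * c * lam j k - a * c * lam i k
    - d * (a * lam i l + b * lam j l + c * lam k l)
    - x * (a * lam i p + b * lam j p + c * lam k p + d * lam l p).
Proof.
move=> a0; have up' : uniq [:: i; j; k; l; p].
  by rewrite -[[:: i; j; k; l; p]]/(rcons [:: i; j; k; l] p) rcons_uniq up uijkl.
have := @qform_gt0 [:: (a, i); (b, j); (c, k); (d, l); (x, p)] up'.
rewrite /= a0 => /(_ isT).
by rewrite !big_cons !big_nil /=; congr (0 < _); ring.
Qed.

Let np a : a \in [:: i; j; k; l] -> 0 <= lam a p.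
Proof. by move=> h; apply: lam_ge0; apply: contraNneq up => <-. Qed.
Let lip : 0 <= lam i p. Proof. by apply: np; rewrite !inE eqxx. Qed.
Let ljp : 0 <= lam j p. Proof. by apply: np; rewrite !inE eqxx orbT. Qed.
Let lkp : 0 <= lam k p. Proof. by apply: np; rewrite !inE eqxx !orbT. Qed.
Let llp : 0 <= lam l p. Proof. by apply: np; rewrite !inE eqxx !orbT. Qed.

Lemma no_star_k : (m k p <= 2)%N.
Proof.
rewrite leqNgt; apply/negP => h; have lkp' : 1 <= lam k p by rewrite lamE two_cos_ge1.
have := @qform_ijklp (8 / 5) 2 2 1 1.
rewrite mulf_eq0 invr_eq0 !pnatr_eq0 /= => /(_ isT); move: lij ljk lik lil ljl lkl' lip ljp llp; lra.
Qed.

Lemma no_5333 : (m l p <= 2)%N.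
Proof.
rewrite leqNgt; apply/negP => h; have llp' : 1 <= lam l p by rewrite lamE two_cos_ge1.
(* The coordinates 4, 3, 2, 1 decrease linearly along the arm with labels 3, and 16/5 is half of 4 *
   (8 / 5). *)
have := @qform_ijklp (16 / 5) 4 3 2 1.
rewrite mulf_eq0 invr_eq0 !pnatr_eq0 /= => /(_ isT); move: lij ljk lik lil ljl lkl' lip ljp lkp; lra.
Qed.

End Fifth.
End Fourth.
End Forbidden.

(** The coordinates [lam i j], 2, 1 give a norm of at most 5 - [lam i j]^2 - 2 [lam j k], which is
    nonpositive. For the label 6 next to 3 this is the null vector of affine G2. *)
Lemma no_neighbour_ge6 i j k : uniq [:: i; j; k] -> (5 < m i j)%N -> (m j k <= 2)%N.
Proof.
move=> u mij; rewrite leqNgt; apply/negP => h.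
have ljk : 1 <= lam j k by rewrite lamE two_cos_ge1.
have lij : 3 <= lam i j ^+ 2 by rewrite lamE two_cos_ge6.
have /= := u; rewrite !inE negb_or => /and3P [/andP [ij ik] _ _].
have l0 := lam_ge0 ij; have lik := mulr_ge0 l0 (lam_ge0 ik).
have := @qform_gt0 [:: (lam i j, i); (2, j); (1, k)] u.
rewrite /= pnatr_eq0 orbT => /(_ isT); rewrite !big_cons !big_nil /=; nra.
Qed.

End Classification.

(** * The components of the Coxeter graph *)

Lemma zlabelC a b : zlabel a b = zlabel b a.
Proof.
rewrite /zlabel (orbC ((b == 0) && (a == 1))%N) !(andbC (b == _)).
by rewrite (orbC (b == a.+1)).
Qed.

Section Components.
Variables (R : realType) (n : nat) (W : finGroupType) (m : 'M[nat]_n)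
  (s : 'I_n -> W) (rho : mx_representation R [set: W] n).
Hypotheses (cs : coxeter_system m s) (rr : reflection_representation m s rho).
Notation C := (coxeter_form R m).
Notation E := 'rV[R]_n.
Notation e := (@unit_row R n).
Notation B := (@cform R n m).
Notation closed_nodes := (closed_nodes R m).
Notation mat_nodes := (mat_nodes s rho).
Notation lam := (@lam R n m).
Implicit Types (J K : {set 'I_n}) (t : seq 'I_n).

Lemma closed_adj J a b : closed_nodes J -> a \in J -> (2 < m a b)%N -> b \in J.
Proof.
move=> cJ aJ ab; apply: contraTT isT => bJ; have := cJ a b aJ bJ => h.
have : 1 <= lam a b by rewrite lamE two_cos_ge1.
by rewrite lam_def h; lra.
Qed.

Lemma mat_nodes_diagram t k ls i0 : uniq t -> zcheck (size t) k ls ->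
  (forall a b : 'I_(size t), (a < b)%N ->
     lam (nth i0 t a) (nth i0 t b) = glabel (two_cos R 5) a b) ->
  closed_nodes [set x in t] -> mat_nodes [set x in t].
Proof.
move=> u chk lamt; pose f (a : 'I_(size t)) := nth i0 t a.
have finj : injective f.
  by move=> a b /eqP; rewrite nth_uniq // => /eqP /val_inj.
have -> : [set x in t] = [set f a | a : 'I_(size t)].
  apply/setP => x; rewrite inE; apply/(nthP i0)/imsetP => [[a lt <-]|[a _ ->]].
    by exists (Ordinal lt).
  by exists a.
apply: (mat_nodes_golden cs rr (two_cos5 R) chk finj) => a b ab.
have gsym : glabel (two_cos R 5) a b = glabel (two_cos R 5) b a by rewrite /glabel zlabelC.
have -> : C (f a) (f b) = - lam (f a) (f b) / 2 by rewrite lam_def; field.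
congr (- _ / _); have [lt|gt|/val_inj e1] := ltngtP a b; first exact: lamt.
  by rewrite (lamC R cs) lamt.
by rewrite e1 eqxx in ab.
Qed.

Lemma glabel_val N (a b : 'I_N) (phi : R) : (a < b)%N ->
  glabel phi a b = if (a == 0 :> nat)%N && (b == 1 :> nat)%N then phi
    else if b == a.+1 :> nat then 1 else 0.
Proof.
move=> ab; rewrite /glabel /zlabel.
have -> : ((a == 1 :> nat) && (b == 0 :> nat))%N = false.
  by case: b ab => [[|b'] hb] //= _; rewrite andbF.
rewrite orbF (_ : (a == b.+1 :> nat) = false) /=; last first.
  by apply/negbTE; rewrite neq_ltn ltnS ltnW.
by case: ifP => _; [|case: ifP => _]; rewrite /zev /= ?mul0r ?addr0 // add0r mul1r.
Qed.

Lemma lam2 a b : a != b -> (m a b <= 2)%N -> lam a b = 0.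
Proof.
move=> ab h; rewrite lamE (_ : m a b = 2%N) ?two_cos2 //.
by apply/eqP; rewrite eqn_leq h (m_gt1 cs rr).
Qed.

Lemma lam3 a b : m a b = 3%N -> lam a b = 1.
Proof. by rewrite lamE => ->; rewrite two_cos3. Qed.

Definition has_component (a : 'I_n) := exists K,
  [/\ closed_nodes K, mat_nodes K, a \in K & forall J, closed_nodes J -> a \in J -> K \subset J].

(** Beside the edge labelled 5 only the paths with labels 5, 3 and 5, 3, 3 remain, that is H3 and
    H4; every other neighbour leads to an excluded graph. *)
Lemma component5 i j k : uniq [:: i; j; k] -> m i j = 5%N -> (2 < m j k)%N -> has_component i.
Proof.
move=> u mij mjk; have nth3 := no_triangle cs rr u mij mjk.
have mjk3 := no_54 cs rr u mij mjk.
have /= := u; rewrite !inE !negb_or => /and3P [/andP [ij ik] jk _].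
have iJ J : closed_nodes J -> i \in J -> [/\ i \in J, j \in J & k \in J].
  move=> cJ iJ; have jJ : j \in J by apply: (closed_adj cJ iJ); rewrite mij.
  by split=> //; apply: (closed_adj cJ jJ).
case: (closed_or_neighbour cs rr [set x in [:: i; j; k]]) => [cK|[a [l [aK lK mal]]]].
  exists [set x in [:: i; j; k]]; split=> //; last 2 first.
  - by rewrite !inE eqxx.
  - move=> J cJ /(iJ _ cJ) [h1 h2 h3]; apply/subsetP => x.
    by rewrite !inE => /or3P [] /eqP ->.
  apply: (mat_nodes_diagram (i0 := i) u h3_check) => // x y xy; rewrite glabel_val //.
  case: x y xy => [[|[|[|x]]] hx] [[|[|[|y]]] hy] //= _.
  - by rewrite lamE mij.
  - exact: lam2.
  - exact: lam3.
rewrite !inE in aK lK; have ul : l \notin [:: i; j; k] by rewrite !inE.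
have mil := no_353 cs rr u mij mjk ul; have mjl := no_star_j cs rr u mij mjk ul.
have mkl : (2 < m k l)%N.
  by case/or3P: aK => /eqP ea; rewrite ea in mal => //; [move: mil|move: mjl];
    rewrite leqNgt mal.
have mkl3 : m k l = 3%N by apply/eqP; rewrite eqn_leq mkl (no_534 cs rr u mij mjk ul).
have u4 : uniq [:: i; j; k; l].
  by rewrite -[[:: i; j; k; l]]/(rcons [:: i; j; k] l) rcons_uniq ul u.
have [il jl kl] : [/\ i != l, j != l & k != l].
  by move: ul; rewrite !inE !negb_or ![l == _]eq_sym => /and3P [].
case: (closed_or_neighbour cs rr [set x in [:: i; j; k; l]]) => [cK|[b [p [bK pK mbp]]]].
  exists [set x in [:: i; j; k; l]]; split=> //; last 2 first.
  - by rewrite !inE eqxx.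
  - move=> J cJ /(iJ _ cJ) [h1 h2 h3]; have h4 := closed_adj cJ h3 mkl; apply/subsetP => x.
    by rewrite !inE => /or4P [] /eqP ->.
  apply: (mat_nodes_diagram (i0 := i) u4 h4_check) => // x y xy; rewrite glabel_val //.
  case: x y xy => [[|[|[|[|x]]]] hx] [[|[|[|[|y]]]] hy] //= _.
  - by rewrite lamE mij.
  - exact: lam2.
  - exact: lam2.
  - exact: lam3.
  - exact: lam2.
  - exact: lam3.
rewrite !inE in bK pK; have up : p \notin [:: i; j; k; l] by rewrite !inE.
have up3 : p \notin [:: i; j; k].
  by move: up; rewrite !inE !negb_or => /and4P [-> -> -> _].
exfalso; case/or4P: bK => /eqP eb; rewrite eb in mbp; move: mbp; rewrite ltnNge.
- by rewrite (no_353 cs rr u mij mjk up3).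
- by rewrite (no_star_j cs rr u mij mjk up3).
- by rewrite (no_star_k cs rr u mij mjk ul up mkl).
by rewrite (no_5333 cs rr u mij mjk ul up mkl).
Qed.

(** If no edge leaves the two nodes, the component is dihedral. Otherwise the label must be 5, and
    the end that carries the further edge plays the role of the middle node. *)
Lemma component_bad i j : i != j -> m i j = 5%N \/ (5 < m i j)%N ->
  exists K, [/\ closed_nodes K, mat_nodes K, (0 < #|K|)%N
    & forall J, closed_nodes J -> i \in J -> j \in J -> K \subset J].
Proof.
move=> ij mij.
case: (closed_or_neighbour cs rr [set i; j]) => [cK|[a [k [aK kK mak]]]].
  exists [set i; j]; split=> [//|||J cJ iJ jJ].
  - exact: (mat_nodes_rank2 cs rr ij cK).
  - by rewrite cards2.
  by apply/subsetP => x; rewrite !inE => /orP [] /eqP ->.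
have [ki kj] : k != i /\ k != j by move: kK; rewrite !inE negb_or => /andP.
have u : uniq [:: i; j; k] by rewrite /= !inE negb_or ij !(eq_sym _ k) ki kj.
have u' : uniq [:: j; i; k] by rewrite /= !inE negb_or (eq_sym j) ij !(eq_sym _ k) ki kj.
have conv x : x \in [set i; j] -> has_component x ->
    exists K, [/\ closed_nodes K, mat_nodes K, (0 < #|K|)%N
      & forall J, closed_nodes J -> i \in J -> j \in J -> K \subset J].
  move=> xij [K [cK mK xK sub]]; exists K; split=> //; first by apply/card_gt0P; exists x.
  by move=> J cJ iJ jJ; apply: sub => //; move: xij; rewrite !inE => /orP [] /eqP ->.
move: aK; rewrite !inE => /orP [] /eqP ea; rewrite ea in mak.
  case: mij => [m5|m6]; last first.
    by move: mak; rewrite ltnNge (no_neighbour_ge6 cs rr u') // (m_sym cs).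
  by apply: (conv j); rewrite ?inE ?eqxx ?orbT //; apply: (component5 u') => //;
    rewrite (m_sym cs).
case: mij => [m5|m6]; last by move: mak; rewrite ltnNge (no_neighbour_ge6 cs rr u).
by apply: (conv i); rewrite ?inE ?eqxx //; apply: (component5 u).
Qed.

(* Otherwise the sum of the simple roots of J has a nonpositive norm. *)
Lemma exists_leaf J : (0 < #|J|)%N ->
  exists2 k, k \in J & (#|[set j in J | (j != k) && (lam k j != 0%R)]| <= 1)%N.
Proof.
case/card_gt0P => i0 i0J; have [/exists_inP [k kJ h]|/exists_inPn no] :=
  boolP [exists k in J, (#|[set j in J | (j != k) && (lam k j != 0%R)]| <= 1)%N].
  by exists k.
exfalso; pose x : E := \sum_(i in J) e i.
have x0 : x != 0.
  apply/eqP => /rowP /(_ i0); rewrite summxE (bigD1 i0) //= big1 => [|i /andP [_ ii]].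
    by rewrite !mxE !eqxx addr0 => /eqP; rewrite oner_eq0.
  by rewrite mxE eqxx eq_sym (negbTE ii).
have B0l y : B 0 y = 0 by have := cformZl m 0 0 y; rewrite scale0r mul0r.
have B0r y : B y 0 = 0 by rewrite (cformC cs) B0l.
have := cform_pos cs rr x0; rewrite ltNge => /negP; apply.
rewrite /x big_mkcond cform_suml sumr_le0 // => i _; case: ifP => iJ; last first.
  by rewrite B0l.
rewrite cform_sumr (bigD1 i) //= iJ (cform_ii R cs).
suff : 2 <= \sum_(j | j != i) (if j \in J then lam i j else 0).
  move=> h; have -> : \sum_(j | j != i) B (e i) (if j \in J then e j else 0) =
      - (\sum_(j | j != i) (if j \in J then lam i j else 0)) / 2.
    rewrite -sumrN mulr_suml; apply: eq_bigr => j _; case: ifP => _.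
      by rewrite cform_e lam_def; field.
    by rewrite B0r oppr0 mul0r.
  by lra.
have := no i iJ; rewrite -ltnNge => h2.
apply: le_trans (_ : (#|[set j in J | (j != i) && (lam i j != 0)]|)%:R <= _).
  by rewrite ler_nat.
rewrite -sum1_card natr_sum big_mkcond [leRHS]big_mkcond; apply: ler_sum => j _.
rewrite inE; case: ifP => [/and3P [jJ ji lj]|_].
  by rewrite ji jJ lamE two_cos_ge1 // (lam_ge1 cs rr) // eq_sym.
by case: ifP => // ji; case: ifP => // _; apply: (lam_ge0 cs rr); rewrite eq_sym.
Qed.

(** Induction by removing a leaf [k] of the graph. Its length is constrained by at most one
    neighbour [j]; with [lam k j * L j] the two new Cartan integers are -1 and minus the square of
    [lam k j], which is 1, 2 or 3. *)
Lemma exists_lengths J :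
  (forall i j, i \in J -> j \in J -> i != j -> m i j \in [:: 2; 3; 4; 6]%N) ->
  exists L : 'I_n -> R, (forall i, i \in J -> 0 < L i) /\
    forall i j, i \in J -> j \in J -> 2 * C i j * L i / L j \is a Num.int.
Proof.
have [N] := ubnP #|J|; elim: N J => // N IH J leN good.
have [J0|J0] := leqP #|J| 0.
  exists (fun _ => 1); split=> [i|i j]; move: J0; rewrite leqn0 cards_eq0 => /eqP ->;
  by rewrite inE.
have [k kJ hk] := exists_leaf J0.
have sub i : i \in J :\ k -> i \in J /\ i != k by rewrite !inE => /andP [].
have [||L [L0 Li]] := IH (J :\ k).
- by move: leN; rewrite (cardsD1 k J) kJ.
- by move=> i j /sub [iJ _] /sub [jJ _]; apply: good.
pose Lk := if [pick j in [set j in J | (j != k) && (lam k j != 0)]] is Some j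
  then lam k j * L j else 1.
have lamkE j : j \in J -> j != k -> lam k j = 0 \/
    [/\ 0 < lam k j, Lk = lam k j * L j & lam k j ^+ 2 \is a Num.int].
  move=> jJ jk; have [->|lj] := eqVneq (lam k j) 0; [by left|right].
  have kj : k != j by rewrite eq_sym.
  have jS : j \in [set j in J | (j != k) && (lam k j != 0)] by rewrite inE jJ jk.
  split.
  - by rewrite lt_neqAle eq_sym lj (lam_ge0 cs rr).
  - rewrite /Lk; case: pickP => [j' j'S|/(_ j)]; last by rewrite jS.
    by have /card_le1P h := hk; have := h j' j'S j; rewrite jS inE => /esym /eqP ->.
  have := good k j kJ jJ kj; move: lj; rewrite lamE !inE => lj /or4P [] /eqP e1; rewrite e1 in lj *.
  - by rewrite two_cos2 eqxx in lj.
  - by rewrite two_cos3 expr1n.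
  - by rewrite two_cos4 (natr_int R 2).
  - by rewrite two_cos6 (natr_int R 3).
have Lk0 : 0 < Lk.
  rewrite /Lk; case: pickP => // j; rewrite inE => /and3P [jJ jk lj].
  rewrite mulr_gt0 //; last by apply: L0; rewrite !inE jk.
  by rewrite lt_neqAle eq_sym lj (lam_ge0 cs rr) // eq_sym.
exists (fun i => if i == k then Lk else L i); split=> [i iJ|i j iJ jJ].
  by case: ifP => // /negbT ik; apply: L0; rewrite !inE ik.
have CE a b : C a b = - lam a b / 2 by rewrite lam_def; field.
have int2 : 2 \is a @Num.int R by apply: (natr_int R 2).
case: ifP => [/eqP ->|/negbT ik]; case: ifP => [/eqP ->|/negbT jk].
- by rewrite -cform_e (cform_ii R cs) mulr1 mulfK // gt_eqF.
- have lj0 : 0 < L j by apply: L0; rewrite !inE jk.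
  rewrite CE; case: (lamkE j jJ jk) => [->|[l0 -> hi]].
    by rewrite oppr0 !mul0r mulr0 !mul0r.
  rewrite (_ : _ / L j = - lam k j ^+ 2) ?rpredN //; field; by rewrite gt_eqF.
- have li0 : 0 < L i by apply: L0; rewrite !inE ik.
  rewrite CE (lamC R cs); case: (lamkE i iJ ik) => [->|[l0 -> hi]].
    by rewrite oppr0 !mul0r mulr0 !mul0r.
  rewrite (_ : _ / (_ * L i) = - 1) ?rpredN ?rpred1 //; field.
  by rewrite !gt_eqF.
by apply: Li; rewrite !inE ?ik ?jk.
Qed.

(** A component with a label other than 2, 3, 4, 6 is split off and induction applies to the rest,
    which is again closed. When there is none, [exists_lengths] provides a root system. *)
Theorem mat_nodes_closed J : closed_nodes J -> mat_nodes J.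
Proof.
have [N] := ubnP #|J|; elim: N J => // N IH J leN cJ.
have [/existsP [i /existsP [j /and4P [iJ jJ ij bad]]]|good] :=
  boolP [exists i, exists j, [&& i \in J, j \in J, i != j & m i j \notin [:: 2; 3; 4; 6]%N]].
  have mij : m i j = 5%N \/ (5 < m i j)%N.
    move: bad (m_gt1 cs rr ij); rewrite !inE; case: (m i j) => [|[|[|[|[|[|q]]]]]] //; auto.
  have [K [cK mK K0 sub]] := component_bad ij mij.
  have KJ := sub J cJ iJ jJ.
  have cD : closed_nodes (J :\: K).
    move=> a b; rewrite !inE => /andP [aK aJ]; rewrite negb_and negbK => /orP [bK|bJ].
      by rewrite (cox_sym R cs) cK.
    exact: cJ.
  have -> : J = K :|: (J :\: K).
    by apply/setP => x; rewrite !inE; case: (boolP (x \in K)) => // /(subsetP KJ) ->.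
  apply: (mat_nodes_union rr) => //.
    rewrite disjoint_sym disjoints_subset; apply/subsetP => x.
    by rewrite !inE => /andP [].
  apply: IH => //; move: leN; rewrite -(cardsID K J) (setIidPr KJ).
  by move: K0; lia.
have [|L [L0 Li]] := @exists_lengths J.
  move=> i j iJ jJ ij; apply: contraNT good => bad.
  by apply/existsP; exists i; apply/existsP; exists j; rewrite iJ jJ ij.
exact (mat_nodes_cryst cs rr cJ L0 Li).
Qed.

End Components.

Theorem theorem1p6 (R : realType) (n : nat) (W : finGroupType)
    (m : 'M[nat]_n) (s : 'I_n -> W) (rho : mx_representation R [set: W] n) :
  coxeter_system m s ->
  reflection_representation m s rho ->
  accurate (coxeter_arrangement rho).
Proof.
move=> cs rr; apply: (mat_nodes_accurate cs rr); apply: (mat_nodes_closed cs rr).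
by move=> i j _; rewrite inE.
Qed.
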